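(* Let $\overline{X}=(X_0,X_1)$ be a compatible pair of complex Banach spaces, $\Sigma=X_0+X_1$, and let $\theta\in(0,1)$. Then the image of the evaluation map $$H^{\infty}(\overline{X})\to\Sigma,\qquad f\mapsto f(\theta),$$ is the (first) Calderón space $\overline{X}_\theta$.
   Context: A compatible pair $\overline{X}=(X_0,X_1)$ consists of two complex Banach spaces continuously embedded in a common Hausdorff topological vector space. $\Sigma=X_0+X_1$ is a Banach space with norm $\|a\|_\Sigma=\inf\{\|a_0\|_{X_0}+\|a_1\|_{X_1}: a=a_0+a_1,\ a_k\in X_k\}$. Let $S=\{z\in\mathbb{C}:0\le \operatorname{Re} z\le 1\}$ and $S^i=\{0<\operatorname{Re} z<1\}$, $z=x+iy$; regard $(0,1)\subset S^i$. $H^\infty(\Sigma)$ is the space of bounded holomorphic functions $f:S^i\to\Sigma$, with norm $\sup_{z\in S^i}\|f(z)\|_\Sigma$. Every $f\in H^\infty(\Sigma)$ has distributional boundary values $f(i\cdot)$ and $f(1+i\cdot)$: the $\Sigma$-valued distributions on $\mathbb{R}$ (continuous linear maps $C_c^\infty(\mathbb{R})\to\Sigma$) given by $\varphi\mapsto\lim_{\varepsilon\to0^+}\int f(\varepsilon+iy)\varphi(y)\,dy$ and $\varphi\mapsto\lim_{\varepsilon\to0^+}\int f(1-\varepsilon+iy)\varphi(y)\,dy$, respectively. For a Banach space $X$, $L^\infty(X)$ denotes the space of (classes of) essentially bounded strongly measurable functions $g:\mathbb{R}\to X$ (Lebesgue measure), with the essential sup norm; a function $g\in L^\infty(X_k)$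 is identified with the $\Sigma$-valued distribution $\varphi\mapsto\int g(y)\varphi(y)\,dy$. $H^\infty(\overline{X})$ is the space of all $f\in H^\infty(\Sigma)$ such that $f(i\cdot)\in L^\infty(X_0)$ and $f(1+i\cdot)\in L^\infty(X_1)$, with norm $\max(\|f(i\cdot)\|_{L^\infty(X_0)},\|f(1+i\cdot)\|_{L^\infty(X_1)})$. $A(\Sigma)$ is the space of those $f\in H^\infty(\Sigma)$ having a continuous extension $S\to\Sigma$. $A(\overline{X})$ is the space of those $f\in A(\Sigma)$ such that, for $k=0,1$, $y\mapsto f(k+iy)$ is a bounded continuous function $\mathbb{R}\to X_k$; it is a closed subspace of $H^\infty(\overline{X})$. The first Calderón space is $\overline{X}_\theta=\{f(\theta): f\in A(\overline{X})\}\subseteq\Sigma$, with the quotient norm $\|a\|_{\overline{X}_\theta}=\inf\{\|f\|_{H^\infty(\overline{X})}: f\in A(\overline{X}),\ f(\theta)=a\}$. *)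

(* Defs.v *)
From HB Require Import structures.
From mathcomp Require Import all_boot all_order all_algebra.
From mathcomp Require Import complex lra.
From mathcomp Require Import all_classical all_reals all_analysis.

Set Implicit Arguments.
Unset Strict Implicit.
Unset Printing Implicit Defensive.

Import Order.TTheory GRing.Theory Num.Theory.
Import numFieldNormedType.Exports.

Local Open Scope classical_set_scope.
Local Open Scope ring_scope.

(* The norm of a complex normed space is valued in R[i] in the library;
   [rnorm] is the same norm, read as an element of R. *)
Definition rnorm (R : realType) (E : normedModType R[i]) (x : E) : R :=
  complex.Re `|x|.

Lemma rnormE (R : realType) (E : normedModType R[i]) (x : E) :
  (rnorm x)%:C%C = `|x|.
Proof.
have := normr_ge0 x; rewrite /rnorm; case: (`|x|) => a b.
by rewrite lecE /= => /andP[/eqP-> _].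
Qed.

(* The two spaces X_0, X_1 are indexed by the booleans: false is 0 and true
   is 1. *)
Record compatible_pair (R : realType) := CompatiblePair {
  space : bool -> completeNormedModType R[i];
  ambient : topologicalLmodType R[i];
  ambient_hausdorff : hausdorff_space ambient;
  emb : forall k, {linear space k -> ambient};
  emb_inj : forall k, injective (emb k);
  emb_continuous : forall k, continuous (emb k) }.

Section SumSpace.
Context (R : realType) (P : compatible_pair R).

Definition in_sum : {pred ambient P} :=
  fun v => `[< exists x0 x1, v = emb P false x0 + emb P true x1 >].

Lemma in_sumP v :
  reflect (exists x0 x1, v = emb P false x0 + emb P true x1) (v \in in_sum).
Proof. exact: asboolP. Qed.

Lemma in_sum_submod : submod_closed in_sum.
Proof.
split; first by apply/in_sumP; exists 0, 0; rewrite !linear0 addr0.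
move=> a u v /in_sumP[x0 [x1 ->]] /in_sumP[y0 [y1 ->]].
apply/in_sumP; exists (a *: x0 + y0), (a *: x1 + y1).
by rewrite !linearP scalerDr addrACA.
Qed.

HB.instance Definition _ :=
  GRing.isSubmodClosed.Build R[i] (ambient P) in_sum in_sum_submod.

(* Sigma = X_0 + X_1, with the norm of the sum space (and not with the
   topology of the ambient space). *)
Record Sigma := MkSigma { sigma_val : ambient P; _ : sigma_val \in in_sum }.

HB.instance Definition _ := [isSub for sigma_val].
HB.instance Definition _ := [Choice of Sigma by <:].
HB.instance Definition _ := [SubChoice_isSubLmodule of Sigma by <:].

Definition decomposition_norms (a : Sigma) : set R :=
  [set r | exists x0 x1,
     sigma_val a = emb P false x0 + emb P true x1 /\ r = rnorm x0 + rnorm x1].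

Definition sigma_norm (a : Sigma) : R := inf (decomposition_norms a).


Lemma decomposition_norms_neq0 a : decomposition_norms a !=set0.
Proof.
by case: a => v /[dup] /in_sumP[x0 [x1 e]] h; exists (rnorm x0 + rnorm x1), x0, x1.
Qed.

Lemma rnorm_ge0 (E : normedModType R[i]) (x : E) : 0 <= rnorm x.
Proof. by rewrite -lecR rnormE normr_ge0. Qed.

Lemma rnormD (E : normedModType R[i]) (x y : E) :
  rnorm (x + y) <= rnorm x + rnorm y.
Proof. by rewrite -lecR rmorphD /= !rnormE ler_normD. Qed.

Lemma rnormZ (E : normedModType R[i]) (l : R[i]) (x : E) :
  rnorm (l *: x) = complex.Re `|l| * rnorm x.
Proof.
by apply: complexI; rewrite rmorphM /= !rnormE normrZ (@rnormE _ R[i]^o l).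
Qed.

Lemma decomposition_norms_lb a : lbound (decomposition_norms a) 0.
Proof. by move=> r [x0 [x1 [_ ->]]]; rewrite addr_ge0 ?rnorm_ge0. Qed.

Lemma sigma_norm_le a x0 x1 :
  sigma_val a = emb P false x0 + emb P true x1 ->
  sigma_norm a <= rnorm x0 + rnorm x1.
Proof.
move=> e; apply: ge_inf; last by exists x0, x1.
by exists 0; exact: decomposition_norms_lb.
Qed.

Lemma sigma_norm_lt a (e : R) : sigma_norm a < e ->
  exists x0 x1, sigma_val a = emb P false x0 + emb P true x1 /\
                rnorm x0 + rnorm x1 < e.
Proof.
have lb : has_inf (decomposition_norms a).
  split; first exact: decomposition_norms_neq0.
  by exists 0; exact: decomposition_norms_lb.
move=> ae; have [] := inf_adherent (eps := e - sigma_norm a) _ lb.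
  by rewrite subr_gt0.
move=> r [x0 [x1 [h ->]]]; rewrite /sigma_norm subrKC => h'.
by exists x0, x1.
Qed.

Lemma sigma_norm_ge0 a : 0 <= sigma_norm a.
Proof.
by apply: lb_le_inf; [exact: decomposition_norms_neq0
                     |exact: decomposition_norms_lb].
Qed.

Lemma sigma_normD a b : sigma_norm (a + b) <= sigma_norm a + sigma_norm b.
Proof.
apply/ler_addgt0Pr => e e0.
have e2 : 0 < e / 2 by rewrite divr_gt0.
have [x0 [x1 [hx lx]]] : exists x0 x1,
    sigma_val a = emb P false x0 + emb P true x1 /\
    rnorm x0 + rnorm x1 < sigma_norm a + e / 2.
  by apply: sigma_norm_lt; rewrite ltrDl.
have [y0 [y1 [hy ly]]] : exists x0 x1,
    sigma_val b = emb P false x0 + emb P true x1 /\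
    rnorm x0 + rnorm x1 < sigma_norm b + e / 2.
  by apply: sigma_norm_lt; rewrite ltrDl.
have /sigma_norm_le h : sigma_val (a + b) =
    emb P false (x0 + y0) + emb P true (x1 + y1).
  by rewrite !linearD addrACA -hx -hy.
have D0 := rnormD x0 y0; have D1 := rnormD x1 y1.
by lra.
Qed.

Lemma sigma_normZ_le (l : R[i]) a :
  sigma_norm (l *: a) <= complex.Re `|l| * sigma_norm a.
Proof.
have l0 : 0 <= complex.Re `|l| by exact: (@rnorm_ge0 R[i]^o l).
apply/ler_addgt0Pr => e e0.
have l1 : 0 < complex.Re `|l| + 1 by lra.
have e1 : 0 < e / (complex.Re `|l| + 1) by rewrite divr_gt0.
have [x0 [x1 [hx lx]]] : exists x0 x1,
    sigma_val a = emb P false x0 + emb P true x1 /\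
    rnorm x0 + rnorm x1 < sigma_norm a + e / (complex.Re `|l| + 1).
  by apply: sigma_norm_lt; rewrite ltrDl.
have /sigma_norm_le h : sigma_val (l *: a) =
    emb P false (l *: x0) + emb P true (l *: x1).
  by rewrite !linearZ /= -scalerDr -hx.
apply: (le_trans h); rewrite !rnormZ -mulrDr.
apply: (le_trans (ler_wpM2l l0 (ltW lx))); rewrite mulrDr lerD2l.
rewrite mulrCA ger_pMr// ler_pdivrMr// mul1r; lra.
Qed.

Lemma sigma_normZ (l : R[i]) a :
  sigma_norm (l *: a) = complex.Re `|l| * sigma_norm a.
Proof.
apply/eqP; rewrite eq_le sigma_normZ_le andTb.
have l0 : 0 <= complex.Re `|l| by exact: (@rnorm_ge0 R[i]^o l).
have [->|ln0] := eqVneq l 0.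
  by rewrite normr0 mul0r sigma_norm_ge0.
have := sigma_normZ_le l^-1 (l *: a).
rewrite scalerA mulVf // scale1r => /(ler_wpM2l l0) h.
apply: (le_trans h); rewrite mulrA.
suff -> : complex.Re `|l| * complex.Re `|l^-1| = 1 by rewrite mul1r.
apply: complexI; rewrite rmorphM /= (@rnormE _ R[i]^o l).
by rewrite (@rnormE _ R[i]^o l^-1) -normrM mulfV // normr1.
Qed.

(* This is where the ambient space has to be Hausdorff. *)
Lemma sigma_norm0_eq0 a : sigma_norm a = 0 -> a = 0.
Proof.
move=> a0; apply: val_inj => /=; apply/esym/(@ambient_hausdorff R P).
move=> A B A0 Ba.
pose F (x : space P false * space P true) := emb P false x.1 + emb P true x.2.
have F0 : F @ (0, 0) --> (0 : ambient P).
  rewrite -[X in _ --> X](_ : F (0, 0) = 0); last by rewrite /F !linear0 addr0.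
  apply: (@continuous_comp _ _ _
    (fun x : space P false * space P true => (emb P false x.1, emb P true x.2))
    (fun v : ambient P * ambient P => v.1 + v.2)); last exact: add_continuous.
  apply: cvg_pair.
    by apply: continuous_comp; [exact: cvg_fst|exact: emb_continuous].
  by apply: continuous_comp; [exact: cvg_snd|exact: emb_continuous].
have [[/= U V] [/nbhs_ballP[e /= e0 Ue] /nbhs_ballP[d /= d0 Vd]] UV] :=
  F0 _ A0.
have real_pos (t : R[i]) : 0 < t -> (complex.Re t)%:C%C = t /\ 0 < complex.Re t.
  by case: t => u v; rewrite ltcE /= => /andP[/eqP-> ->].
have [re eR] := real_pos _ e0; have [rd dR] := real_pos _ d0.
have [x0 [x1 [hx lx]]] := @sigma_norm_lt a
  (Num.min (complex.Re e) (complex.Re d)) ltac:(by rewrite a0 lt_min eR dR).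
exists (sigma_val a); split; last exact: nbhs_singleton.
rewrite hx; apply: (UV (x0, x1)); split.
  apply: Ue; rewrite -ball_normE /= sub0r normrN -rnormE -re ltcR.
  move: lx; rewrite lt_min => /andP[+ _]; have := rnorm_ge0 x1; lra.
apply: Vd; rewrite -ball_normE /= sub0r normrN -rnormE -rd ltcR.
move: lx; rewrite lt_min => /andP[_]; have := rnorm_ge0 x0; lra.
Qed.

Definition sigma_cnorm (a : Sigma) : R[i] := (sigma_norm a)%:C%C.

Lemma sigma_cnormD a b : sigma_cnorm (a + b) <= sigma_cnorm a + sigma_cnorm b.
Proof. by rewrite /sigma_cnorm -rmorphD /= lecR sigma_normD. Qed.

Lemma sigma_cnormZ (l : R[i]) a : sigma_cnorm (l *: a) = `|l| * sigma_cnorm a.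
Proof.
by rewrite /sigma_cnorm sigma_normZ rmorphM /= (@rnormE _ R[i]^o l).
Qed.

Lemma sigma_cnorm0_eq0 a : sigma_cnorm a = 0 -> a = 0.
Proof. by move/complexI/sigma_norm0_eq0. Qed.

HB.instance Definition _ := Lmodule_isNormed.Build R[i] Sigma
  sigma_cnormD sigma_cnormZ sigma_cnorm0_eq0.

End SumSpace.

Section Inclusion.
Context (R : realType) (P : compatible_pair R).

Lemma emb_in_sum k (x : space P k) : emb P k x \in @in_sum R P.
Proof.
apply/in_sumP; case: k x => x; first by exists 0, x; rewrite linear0 add0r.
by exists x, 0; rewrite linear0 addr0.
Qed.

(* The inclusion of X_k into Sigma. *)
Definition incl k (x : space P k) : Sigma P := MkSigma (emb_in_sum x).

End Inclusion.

Section BochnerIntegral.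
Context (R : realType) (E : normedModType R[i]).
Implicit Types (s h : R -> E) (v : E).
Local Notation mu := (@lebesgue_measure R).

Definition simple_fun s :=
  finite_set (range s) /\ forall x, measurable (s @^-1` [set x]).

Definition integrable_simple_fun s :=
  simple_fun s /\ forall x, x != 0 -> (mu (s @^-1` [set x]) < +oo)%E.

(* The value 0 contributes nothing, even if it is taken on a set of infinite
   measure. *)
Definition simple_integral s : E :=
  \sum_(x \in range s) (fine (mu (s @^-1` [set x])))%:C%C *: x.

(* The library's measurable subsets of R are the Borel sets; since convergence
   is only required almost everywhere, Lebesgue measurable level sets would
   give the same functions. *)
Definition strongly_measurable h :=
  exists2 s : nat -> R -> E, forall n, simple_fun (s n) &
    {ae mu, forall y, s n y @[n --> \oo] --> h y}.

Definition is_bochner_integral h v :=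
  strongly_measurable h /\
  exists s : nat -> R -> E,
    [/\ forall n, integrable_simple_fun (s n),
        (\int[mu]_y (rnorm (h y - s n y))%:E)%E @[n --> \oo] --> 0%E &
        simple_integral (s n) @[n --> \oo] --> v].

(* Equal to 0 if h is not integrable. *)
Definition bochner_integral h : E := xget 0 (is_bochner_integral h).

Definition Linfty h :=
  strongly_measurable h /\ exists M : R, {ae mu, forall y, rnorm (h y) <= M}.

End BochnerIntegral.

(* The complex valued functions in C_c^oo(R). *)
Definition test_function (R : realType) (phi : R -> R[i]) :=
  [/\ forall n y, derivable (derive1n n (fun t => complex.Re (phi t))) y 1,
      forall n y, derivable (derive1n n (fun t => complex.Im (phi t))) y 1 &
      compact (closure [set y | phi y != 0])].

Section CalderonSpaces.
Context (R : realType) (P : compatible_pair R).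

Definition open_strip : set R[i]^o := [set z | 0 < complex.Re z < 1].
Definition closed_strip : set R[i]^o := [set z | 0 <= complex.Re z <= 1].

(* The point k + iy. *)
Definition bpoint (k : bool) (y : R) : R[i]^o := Complex (k%:R : R) y.

(* The point eps + iy if k = 0, and 1 - eps + iy if k = 1. *)
Definition near_bpoint (k : bool) (eps y : R) : R[i]^o :=
  Complex (if k then 1 - eps else eps) y.

(* A function on the open strip is represented by a function on R[i]; only
   its values on the open strip are relevant. *)
Definition Hinfty_Sigma (f : R[i]^o -> Sigma P) :=
  (forall z, open_strip z -> derivable f z 1) /\
  exists M : R, forall z, open_strip z -> rnorm (f z) <= M.

(* The distributional boundary value f(k + i.) is the distribution defined
   by the function g with values in X_k. *)
Definition has_boundary_value (f : R[i]^o -> Sigma P) k (g : R -> space P k) :=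
  forall phi : R -> R[i], test_function phi ->
    bochner_integral (fun y => phi y *: f (near_bpoint k eps y))
      @[eps --> (0 : R)^'+] -->
    bochner_integral (fun y => phi y *: incl (g y)).

Definition Hinfty (f : R[i]^o -> Sigma P) :=
  Hinfty_Sigma f /\
  forall k, exists2 g : R -> space P k, Linfty g & has_boundary_value f g.

Definition continuous_extension (f F : R[i]^o -> Sigma P) :=
  {within closed_strip, continuous F} /\ forall z, open_strip z -> F z = f z.

Definition A_Sigma (f : R[i]^o -> Sigma P) :=
  Hinfty_Sigma f /\ exists F, continuous_extension f F.

Definition A_space (f : R[i]^o -> Sigma P) :=
  A_Sigma f /\
  exists2 F, continuous_extension f F &
    forall k, exists g : R -> space P k,
      [/\ continuous g, exists M : R, forall y, rnorm (g y) <= M &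
          forall y, F (bpoint k y) = incl (g y)].

Definition eval_at (theta : R) (f : R[i]^o -> Sigma P) : Sigma P :=
  f (theta%:C%C).

Definition calderon_space (theta : R) : set (Sigma P) :=
  eval_at theta @` [set f | A_space f].

End CalderonSpaces.

Arguments eval_at {R P} theta f.
Arguments calderon_space {R} P theta.

(* Main.v *)
From HB Require Import structures.
Require Import Defs.
From mathcomp Require Import all_boot all_order all_algebra.
From mathcomp Require Import complex zify ring lra.
From mathcomp Require Import all_classical all_reals all_analysis.
From mathcomp Require Import measurable_realfun.

(** By bounded convergence a function in A(X) has its continuous boundary values
    as distributional boundary values ([A_space_Hinfty]), so that the Calderon space
    is contained in the image of H^oo(X). The point is to replace a function f in
    H^oo(X) by one in A(X) with the same value at theta.

    Let g_k be the boundary values of f. Averaging f over vertical segments of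
    length 2d replaces g_k by continuous functions, but changes the value at theta.
    As d tends to 0 these functions converge to g_k in mean on bounded intervals
    ([average_mean]), by Lebesgue's differentiation theorem, but not uniformly. This
    is repaired as follows. If the boundary values of v are small in mean, there is a
    holomorphic function H with positive real part such that Re H dominates the norms
    of the boundary values while H(theta) is small; H is essentially their Poisson
    integral ([majorant]). Then H(theta) v / H has the same value as v at theta and
    boundary values that are uniformly small ([correction]). When the differences of
    consecutive averages are corrected in this way, their sum converges uniformly on
    the boundary, hence in the strip by the maximum principle, to a function in A(X)
    ([limit_A_space]), and its value at theta is the limit of the values of the
    averages ([corrected_limit]). All functions are multiplied by 1/(1+z), which gives
    decay at infinity and a constant factor at theta.

    Distributional boundary values enter through a primitive G of f, which exists by
    Goursat's theorem ([primitive]). It is Lipschitz, so it extends to the closed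
    strip, and testing against bumps shows that its increments along the boundary are
    the integrals of the g_k ([Hinfty_primitive]). The averages of f are difference
    quotients of G; hence they are continuous on the closed strip, have the averages
    of the g_k as boundary values, and are twice differentiable inside, because f is
    differentiable. For the norm of a twice differentiable function the mean value
    inequality over four points holds up to o(s^2) ([holo2_four_point]), which yields
    the maximum principle, a Schwarz lemma and the differentiability of uniform limits
    ([max_principle], [schwarz], [uniform_limit_derivable]). *)

Set Implicit Arguments.
Unset Strict Implicit.
Unset Printing Implicit Defensive.

Import Order.TTheory GRing.Theory Num.Theory.
Import numFieldNormedType.Exports.

Local Open Scope classical_set_scope.
Local Open Scope ring_scope.

(** * Moduli and norms as real numbers *)

Section Modulus.
Context (R : realType).
Implicit Types (z w : R[i]) (x y : R).

Definition cmod z : R := complex.Re `|z|.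

Lemma cmodE z : (cmod z)%:C%C = `|z|.
Proof. exact: (@rnormE _ R[i]^o z). Qed.

Lemma cmod_sqrt z : cmod z = Num.sqrt (complex.Re z ^+ 2 + complex.Im z ^+ 2).
Proof. by rewrite /cmod normc_def. Qed.

Lemma cmod_ge0 z : 0 <= cmod z. Proof. exact: (@rnorm_ge0 _ R[i]^o z). Qed.

Lemma cmodM z w : cmod (z * w) = cmod z * cmod w.
Proof. exact: (@rnormZ _ R[i]^o z w). Qed.

Lemma cmodD z w : cmod (z + w) <= cmod z + cmod w.
Proof. exact: (@rnormD _ R[i]^o z w). Qed.

Lemma cmodN z : cmod (- z) = cmod z. Proof. by rewrite /cmod normrN. Qed.

Lemma cmodB z w : cmod (z - w) = cmod (w - z).
Proof. by rewrite -cmodN opprB. Qed.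

Lemma cmod0 : cmod 0 = 0. Proof. by rewrite /cmod normr0. Qed.
Lemma cmod1 : cmod 1 = 1 :> R. Proof. by rewrite /cmod normr1. Qed.

Lemma cmodV z : cmod z^-1 = (cmod z)^-1.
Proof.
have [->|z0] := eqVneq z 0; first by rewrite invr0 cmod0 invr0.
apply: (mulfI (x := cmod z)); first by rewrite /cmod -(inj_eq (@complexI R)) cmodE normr_eq0.
by rewrite -cmodM mulfV// mulfV ?cmod1// -(inj_eq (@complexI R)) cmodE normr_eq0.
Qed.

Lemma cmod_real x : cmod x%:C%C = `|x|.
Proof. by rewrite cmod_sqrt /= expr0n /= addr0 sqrtr_sqr. Qed.

Lemma cmodi : cmod 'i%C = 1.
Proof. by rewrite cmod_sqrt /= expr0n expr1n /= add0r sqrtr1. Qed.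

Lemma cmodX z n : cmod (z ^+ n) = cmod z ^+ n.
Proof. by elim: n => [|n ih]; rewrite ?expr0 ?cmod1// !exprS cmodM ih. Qed.

Lemma cmod_eq0 z : (cmod z == 0) = (z == 0).
Proof.
apply/eqP/eqP => [h|->]; last exact: cmod0.
by apply: normr0_eq0; rewrite -cmodE h.
Qed.

Lemma cmod_gt0 z : (0 < cmod z) = (z != 0).
Proof. by rewrite lt_neqAle cmod_ge0 andbT eq_sym cmod_eq0. Qed.

Lemma ler_Re z : `|complex.Re z| <= cmod z.
Proof. by rewrite -lecR cmodE normc_ge_Re. Qed.

Lemma ler_Im z : `|complex.Im z| <= cmod z.
Proof.
by rewrite cmod_sqrt -sqrtr_sqr ler_wsqrtr// lerDr sqr_ge0.
Qed.

Lemma cmod_le z : cmod z <= `|complex.Re z| + `|complex.Im z|.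
Proof.
have -> : z = (complex.Re z)%:C%C + 'i%C * (complex.Im z)%:C%C.
  by case: z => a b; apply/eqP; rewrite eq_complex /= !(mul0r,mulr0,mul1r,subr0,addr0,add0r) !eqxx.
apply: (le_trans (cmodD _ _)).
by rewrite cmodM cmodi mul1r !cmod_real /= !(mul0r,mulr0,mul1r,subr0,addr0,add0r).
Qed.

Lemma real_pos (e : R[i]) : 0 < e -> (complex.Re e)%:C%C = e /\ 0 < complex.Re e.
Proof. by case: e => u v; rewrite ltcE /= => /andP[/eqP-> ->]. Qed.

End Modulus.

Lemma distm_lt (R : realType) (E : normedModType R[i]) (x y : E) (e : R) :
  (`|x - y| < e%:C%C) = (rnorm (x - y) < e).
Proof. by rewrite -rnormE ltcR. Qed.

Section RNorm.
Context (R : realType) (E : normedModType R[i]).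
Implicit Types (x y : E).

Lemma rnorm0 : rnorm (0 : E) = 0. Proof. by rewrite /rnorm normr0. Qed.
Lemma rnormN x : rnorm (- x) = rnorm x. Proof. by rewrite /rnorm normrN. Qed.
Lemma rnormB x y : rnorm (x - y) = rnorm (y - x).
Proof. by rewrite -rnormN opprB. Qed.

Lemma rnorm_scale (l : R[i]) x : rnorm (l *: x) = cmod l * rnorm x.
Proof. exact: rnormZ. Qed.

Lemma rnorm_eq0 x : (rnorm x == 0) = (x == 0).
Proof.
apply/eqP/eqP => [h|->]; last exact: rnorm0.
by apply: normr0_eq0; rewrite -rnormE h.
Qed.

Lemma rnorm_tri y x z : rnorm (x - z) <= rnorm (x - y) + rnorm (y - z).
Proof. by apply: le_trans (rnormD _ _); rewrite addrA subrK. Qed.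

Lemma rnorm_subr x y : rnorm (x - y) <= rnorm x + rnorm y.
Proof. by rewrite -(rnormN y) rnormD. Qed.

Lemma rnorm_lip x y : `|rnorm x - rnorm y| <= rnorm (x - y).
Proof.
rewrite ler_norml; apply/andP; split.
  have := rnormD (y - x) x; rewrite subrK (rnormB y x); lra.
by have := rnormD (x - y) y; rewrite subrK; lra.
Qed.

Lemma rnorm_sum (I : Type) (r : seq I) (F : I -> E) :
  rnorm (\sum_(i <- r) F i) <= \sum_(i <- r) rnorm (F i).
Proof.
elim: r => [|i r ih]; first by rewrite !big_nil rnorm0.
by rewrite !big_cons (le_trans (rnormD _ _))// lerD2l.
Qed.

Lemma rnorm_le_eps x : (forall e : R, 0 < e -> rnorm x <= e) -> x = 0.
Proof.
move=> h; apply/eqP; rewrite -rnorm_eq0 eq_le rnorm_ge0 andbT.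
by apply/ler_addgt0Pr => e e0; rewrite add0r h.
Qed.

Lemma cvg_rnormP (T : Type) (F : set_system T) (FF : Filter F) (f : T -> E) l :
  f @ F --> l <-> (forall e : R, 0 < e -> \forall t \near F, rnorm (f t - l) < e).
Proof.
rewrite cvgrPdist_lt; split => [h e e0|h e /real_pos[<- e0]].
  have : (0 : R[i]) < e%:C%C by rewrite ltcR.
  by move/h; apply: filterS => t; rewrite distm_lt rnormB.
by apply: filterS (h _ e0) => t; rewrite distm_lt rnormB.
Qed.

Lemma nbhs_rnormP (a : E) (A : set E) :
  nbhs a A <-> exists2 e : R, 0 < e & forall x, rnorm (x - a) < e -> A x.
Proof.
split=> [/nbhs_normP[e /= /real_pos[<- e0] h]|[e e0 h]].
  by exists (complex.Re e) => // x xe; apply: h; rewrite /= distm_lt rnormB.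
apply/nbhs_normP; exists e%:C%C; first by rewrite /= ltcR.
by move=> x /=; rewrite distm_lt rnormB => /h.
Qed.

Definition tends (u : nat -> E) (l : E) :=
  forall e : R, 0 < e -> exists N, forall n, (N <= n)%N -> rnorm (u n - l) < e.

Definition cauchy_sequence (u : nat -> E) :=
  forall e : R, 0 < e -> exists N, forall m n, (N <= m)%N -> (N <= n)%N ->
    rnorm (u m - u n) < e.

Lemma tendsP u l : tends u l <-> u @ \oo --> l.
Proof.
split=> [h|/cvg_rnormP h e /h[N _ hN]]; last by exists N => n; exact: hN.
by apply/cvg_rnormP => e /h[N hN]; exists N.
Qed.

Lemma tends_uniq u l m : tends u l -> tends u m -> l = m.
Proof.
move=> h h'; apply/eqP; rewrite -subr_eq0; apply/eqP/rnorm_le_eps => e e0.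
have e2 : 0 < e / 2 by lra.
have [N hN] := h _ e2; have [N' hN'] := h' _ e2.
have := hN (maxn N N') (leq_maxl _ _); have := hN' (maxn N N') (leq_maxr _ _).
have := rnorm_tri (u (maxn N N')) l m; rewrite (rnormB l (u _)); lra.
Qed.

Lemma tends_le u l v (r : R) :
  tends u l -> (forall n, rnorm (u n - v) <= r) -> rnorm (l - v) <= r.
Proof.
move=> h hr; apply/ler_addgt0Pr => e /h[N hN].
have := hN _ (leqnn N); have := hr N; have := rnorm_tri (u N) l v.
by rewrite (rnormB l (u N)); lra.
Qed.

Lemma tendsD u v l m : tends u l -> tends v m -> tends (fun n => u n + v n) (l + m).
Proof. by move=> /tendsP h /tendsP h'; apply/tendsP; exact: cvgD. Qed.

Lemma tends_scale (c : R[i]) u l : tends u l -> tends (fun n => c *: u n) (c *: l).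
Proof. by move=> /tendsP h; apply/tendsP; exact: cvgZr. Qed.

Lemma tends_cst l : tends (fun=> l) l.
Proof. by move=> e e0; exists 0%N => n _; rewrite subrr rnorm0. Qed.

Lemma tends_eq u v l : tends u l -> (forall n, u n = v n) -> tends v l.
Proof. by move=> h e eps /h[N hN]; exists N => n /hN; rewrite e. Qed.

Definition seq_complete := forall u, cauchy_sequence u -> exists l, tends u l.

(** Pass to a subsequence whose increments decrease geometrically. *)
Lemma seq_complete_geometric :
  (forall u : nat -> E, (forall n, rnorm (u n.+1 - u n) <= 2^-1 ^+ n) ->
     exists l, tends u l) -> seq_complete.
Proof.
move=> H u cu.
have /choice[N hN] : forall k : nat, exists N, forall m n, (N <= m)%N -> (N <= n)%N ->
    rnorm (u m - u n) < 2^-1 ^+ k.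
  by move=> k; apply: cu; rewrite exprn_gt0// invr_gt0.
pose M k := (\sum_(i < k.+1) N i + k)%N.
have NM k : (N k <= M k)%N by rewrite /M big_ord_recr /= -addnA addnCA leq_addr.
have NM' k : (N k <= M k.+1)%N.
  by apply: leq_trans (NM k) _; rewrite /M leq_add// [leqRHS]big_ord_recr leq_addr.
have [l hl] := H (fun k => u (M k)) (fun k => ltW (hN k _ _ (NM' k) (NM k))).
exists l => e e0; have e2 : 0 < e / 2 by lra.
have [K hK] := hl _ e2; have [K' hK'] := cu _ e2.
exists K' => n nK; have K'M : (K' <= M (maxn K K'))%N.
  by rewrite (leq_trans (leq_maxr K K'))// leq_addl.
have := hK' _ _ nK K'M; have := hK _ (leq_maxl K K').
by have := rnorm_tri (u (M (maxn K K'))) (u n) l; lra.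
Qed.

End RNorm.

(** * Completeness of the sum space *)

Lemma geometric_small (R : realType) (c e : R) :
  0 < e -> exists N, c * 2^-1 ^+ N < e.
Proof.
move=> e0; have h : (fun n => c * (2^-1 : R) ^+ n) @ \oo --> c * 0.
  by apply: cvgMr; apply: cvg_expr; rewrite ger0_norm// invf_lt1// ltr1n.
move/cvgrPdist_lt/(_ _ e0) : h => [j _ hj]; exists j.
have := hj j (leqnn j); rewrite /= mulr0 sub0r normrN.
by apply: le_lt_trans; exact: ler_norm.
Qed.

Section Completeness.
Context (R : realType).

Lemma complete_seq_complete (E : completeNormedModType R[i]) : @seq_complete R E.
Proof.
move=> u cu; suff /cauchy_cvg /cvg_ex[l hl] : cauchy (u @ \oo).
  by exists l; exact/tendsP.
apply: cauchy_exP => e /real_pos[<- e0]; have [N hN] := cu _ e0.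
exists (u N); exists N => // n /= nN.
by rewrite -ball_normE /= distm_lt hN.
Qed.

Context (P : compatible_pair R).
Local Notation incl := (@Defs.incl R P _).

Lemma rnorm_sigma (a : Sigma P) : rnorm a = sigma_norm a.
Proof. by []. Qed.

Lemma inclD k (x y : Defs.space P k) : incl (x + y) = incl x + incl y.
Proof. by apply: val_inj; rewrite /= linearD. Qed.

Lemma inclZ k (c : R[i]) (x : Defs.space P k) : incl (c *: x) = c *: incl x.
Proof. by apply: val_inj; rewrite /= linearZ. Qed.

Lemma incl0 k : incl (0 : Defs.space P k) = 0.
Proof. by apply: val_inj; rewrite /= linear0. Qed.

Lemma inclB k (x y : Defs.space P k) : incl (x - y) = incl x - incl y.
Proof. by apply: val_inj; rewrite /= linearB. Qed.

Lemma rnorm_incl k (x : Defs.space P k) : rnorm (incl x) <= rnorm x.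
Proof.
rewrite rnorm_sigma; case: k x => x.
  have := @sigma_norm_le R P (incl x) 0 x.
  by rewrite linear0 add0r rnorm0 add0r; exact.
have := @sigma_norm_le R P (incl x) x 0.
by rewrite linear0 addr0 rnorm0 addr0; exact.
Qed.

Lemma tends_incl k (u : nat -> Defs.space P k) l : tends u l -> tends (fun n => incl (u n)) (incl l).
Proof.
move=> h e /h[N hN]; exists N => n /hN.
by rewrite -inclB; apply: le_lt_trans; exact: rnorm_incl.
Qed.

(** The norm of Sigma is an infimum over decompositions. *)
Lemma sigma_decomposition (a : Sigma P) (e : R) : rnorm a < e ->
  exists x : forall k, Defs.space P k,
    a = incl (x false) + incl (x true) /\ forall k, rnorm (x k) < e.
Proof.
rewrite rnorm_sigma => /sigma_norm_lt[x0 [x1 [h le]]].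
exists (fun k => if k as k return Defs.space P k then x1 else x0).
split; first by apply: val_inj; rewrite /= h.
by have := rnorm_ge0 x0; have := rnorm_ge0 x1; move=> h1 h0 [] /=; lra.
Qed.

(** Decompose the increments of a rapidly convergent sequence and sum the two
    parts in X_0 and X_1. *)
Lemma sigma_complete : @seq_complete R (Sigma P).
Proof.
apply: seq_complete_geometric => u hu.
have /choice[d hd] : forall n, exists x : forall k, Defs.space P k,
    u n.+1 - u n = incl (x false) + incl (x true) /\
    forall k, rnorm (x k) < 2 * 2^-1 ^+ n.
  move=> n; apply: sigma_decomposition; apply: (le_lt_trans (hu n)).
  have : 0 < 2^-1 ^+ n :> R by rewrite exprn_gt0.
  lra.
have geo m n : (m <= n)%N ->
    \sum_(m <= i < n) 2 * 2^-1 ^+ i <= 4 * 2^-1 ^+ m :> R.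
  move=> mn; suff : \sum_(m <= i < n) 2 * 2^-1 ^+ i = 4 * (2^-1 ^+ m - 2^-1 ^+ n) :> R.
    move=> ->; have : 0 <= 2^-1 ^+ n :> R by rewrite exprn_ge0.
    lra.
  rewrite -(subnKC mn); elim: (n - m)%N => [|k ih].
    by rewrite addn0 big_geq// subrr mulr0.
  by rewrite addnS big_nat_recr ?leq_addr//= ih exprS; field.
have cvgk k : exists l, tends (fun n => \sum_(0 <= i < n) d i k) l.
  apply: complete_seq_complete => e e0.
  have [N hN] := geometric_small 4 e0.
  have key m n : (N <= m)%N -> (m <= n)%N ->
      rnorm (\sum_(0 <= i < n) d i k - \sum_(0 <= i < m) d i k) < e.
    move=> Nm mn; rewrite (@big_cat_nat _ _ _ m)//= addrAC subrr add0r.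
    apply: (le_lt_trans (rnorm_sum _ _)); apply: le_lt_trans hN.
    apply: (@le_trans _ _ (4 * 2^-1 ^+ m)); last first.
      by rewrite ler_pM2l// ler_wiXn2l//; lra.
    apply: le_trans (geo _ _ mn); apply: ler_sum_nat => i _.
    by rewrite ltW//; have [] := hd i.
  exists N => m n Nm Nn; case: (leqP m n) => mn; last exact: (key _ _ Nn (ltnW mn)).
  by rewrite rnormB key.
pose l k := sval (cid (cvgk k)).
have hl k : tends (fun n => \sum_(0 <= i < n) d i k) (l k) := svalP (cid (cvgk k)).
exists (u 0%N + (incl (l false) + incl (l true))).
apply: (@tends_eq _ _ (fun n => u 0%N + (incl (\sum_(0 <= i < n) d i false)
    + incl (\sum_(0 <= i < n) d i true)))).
  apply: tendsD; first exact: tends_cst.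
  by apply: tendsD; exact: tends_incl.
elim=> [|n ih]; first by rewrite !big_geq// !incl0 !addr0.
rewrite !big_nat_recr//= !inclD -(subrK (u n) (u n.+1)) (hd n).1 -ih.
by rewrite [RHS]addrC -!addrA; congr (_ + (_ + _)); rewrite addrCA.
Qed.

End Completeness.

(** * Strong measurability *)

Section SimpleMaps.
Context (R : realType).

(** The condition of [simple_fun] for an arbitrary codomain, so that pairs and
    boolean tests may be handled like vectors. *)
Definition simple_map (T : Type) (s : R -> T) :=
  finite_set (range s) /\ forall x, measurable (s @^-1` [set x]).

Lemma simple_map_preimage (T : choiceType) (s : R -> T) (A : set T) :
  simple_map s -> measurable (s @^-1` A).
Proof.
move=> [fs ms].
have -> : s @^-1` A = \bigcup_(x in range s `&` A) s @^-1` [set x].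
  apply/seteqP; split=> [y Ay|y [x [_ Ax] /= e]]; last by rewrite /preimage /= e.
  by exists (s y) => //; split=> //; exists y.
by apply: fin_bigcup_measurable => //; exact: finite_setIl.
Qed.

Lemma simple_map_comp (T U : choiceType) (F : T -> U) (s : R -> T) :
  simple_map s -> simple_map (F \o s).
Proof.
move=> hs; split.
  by rewrite -(image_comp s F setT); apply: finite_image; exact: hs.1.
by move=> x; rewrite comp_preimage; exact: simple_map_preimage.
Qed.

Lemma simple_map_pair (T U : choiceType) (s : R -> T) (t : R -> U) :
  simple_map s -> simple_map t -> simple_map (fun y => (s y, t y)).
Proof.
move=> [fs ms] [ft mt]; split.
  apply: sub_finite_set (finite_setX fs ft) => _ [y _ <-].
  by split; exists y.
move=> [a b]; have -> : (fun y => (s y, t y)) @^-1` [set (a, b)] =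
    (s @^-1` [set a]) `&` (t @^-1` [set b]).
  by apply/seteqP; split=> y /= => [[-> ->]|[-> ->]].
exact: measurableI.
Qed.

Lemma simple_map_cst (T : choiceType) (x : T) : simple_map (fun=> x).
Proof.
split; first by apply: sub_finite_set (finite_set1 x) => _ [_ _ <-].
by move=> y; rewrite preimage_cst; case: ifP => _; [exact: measurableT|exact: measurable0].
Qed.

Lemma simple_map_indic (A : set R) : measurable A -> simple_map (fun y => `[< A y >]).
Proof.
move=> mA; split.
  exact: sub_finite_set (@finite_finset _ setT).
have e : (fun y => `[< A y >]) @^-1` [set true] = A.
  by apply/seteqP; split=> y /asboolP.
case; first by rewrite e.
rewrite (_ : _ @^-1` _ = ~` A); first exact: measurableC.
apply/seteqP; split=> y /=; first by move/negbT/asboolPn.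
by move/asboolPn/negbTE.
Qed.

Lemma simple_map_measurable (s : R -> R) : simple_map s -> measurable_fun setT s.
Proof. by move=> h _ A _; rewrite setTI; exact: simple_map_preimage. Qed.

Lemma simple_map_if (T : choiceType) (A : set R) (s t : R -> T) : measurable A ->
  simple_map s -> simple_map t -> simple_map (fun y => if `[< A y >] then s y else t y).
Proof.
move=> mA hs ht.
exact: (simple_map_comp (fun p : bool * (T * T) => if p.1 then p.2.1 else p.2.2)
  (simple_map_pair (simple_map_indic mA) (simple_map_pair hs ht))).
Qed.

End SimpleMaps.

Section Smeas.
Context (R : realType).

(** Strong measurability without exceptional set: the approximation by simple
    functions holds at every point. *)
Definition smeas (E : normedModType R[i]) (h : R -> E) :=
  exists2 s : nat -> R -> E, forall n, simple_fun (s n) &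
    forall y, tends (fun n => s n y) (h y).

Lemma smeas_strong (E : normedModType R[i]) (h : R -> E) :
  smeas h -> strongly_measurable h.
Proof. by move=> [s hs ls]; exists s => //; apply: aeW => y; apply/tendsP. Qed.

Lemma smeas_cst (E : normedModType R[i]) (x : E) : smeas (fun=> x).
Proof. by exists (fun _ _ => x) => ?; [exact: simple_map_cst|exact: tends_cst]. Qed.

Lemma smeas_if (E : normedModType R[i]) (A : set R) (h k : R -> E) : measurable A ->
  smeas h -> smeas k -> smeas (fun y => if `[< A y >] then h y else k y).
Proof.
move=> mA [s hs ls] [t ht lt].
exists (fun n y => if `[< A y >] then s n y else t n y).
  by move=> n; exact: (simple_map_if mA (hs n) (ht n)).
by move=> y; case: ifP.
Qed.

Lemma smeasD (E : normedModType R[i]) (h k : R -> E) :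
  smeas h -> smeas k -> smeas (fun y => h y + k y).
Proof.
move=> [s hs ls] [t ht lt]; exists (fun n y => s n y + t n y).
  move=> n; exact: (simple_map_comp (fun p : E * E => p.1 + p.2)
    (simple_map_pair (hs n) (ht n))).
by move=> y; exact: tendsD.
Qed.

Lemma smeas_mul (E : normedModType R[i]) (c : R -> R[i]) (h : R -> E) :
  smeas (c : R -> R[i]^o) -> smeas h -> smeas (fun y => c y *: h y).
Proof.
move=> [s hs ls] [t ht lt]; exists (fun n y => s n y *: t n y).
  move=> n; exact: (simple_map_comp (fun p : R[i]^o * E => p.1 *: p.2)
    (simple_map_pair (hs n) (ht n))).
move=> y; apply/tendsP; apply: cvgZ; last exact/tendsP.
exact/(@tendsP _ R[i]^o).
Qed.

Lemma smeasZ (E : normedModType R[i]) (c : R[i]) (h : R -> E) :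
  smeas h -> smeas (fun y => c *: h y).
Proof. by move=> mh; apply: smeas_mul mh; exact: (@smeas_cst R[i]^o). Qed.

Lemma smeasB (E : normedModType R[i]) (h k : R -> E) :
  smeas h -> smeas k -> smeas (fun y => h y - k y).
Proof.
move=> mh /(smeasZ (-1)) mk; have := smeasD mh mk.
by congr smeas; apply/funext => y; rewrite scaleN1r.
Qed.

Lemma smeas_comp (E F : normedModType R[i]) (f : E -> F) (h : R -> E) :
  (forall u l, tends u l -> tends (fun n => f (u n)) (f l)) ->
  smeas h -> smeas (fun y => f (h y)).
Proof.
move=> cf [s hs ls]; exists (fun n y => f (s n y)).
  move=> n; exact: (simple_map_comp f (hs n)).
by move=> y; exact: cf.
Qed.

Lemma measurable_rnorm (E : normedModType R[i]) (h : R -> E) :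
  smeas h -> measurable_fun setT (fun y => rnorm (h y)).
Proof.
move=> [s hs ls]; apply: (measurable_fun_cvg (h := fun n y => rnorm (s n y))).
  by move=> n; apply: simple_map_measurable; exact: (simple_map_comp (@rnorm R E) (hs n)).
move=> y _; apply/cvgrPdist_lt => e /(ls y)[N hN]; exists N => // n /hN /=.
by rewrite distrC; apply: le_lt_trans; exact: rnorm_lip.
Qed.

(** Continuous functions are limits of their samplings on the grids of mesh
    1/(n+1), truncated to [-n, n]. *)
Lemma smeas_continuous (E : normedModType R[i]) (h : R -> E) :
  (forall y (e : R), 0 < e -> exists2 d : R, 0 < d &
    forall t, `|t - y| < d -> rnorm (h t - h y) < e) -> smeas h.
Proof.
move=> ch.
pose clip (n : nat) (y : R) : R := Num.max (- n%:R) (Num.min n%:R y).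
pose g n (y : R) : R := (Num.floor (n.+1%:R * clip n y))%:~R / n.+1%:R.
have n0 n : 0 < n.+1%:R :> R by rewrite ltr0n.
have clip_bound n y : - n%:R <= clip n y <= n%:R.
  rewrite /clip le_max lexx ge_max ge_min lexx /= andbT.
  have : 0 <= n%:R :> R by rewrite ler0n.
  lra.
exists (fun n y => h (g n y)).
  move=> n; apply: (simple_map_comp h (s := g n)); split; last first.
    move=> x; rewrite -[X in measurable X]setTI.
    apply: (@nondecreasing_measurable R setT) => //.
    move=> a b ab; rewrite /g ler_pM2r ?invr_gt0// ler_int.
    apply: le_floor; rewrite ler_pM2l// /clip.
    rewrite ge_max !le_max lexx /=; apply/orP; right.
    by rewrite le_min !ge_min lexx ab orbT.
  pose F (j : nat) : R := (j%:R - (n * n.+1)%:R) / n.+1%:R.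
  apply: (@sub_finite_set _ _ (F @` `I_(2 * (n * n.+1)).+1)); last first.
    by apply: finite_image; exact: finite_II.
  move=> _ [y _ <-]; have /andP[y1 y2] := clip_bound n y.
  have nn : ((n * n.+1)%:Z)%:~R = n.+1%:R * n%:R :> R by rewrite mulrC -natrM.
  have l1 : (- (n * n.+1)%:Z <= Num.floor (n.+1%:R * clip n y))%R.
    by rewrite floor_ge_int_tmp intrN nn -mulrN ler_pM2l.
  have l2 : (Num.floor (n.+1%:R * clip n y) <= (n * n.+1)%:Z)%R.
    by rewrite -(ler_int R) (le_trans (floor_le _))// nn ler_pM2l.
  exists (absz (Num.floor (n.+1%:R * clip n y) + (n * n.+1)%:Z)%R).
    by rewrite /=; lia.
  rewrite /F /g natr_absz ger0_norm; last lia.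
  by rewrite rmorphD /= addrK.
move=> y e /(ch y)[d d0 hd].
have [N1 hN1] : exists N : nat, `|y| <= N%:R.
  by exists (Num.bound `|y|); rewrite ltW// archi_boundP.
have [N2 hN2] : exists N : nat, d^-1 <= N%:R.
  by exists (Num.bound d^-1); rewrite ltW// archi_boundP// invr_ge0 ltW.
exists (maxn N1 N2) => n; rewrite geq_max => /andP[n1 n2]; apply: hd.
have yn : `|y| <= n%:R by rewrite (le_trans hN1)// ler_nat.
have -> : g n y = (Num.floor (n.+1%:R * y))%:~R / n.+1%:R.
  congr (_%:~R / _); congr (Num.floor (_ * _)); rewrite /clip.
  by move: yn; rewrite ler_norml => /andP[y1 y2]; rewrite (min_idPr y2) (max_idPr y1).
have fl := floor_le (n.+1%:R * y); have fg := floorD1_gt (n.+1%:R * y).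
have dn : 1 / n.+1%:R < d.
  rewrite ltr_pdivrMr// mulrC -ltr_pdivrMr// div1r (le_lt_trans hN2)//.
  by rewrite ltr_nat ltnS.
rewrite distrC; apply: le_lt_trans dn.
have -> : y - (Num.floor (n.+1%:R * y))%:~R / n.+1%:R =
    (n.+1%:R * y - (Num.floor (n.+1%:R * y))%:~R) / n.+1%:R.
  by rewrite mulrBl mulrAC divff ?gt_eqF// mul1r.
rewrite ger0_norm; last by rewrite divr_ge0 ?subr_ge0 ?(ltW (n0 n)).
by rewrite ler_pM2r ?invr_gt0//; lra.
Qed.

End Smeas.

(** * Integrals of real functions and of simple functions *)

Section RealIntegrals.
Import HBNNSimple.
Context (R : realType).
Local Notation mu := (@lebesgue_measure R).

(** Changing a nonnegative function on a null set does not change its integral,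
    even if the function is not measurable: a simple minorant of the one gives
    a simple minorant of the other with the same integral. *)
Lemma integral_ae_nonmeasurable (f g : R -> R) (N : set R) :
  measurable N -> mu N = 0 -> (forall y, 0 <= f y) -> (forall y, 0 <= g y) ->
  (forall y, ~ N y -> f y = g y) ->
  (\int[mu]_y (f y)%:E = \int[mu]_y (g y)%:E)%E.
Proof.
move=> mN N0.
suff le (u w : R -> R) : (forall y, 0 <= u y) -> (forall y, 0 <= w y) ->
    (forall y, ~ N y -> u y = w y) -> (\int[mu]_y (u y)%:E <= \int[mu]_y (w y)%:E)%E.
  move=> f0 g0 fg; apply/eqP; rewrite eq_le !le// => y Ny; exact/esym/fg.
move=> u0 w0 uw.
rewrite ge0_integralTE ?ge0_integralTE => [|y|y]; rewrite ?lee_fin//.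
apply: ge_ereal_sup => _ [t /= tu <-].
pose t' := proj_nnsfun t (measurableC mN).
have t'E y : t' y = if y \in ~` N then t y else 0.
  by rewrite /t' /= mindicE; case: ifP => _; rewrite (mulr0, mulr1).
have -> : sintegral mu t = sintegral mu t'.
  rewrite -!integralT_nnsfun; apply: ge0_ae_eq_integral => //.
  - exact/measurable_EFinP.
  - exact/measurable_EFinP.
  - by move=> y _; rewrite lee_fin.
  - by move=> y _; rewrite lee_fin.
  exists N; split=> // y; apply: contra_notP => Ny _.
  by rewrite t'E mem_set.
apply: ereal_sup_ubound; exists t' => // y.
rewrite t'E; case: ifPn => [|_]; last by rewrite lee_fin.
by rewrite inE => Ny; rewrite -uw.
Qed.

Lemma cvge0_lt (X : nat -> \bar R) (e : R) : X @ \oo --> 0%E -> 0 < e ->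
  exists N, forall n, (N <= n)%N -> (X n < e%:E)%E.
Proof.
move=> /fine_cvgP[[N1 _ h1] /cvgrPdist_lt h2] /h2[N2 _ h3].
exists (maxn N1 N2) => n; rewrite geq_max => /andP[n1 n2].
rewrite -(fineK (h1 _ n1)) lte_fin; have := h3 _ n2.
by rewrite /= sub0r normrN; apply: le_lt_trans; exact: ler_norm.
Qed.

Lemma cvge0_le (X : nat -> \bar R) :
  (forall n, 0 <= X n)%E ->
  (forall e : R, 0 < e -> exists N, forall n, (N <= n)%N -> (X n <= e%:E)%E) ->
  X @ \oo --> 0%E.
Proof.
move=> X0 h; apply/fine_cvgP; split.
  have [N hN] := h 1 ltr01; exists N => // n /hN Xn.
  by rewrite ge0_fin_numE// (le_lt_trans Xn)// ltry.
apply/cvgrPdist_le => e /h[N hN]; exists N => // n /hN Xn /=.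
rewrite sub0r normrN ger0_norm ?fine_ge0// -lee_fin fineK//.
by rewrite ge0_fin_numE// (le_lt_trans Xn)// ltry.
Qed.

Lemma itv_mu (a b : R) : a <= b -> mu `[a, b]%classic = (b - a)%:E.
Proof.
rewrite lebesgue_measure_itv /= lte_fin => ab; case: ltP => //.
by move=> ba; have -> : a = b; [apply/eqP; rewrite eq_le ab|rewrite subrr].
Qed.

Lemma bounded_convergence0 (T M : R) (r : nat -> R -> R) :
  (forall n, measurable_fun setT (r n)) -> (forall n y, 0 <= r n y <= M) ->
  (forall n y, T < `|y| -> r n y = 0) ->
  {ae mu, forall y, r n y @[n --> \oo] --> 0} ->
  (\int[mu]_y (r n y)%:E)%E @[n --> \oo] --> 0%E.
Proof.
move=> mr r0 rT r1.
pose K : set R := `[- T, T]%classic.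
have mK : measurable K by exact: measurable_itv.
have e n : (\int[mu]_y (r n y)%:E = \int[mu]_(y in K) (r n y)%:E)%E.
  rewrite [RHS]integral_mkcond; apply: eq_integral => y _.
  rewrite patchE; case: ifPn => // /negP; rewrite inE /K /= in_itv /= => /negP.
  by rewrite -ler_norml -ltNge => /(rT n) ->.
rewrite (_ : (fun n => _) = fun n => (\int[mu]_(y in K) (r n y)%:E)%E); last exact/funext.
have muK : (mu K < +oo)%E.
  by rewrite /K lebesgue_measure_itv /=; case: ifP => _; rewrite ?ltry// -EFinD ltry.
have [|||||_ _ h] := @dominated_convergence _ _ R mu K mK
  (fun n y => (r n y)%:E) (fun=> 0%E) (fun=> M%:E).
- move=> n; apply/measurable_EFinP; apply: measurable_funTS; exact: mr.
- exact: measurable_cst.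
- apply: negligibleS r1 => y /=; apply: contra_not => ry Ky.
  by apply: cvg_EFin => //; exact: nearW.
- apply/integrableP; split; first exact: measurable_cst.
  rewrite integral_cst//= lte_mul_pinfty//.
- apply: aeW => y n _ /=; rewrite lee_fin.
  by have /andP[r00 rM] := r0 n y; rewrite ger0_norm.
by move: h; rewrite integral0.
Qed.

Lemma integral_itv_le (a b c : R) (r : R -> R) : a <= b -> 0 <= c ->
  measurable_fun setT r -> (forall y, 0 <= r y <= c) ->
  (forall y, ~~ (a <= y <= b) -> r y = 0) ->
  (\int[mu]_y (r y)%:E <= (c * (b - a))%:E)%E.
Proof.
move=> ab c0 mr r0 rs; have mK : measurable (`[a, b]%classic : set R) by exact: measurable_itv.
have -> : (\int[mu]_y (r y)%:E = \int[mu]_(y in `[a, b]) (r y)%:E)%E.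
  rewrite [RHS]integral_mkcond; apply: eq_integral => y _.
  rewrite patchE; case: ifPn => // /negP; rewrite inE /= in_itv /= => /negP.
  by move=> /rs ->.
apply: (@le_trans _ _ (\int[mu]_(y in `[a, b]) (cst c%:E) y)%E).
  apply: ge0_le_integral => //.
  - by move=> y _; rewrite lee_fin; have /andP[] := r0 y.
  - apply/measurable_EFinP; apply: measurable_funTS; exact: mr.
  - by move=> y _; rewrite lee_fin; have /andP[] := r0 y.
by rewrite integral_cst//= itv_mu// EFinM.
Qed.

End RealIntegrals.

Section SimpleIntegral.
Context (R : realType) (E : normedModType R[i]).
Local Notation mu := (@lebesgue_measure R).

Lemma sum_seq_pred1 (V : nmodType) (T : eqType) (L : seq T) (x : T) (c : T -> V) :
  uniq L -> x \in L -> \sum_(p <- L | x == p) c p = c x.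
Proof.
move=> uL xL; rewrite big_mkcond (bigD1_seq x)//= eqxx big1 ?addr0// => i.
by rewrite eq_sym => /negbTE ->.
Qed.

(** The integral of a simple function may be computed on the level sets of any simple
    map w that it factors through; for two functions take w to be the pair. *)
Lemma simple_integral_refine (T : choiceType) (w : R -> T) (F : T -> E) (K : set R) :
  simple_map w -> measurable K -> (mu K < +oo)%E ->
  (forall y, ~ K y -> F (w y) = 0) ->
  simple_integral (F \o w) = \sum_(p <- finmap.enum_fset (fset_set (range w)))
    (fine (mu (w @^-1` [set p] `&` K)))%:C%C *: F p.
Proof.
move=> sw mK Kfin wK.
have fw := sw.1; have [fs ms] := simple_map_comp F sw.
have mp p : measurable (w @^-1` [set p] `&` K) by apply: measurableI => //; exact: sw.2.
have fin (A : set R) : measurable A -> mu (A `&` K) \is a fin_num.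
  move=> mA; rewrite ge0_fin_numE// (le_lt_trans _ Kfin)//.
  by apply: le_measure; rewrite ?inE//; exact: measurableI.
rewrite /simple_integral fsbig_finite//=.
transitivity (\sum_(x <- finmap.enum_fset (fset_set (range (F \o w))))
    \sum_(p <- finmap.enum_fset (fset_set (range w)) | F p == x)
    (fine (mu (w @^-1` [set p] `&` K)))%:C%C *: F p).
  apply: eq_bigr => x _.
  rewrite (eq_bigr (fun p => (fine (mu (w @^-1` [set p] `&` K)))%:C%C *: x)); last first.
    by move=> p /eqP ->.
  rewrite -scaler_suml; have [->|x0] := eqVneq x 0; first by rewrite !scaler0.
  congr (_ *: _); rewrite -rmorph_sum /=; congr (_%:C%C).
  rewrite -[X in mu X](_ : (F \o w) @^-1` [set x] `&` K = _); last first.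
    apply/seteqP; split=> [y [] //|y /= e]; split=> //; apply: contrapT => /wK h.
    by move: x0; rewrite -e h eqxx.
  have -> : (F \o w) @^-1` [set x] `&` K =
      \bigcup_(p in [set p | range w p /\ F p == x]) (w @^-1` [set p] `&` K).
    apply/seteqP; split=> [y [/= e Ky]|y [p [_ /eqP Fp] [/= wp Ky]]].
      by exists (w y) => //=; split; [exists y|rewrite e].
    by split=> //=; rewrite wp.
  have fD : finite_set [set p | range w p /\ F p == x].
    by apply: sub_finite_set fw => p [].
  rewrite measure_fin_bigcup//; [|by move=> p q _ _ [y [[/= wp _] [/= wq _]]]; rewrite -wp -wq
    |by move=> p _; exact: mp].
  rewrite fsbig_finite//= -sum_fine; last by move=> p _; apply: fin; exact: sw.2.
  rewrite -[RHS]big_filter; apply: perm_big; apply: uniq_perm.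
  - exact: finmap.fset_uniq.
  - by rewrite filter_uniq// finmap.fset_uniq.
  move=> p; rewrite mem_filter !in_fset_set//; apply/idP/andP.
    by rewrite inE => -[h1 h2]; split=> //; rewrite inE.
  by rewrite !inE => -[].
rewrite (exchange_big_dep predT)//=; apply: eq_big_seq => p pL.
rewrite sum_seq_pred1 ?finmap.fset_uniq//.
rewrite in_fset_set// inE; move: pL; rewrite in_fset_set// inE => -[y _ <-].
by exists y.
Qed.

End SimpleIntegral.

(** * Bochner integrals *)

Section SimpleIntegralTheory.
Context (R : realType) (E : normedModType R[i]).
Local Notation mu := (@lebesgue_measure R).

Lemma integrable_simple_support (s : R -> E) : integrable_simple_fun s ->
  measurable (s @^-1` (~` [set (0%R : E)])) /\ (mu (s @^-1` (~` [set (0%R : E)])) < +oo)%E.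
Proof.
move=> [ss si]; split; first exact: simple_map_preimage.
have -> : s @^-1` (~` [set (0%R : E)]) = \bigcup_(x in range s `&` ~` [set (0%R : E)]) s @^-1` [set x].
  apply/seteqP; split=> [y Ay|y [x [_ Ax] /= e]]; last by rewrite /preimage /= e.
  by exists (s y) => //; split=> //; exists y.
have fD : finite_set (range s `&` ~` [set (0%R : E)]) by apply: finite_setIl; exact: ss.1.
rewrite measure_fin_bigcup//; [|by move=> p q _ _ [y [/= <- <-]]
  |by move=> p _; exact: ss.2].
rewrite fsbig_finite//= big_seq lte_sum_pinfty// => x.
by rewrite in_fset_set// inE => -[_ /= /eqP x0]; exact: si.
Qed.

Lemma simple_integral_linear (c : R[i]) (s t : R -> E) :
  integrable_simple_fun s -> integrable_simple_fun t ->
  integrable_simple_fun (fun y => c *: s y + t y) /\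
  simple_integral (fun y => c *: s y + t y) = c *: simple_integral s + simple_integral t.
Proof.
move=> is_ it; have [ms fs] := integrable_simple_support is_.
have [mt ft] := integrable_simple_support it.
pose K := s @^-1` (~` [set (0%R : E)]) `|` t @^-1` (~` [set (0%R : E)]).
have mK : measurable K by exact: measurableU.
have fK : (mu K < +oo)%E.
  by apply: (le_lt_trans (measureU2 _ _ _)) => //; rewrite lte_add_pinfty.
have sK y : ~ K y -> s y = 0 by move=> Ky; apply: contrapT => h; apply: Ky; left.
have tK y : ~ K y -> t y = 0 by move=> Ky; apply: contrapT => h; apply: Ky; right.
have sw := simple_map_pair is_.1 it.1.
split.
  have ss : simple_fun (fun y => c *: s y + t y).
    exact: (simple_map_comp (fun p : E * E => c *: p.1 + p.2) sw).
  split=> // x x0; apply: le_lt_trans fK; apply: le_measure; rewrite ?inE//.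
    exact: ss.2.
  move=> y /= e; apply: contrapT => Ky.
  by move: x0; rewrite -e sK// tK// scaler0 addr0 eqxx.
rewrite (simple_integral_refine (F := (fun p : E * E => c *: p.1 + p.2)) sw mK fK) /=; last first.
  by move=> y Ky; rewrite sK// tK// scaler0 addr0.
rewrite (simple_integral_refine (F := (fun p : E * E => p.1)) sw mK fK)//.
rewrite (simple_integral_refine (F := (fun p : E * E => p.2)) sw mK fK)//.
rewrite scaler_sumr -big_split /=; apply: eq_bigr => p _.
by rewrite scalerDr !scalerA mulrC.
Qed.

Lemma simple_integral_norm (s : R -> E) : integrable_simple_fun s ->
  ((rnorm (simple_integral s))%:E <= \int[mu]_y (rnorm (s y))%:E)%E.
Proof.
move=> is_; have [mK fK] := integrable_simple_support is_.
set K := s @^-1` _ in mK fK.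
have sK y : ~ K y -> s y = 0 by move=> Ky; apply: contrapT.
have ss := is_.1.
have mp p : measurable (s @^-1` [set p] `&` K) by apply: measurableI => //; exact: ss.2.
rewrite (simple_integral_refine (F := id) ss mK fK sK).
set L := finmap.enum_fset _.
apply: (@le_trans _ _ (\sum_(p <- L) (fine (mu (s @^-1` [set p] `&` K)) * rnorm p)%:E)%E).
  rewrite sumEFin lee_fin; apply: le_trans (rnorm_sum _ _) _; apply: ler_sum => p _.
  by rewrite rnorm_scale cmod_real ger0_norm// fine_ge0.
have -> : (\int[mu]_y (rnorm (s y))%:E =
    \int[mu]_y \sum_(p <- L) ((rnorm p)%:E * (\1_(s @^-1` [set p] `&` K) y)%:E))%E.
  apply: eq_integral => y _; under eq_bigr do rewrite -EFinM.
  rewrite sumEFin; congr (_%:E).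
  have yL : s y \in L by rewrite /L in_fset_set; [rewrite inE; exists y|exact: ss.1].
  rewrite (bigD1_seq (s y))//=; last exact: finmap.fset_uniq.
  rewrite big1 ?addr0 => [|p /eqP py]; last first.
    by rewrite indicE memNset ?mulr0// => -[/= h _]; exact: py.
  rewrite indicE; have [->|h] := eqVneq (s y) 0; first by rewrite rnorm0 mul0r.
  by rewrite mem_set ?mulr1//; split=> //=; apply/eqP.
have mi p : measurable_fun setT (\1_(s @^-1` [set p] `&` K) : R -> R).
  exact: measurable_indic.
rewrite ge0_integral_sum//; [|by move=> p; apply: measurable_funeM; apply/measurable_EFinP; exact: mi|by move=> p y _; rewrite -EFinM lee_fin mulr_ge0// rnorm_ge0].
apply: lee_sum => p _; rewrite ge0_integralZl_EFin ?rnorm_ge0//; last by apply/measurable_EFinP; exact: mi.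
have -> : (\int[mu]_y (\1_(s @^-1` [set p] `&` K) y)%:E = mu (s @^-1` [set p] `&` K))%E.
  by rewrite integral_indic//; [congr (mu _); exact: setIT|exact: mp].
have fin : mu (s @^-1` [set p] `&` K) \is a fin_num.
  rewrite ge0_fin_numE// (le_lt_trans _ fK)//.
  by apply: le_measure; rewrite ?inE//; exact: mp.
by rewrite EFinM (fineK fin) [X in (X <= _)%E]muleC lexx.
Qed.

End SimpleIntegralTheory.

Section BochnerTheory.
Context (R : realType).
Local Notation mu := (@lebesgue_measure R).

Lemma integrable_simple_bounded_support (E : normedModType R[i]) (s : R -> E) (T : R) :
  simple_fun s -> (forall y, T < `|y| -> s y = 0) -> integrable_simple_fun s.
Proof.
move=> ss sT; split=> // x x0.
apply: (@le_lt_trans _ _ (mu (`[- T, T]%classic))); last first.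
  by rewrite lebesgue_measure_itv /=; case: ifP => _; rewrite ?ltry// -EFinD ltry.
apply: le_measure; rewrite ?inE//; first exact: ss.2.
move=> y /= e; rewrite in_itv /= -ler_norml leNgt; apply/negP => /sT.
by rewrite e => /eqP; apply/negP.
Qed.

Section OneSpace.
Context (E : normedModType R[i]).
Implicit Types (h k : R -> E) (v w : E).

Lemma measurable_dist h k : smeas h -> smeas k ->
  measurable_fun setT (fun y => (rnorm (h y - k y))%:E).
Proof.
move=> mh mk; apply/measurable_EFinP; apply: measurable_rnorm; exact: smeasB.
Qed.

Lemma simple_smeas h : simple_fun h -> smeas h.
Proof. by move=> sh; exists (fun=> h) => // y; exact: tends_cst. Qed.

Lemma bochner_ae h k v (N : set R) : measurable N -> mu N = 0 ->
  (forall y, ~ N y -> h y = k y) -> is_bochner_integral h v -> is_bochner_integral k v.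
Proof.
move=> mN N0 hk [[s ss sh] [t [it ct lt]]]; split.
  exists s => //; have Nn : {ae mu, forall y, ~ N y}.
    by exists N; split=> // y /= /contrapT.
  have := @filterI _ _ (ae_filter_ringOfSetsType mu) _ _ sh Nn.
  by apply: negligibleS => y /=; apply: contra_not => -[h1 /hk <-].
exists t; split=> //; rewrite (_ : (fun n => _) =
  (fun n => \int[mu]_y (rnorm (h y - t n y))%:E)%E)//; apply/funext => n.
apply: (integral_ae_nonmeasurable mN N0) => [y|y|y /hk ->//]; exact: rnorm_ge0.
Qed.

(** This estimate gives the uniqueness of the integral and its continuity in mean. *)
Lemma bochner_dist h k v w : smeas h -> smeas k ->
  is_bochner_integral h v -> is_bochner_integral k w ->
  ((rnorm (v - w))%:E <= \int[mu]_y (rnorm (h y - k y))%:E)%E.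
Proof.
move=> mh mk [_ [s [is_ cs ls]]] [_ [t [it ct lt]]].
have : (0 <= \int[mu]_y (rnorm (h y - k y))%:E)%E.
  by apply: integral_ge0 => y _; rewrite lee_fin rnorm_ge0.
case e : (\int[mu]_y (rnorm (h y - k y))%:E)%E => [r| |]// _; last by rewrite leey.
rewrite lee_fin; apply/ler_addgt0Pr => d d0.
have d4 : 0 < d / 4 by lra.
have [N1 h1] := cvge0_lt cs d4; have [N2 h2] := cvge0_lt ct d4.
have [N3 h3] := (tendsP _ _).2 ls _ d4; have [N4 h4] := (tendsP _ _).2 lt _ d4.
pose n := (N1 + N2 + N3 + N4)%N.
have {}h1 := h1 n ltac:(rewrite /n; lia). have {}h2 := h2 n ltac:(rewrite /n; lia).
have {}h3 := h3 n ltac:(rewrite /n; lia). have {}h4 := h4 n ltac:(rewrite /n; lia).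
have [ist iste] := simple_integral_linear (-1) (it n) (is_ n).
have ms := simple_smeas (is_ n).1; have mt := simple_smeas (it n).1.
have key : rnorm (simple_integral (s n) - simple_integral (t n)) <= d / 4 + (r + d / 4).
  have nst := simple_integral_norm ist; rewrite iste scaleN1r addrC in nst.
  rewrite -lee_fin; apply: (le_trans nst).
  apply: (@le_trans _ _ (\int[mu]_y ((rnorm (h y - s n y))%:E +
     ((rnorm (h y - k y))%:E + (rnorm (k y - t n y))%:E)))%E).
    apply: ge0_le_integral => //.
    - by move=> y _; rewrite lee_fin rnorm_ge0.
    - by apply/measurable_EFinP; apply: measurable_rnorm; apply: simple_smeas; exact: ist.1.
    - apply: emeasurable_funD; [exact: measurable_dist|].
      by apply: emeasurable_funD; exact: measurable_dist.
    move=> y _; rewrite -!EFinD lee_fin scaleN1r [- _ + _]addrC.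
    have := rnorm_tri (h y) (s n y) (t n y); rewrite (rnormB (s n y) (h y)).
    by have := rnorm_tri (k y) (h y) (t n y); lra.
  rewrite ge0_integralD//; [|by move=> y _; rewrite lee_fin rnorm_ge0|exact: measurable_dist
    |by move=> y _; rewrite -EFinD lee_fin addr_ge0 ?rnorm_ge0
    |by apply: emeasurable_funD; exact: measurable_dist].
  rewrite ge0_integralD//; [|by move=> y _; rewrite lee_fin rnorm_ge0|exact: measurable_dist
    |by move=> y _; rewrite lee_fin rnorm_ge0|exact: measurable_dist].
  by rewrite e EFinD; apply: leeD; [exact: (ltW h1)|rewrite EFinD leeD2l//; exact: (ltW h2)].
have := rnorm_tri (simple_integral (s n)) v w.
have := rnorm_tri (simple_integral (t n)) (simple_integral (s n)) w.
rewrite (rnormB v (simple_integral (s n))); lra.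
Qed.

Lemma bochner_uniq h v w : smeas h ->
  is_bochner_integral h v -> is_bochner_integral h w -> v = w.
Proof.
move=> mh hv hw; apply/eqP; rewrite -subr_eq0 -rnorm_eq0 eq_le rnorm_ge0 andbT.
have := bochner_dist mh mh hv hw.
by under eq_integral do rewrite subrr rnorm0; rewrite integral0 lee_fin.
Qed.

Lemma bochner_integralE h v : smeas h -> is_bochner_integral h v -> bochner_integral h = v.
Proof.
move=> mh hv; apply: (bochner_uniq mh _ hv); rewrite /bochner_integral.
by apply: (@xgetPex _ 0 (is_bochner_integral h)); exists v.
Qed.

Lemma bochner_linear (c : R[i]) h k v w : smeas h -> smeas k ->
  is_bochner_integral h v -> is_bochner_integral k w ->
  is_bochner_integral (fun y => c *: h y + k y) (c *: v + w).
Proof.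
move=> mh mk [_ [s [is_ cs ls]]] [_ [t [it ct lt]]].
have msum : smeas (fun y => c *: h y + k y) by apply: smeasD => //; exact: smeasZ.
split; first exact: smeas_strong.
exists (fun n y => c *: s n y + t n y); split.
- by move=> n; exact: (simple_integral_linear c (is_ n) (it n)).1.
- apply: cvge0_le => [n|e e0].
    by apply: integral_ge0 => y _; rewrite lee_fin rnorm_ge0.
  have c0 : 0 < 2 * (cmod c + 1) by have := cmod_ge0 c; lra.
  have e2 : 0 < e / (2 * (cmod c + 1)) by rewrite divr_gt0.
  have e3 : 0 < e / 2 by lra.
  have [N1 h1] := cvge0_lt cs e2; have [N2 h2] := cvge0_lt ct e3.
  exists (N1 + N2)%N => n nN; have {}h1 := h1 n ltac:(lia). have {}h2 := h2 n ltac:(lia).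
  have ms := simple_smeas (is_ n).1; have mt := simple_smeas (it n).1.
  apply: (@le_trans _ _ (\int[mu]_y ((cmod c)%:E * (rnorm (h y - s n y))%:E +
     (rnorm (k y - t n y))%:E))%E).
    apply: ge0_le_integral => //.
    - by move=> y _; rewrite lee_fin rnorm_ge0.
    - by apply: measurable_dist => //; apply: smeasD => //; exact: smeasZ.
    - apply: emeasurable_funD; [|exact: measurable_dist].
      by apply: measurable_funeM; exact: measurable_dist.
    move=> y _; rewrite -EFinM -EFinD lee_fin -rnorm_scale.
    apply: le_trans (rnormD _ _); rewrite le_eqVlt; apply/orP; left; apply/eqP; congr rnorm.
    by rewrite scalerBr opprD addrACA.
  rewrite ge0_integralD//; [|by move=> y _; rewrite -EFinM lee_fin mulr_ge0 ?rnorm_ge0 ?cmod_ge0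
    |by apply: measurable_funeM; exact: measurable_dist
    |by move=> y _; rewrite lee_fin rnorm_ge0|exact: measurable_dist].
  rewrite ge0_integralZl_EFin ?cmod_ge0//; [|by move=> y _; rewrite lee_fin rnorm_ge0|exact: measurable_dist].
  rewrite [e in (_ <= e%:E)%E](_ : e = cmod c * (e / (2 * (cmod c + 1))) +
     (e / 2 + e / (2 * (cmod c + 1)))); last by field; lra.
  rewrite EFinD; apply: leeD.
    by rewrite EFinM; apply: lee_wpmul2l; [rewrite lee_fin cmod_ge0|exact: (ltW h1)].
  by apply: (le_trans (ltW h2)); rewrite lee_fin lerDl ltW.
- rewrite (_ : (fun n => _) = (fun n => c *: simple_integral (s n) + simple_integral (t n))).
    by apply: cvgD => //; exact: cvgZr.
  by apply/funext => n; rewrite (simple_integral_linear c (is_ n) (it n)).2.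
Qed.

(** Truncate the approximating simple functions; their integrals form a Cauchy
    sequence by bounded convergence. *)
Lemma bochner_exists h (M T : R) : @seq_complete R E -> smeas h ->
  (forall y, rnorm (h y) <= M) -> (forall y, T < `|y| -> h y = 0) ->
  exists v, is_bochner_integral h v.
Proof.
move=> cE mh hM hT; have [s ss sh] := mh.
pose A n : set R := `[- T, T]%classic `&` s n @^-1` [set x | rnorm x <= M + 1].
have mA n : measurable (A n).
  by apply: measurableI; [exact: measurable_itv|exact: (simple_map_preimage _ (ss n))].
pose t n y := if `[< A n y >] then s n y else 0.
have st n : simple_fun (t n) by exact: (simple_map_if (mA n) (ss n) (simple_map_cst R (0 : E))).
have AT n y : A n y -> `|y| <= T by move=> [/=]; rewrite in_itv /= ler_norml.
have it n : integrable_simple_fun (t n).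
  apply: (integrable_simple_bounded_support (T := T)) => // y yT; rewrite /t.
  by case: asboolP => // /AT; rewrite leNgt yT.
have tM n y : rnorm (t n y) <= M + 1.
  rewrite /t; case: asboolP => [[]//|_]; rewrite rnorm0.
  by have := hM y; have := rnorm_ge0 (h y); lra.
have th y : tends (fun n => t n y) (h y).
  have min_gt0 (e : R) : 0 < e -> 0 < Num.min e 1 by move=> e0; rewrite lt_min e0 ltr01.
  move=> e e0; have [Ty|yT] := ltP T `|y|.
    exists 0%N => n _; rewrite /t hT//; case: asboolP => [/AT|_].
      by rewrite leNgt Ty.
    by rewrite subr0 rnorm0.
  have [N hN] := sh y (Num.min e 1) (min_gt0 _ e0).
  exists N => n /hN; rewrite lt_min => /andP[h1 h2]; rewrite /t; case: asboolP => // nA.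
  exfalso; apply: nA; split; first by rewrite /= in_itv /= -ler_norml.
  have := rnorm_tri (h y) (s n y) 0; rewrite !subr0 /=.
  by have := hM y; lra.
have lim0 : (\int[mu]_y (rnorm (h y - t n y))%:E)%E @[n --> \oo] --> 0%E.
  apply: (@bounded_convergence0 _ T (2 * M + 1)).
  - by move=> n; apply: measurable_rnorm; apply: smeasB => //; exact: simple_smeas.
  - move=> n y; rewrite rnorm_ge0 /=; have := rnorm_subr (h y) (t n y).
    by have := hM y; have := tM n y; lra.
  - move=> n y yT; rewrite hT// /t; case: asboolP => [/AT|]; last by rewrite subr0 rnorm0.
    by rewrite leNgt yT.
  apply: aeW => y; apply/cvgrPdist_lt => e /(th y)[N hN]; exists N => // n /hN /=.
  by rewrite sub0r normrN ger0_norm ?rnorm_ge0// rnormB.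
have [v hv] : exists v, tends (fun n => simple_integral (t n)) v.
  apply: cE => e e0; have e2 : 0 < e / 2 by lra.
  have [N hN] := cvge0_lt lim0 e2; exists N => m n /hN hm /hN hn.
  have [imn imne] := simple_integral_linear (-1) (it n) (it m).
  have := simple_integral_norm imn; rewrite imne scaleN1r addrC.
  rewrite -lte_fin => /le_lt_trans; apply.
  have mt j := simple_smeas (st j).
  apply: (@le_lt_trans _ _ (\int[mu]_y ((rnorm (h y - t m y))%:E + (rnorm (h y - t n y))%:E))%E).
    apply: ge0_le_integral => //.
    - by move=> y _; rewrite lee_fin rnorm_ge0.
    - by apply/measurable_EFinP; apply: measurable_rnorm; apply: simple_smeas; exact: imn.1.
    - by apply: emeasurable_funD; exact: measurable_dist.
    move=> y _; rewrite -EFinD lee_fin scaleN1r [- _ + _]addrC (rnormB (h y)).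
    exact: rnorm_tri.
  rewrite ge0_integralD//; [|by move=> y _; rewrite lee_fin rnorm_ge0|exact: measurable_dist
    |by move=> y _; rewrite lee_fin rnorm_ge0|exact: measurable_dist].
  by rewrite (splitr e) EFinD lteD.
exists v; split; first exact: smeas_strong.
by exists t; split=> //; apply/tendsP.
Qed.

End OneSpace.

Lemma bochner_map (E F : normedModType R[i]) (f : E -> F) (h : R -> E) v :
  (forall x y, f (x + y) = f x + f y) -> (forall (c : R[i]) x, f (c *: x) = c *: f x) ->
  (forall x, rnorm (f x) <= rnorm x) ->
  smeas h -> is_bochner_integral h v -> is_bochner_integral (fun y => f (h y)) (f v).
Proof.
move=> fD fZ fn mh [_ [s [is_ cs ls]]].
have f0 : f 0 = 0 by have := fZ 0 0; rewrite !scale0r.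
have fB x y : f (x - y) = f x - f y by rewrite fD -scaleN1r fZ scaleN1r.
have ft u l : tends u l -> tends (fun n => f (u n)) (f l).
  by move=> ul e /ul[N hN]; exists N => n /hN; rewrite -fB; apply: le_lt_trans.
have mf : smeas (fun y => f (h y)) by exact: smeas_comp.
split; first exact: smeas_strong.
have key n : integrable_simple_fun (fun y => f (s n y)) /\
    simple_integral (fun y => f (s n y)) = f (simple_integral (s n)).
  have [mK fK] := integrable_simple_support (is_ n).
  set K := s n @^-1` _ in mK fK.
  have sK y : ~ K y -> s n y = 0 by move=> Ky; apply: contrapT.
  have ss := simple_map_comp f (is_ n).1.
  split.
    split=> // x x0; apply: le_lt_trans fK; apply: le_measure; rewrite ?inE//.
      exact: ss.2.
    move=> y /= e; apply: contrapT => Ky.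
    by move: x0; rewrite -e sK// f0 eqxx.
  rewrite (simple_integral_refine (F := f) (is_ n).1 mK fK); last by move=> y /sK ->.
  rewrite (simple_integral_refine (F := id) (is_ n).1 mK fK sK).
  elim: (finmap.enum_fset _) => [|p L ih]; first by rewrite !big_nil.
  by rewrite !big_cons fD fZ ih.
exists (fun n y => f (s n y)); split.
- by move=> n; exact: (key n).1.
- apply: cvge0_le => [n|e e0].
    by apply: integral_ge0 => y _; rewrite lee_fin rnorm_ge0.
  have [N hN] := cvge0_lt cs e0; exists N => n /hN/ltW; apply: le_trans.
  apply: ge0_le_integral => //.
  - by move=> y _; rewrite lee_fin rnorm_ge0.
  - by apply: measurable_dist => //; exact: simple_smeas (key n).1.1.
  - by apply: measurable_dist => //; exact: simple_smeas (is_ n).1.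
  by move=> y _; rewrite lee_fin -fB.
- rewrite (_ : (fun n => _) = (fun n => f (simple_integral (s n)))); last first.
    by apply/funext => n; rewrite (key n).2.
  by apply/tendsP/ft/tendsP.
Qed.

End BochnerTheory.

(** * Integrals over intervals *)

Section IntervalIntegrals.
Context (R : realType).
Local Notation mu := (@lebesgue_measure R).

Definition bounded_smeas (E : normedModType R[i]) (h : R -> E) :=
  smeas h /\ exists M : R, forall y, rnorm (h y) <= M.

Definition compactly_smeas (E : normedModType R[i]) (h : R -> E) :=
  bounded_smeas h /\ exists T : R, forall y, T < `|y| -> h y = 0.

(** The signed indicator function of ]a, b]: its opposite for ]b, a] if b < a,
    so that the integral against it is additive with respect to intervals
    without any case distinction. *)
Definition signed_itv (a b y : R) : R[i]^o :=
  ((y <= b)%R%:R - (y <= a)%R%:R : R)%:C%C.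

Fact oint_key : unit. Proof. exact: tt. Qed.

(* Locked: unfolding it in the course of unification is very expensive. *)
Definition oint (E : normedModType R[i]) (a b : R) (h : R -> E) : E :=
  locked_with oint_key (bochner_integral (fun y => signed_itv a b y *: h y)).

Lemma ointE (E : normedModType R[i]) (a b : R) (h : R -> E) :
  oint a b h = bochner_integral (fun y => signed_itv a b y *: h y).
Proof. by rewrite /oint unlock. Qed.

Lemma smeas_signed_itv a b : smeas (signed_itv a b).
Proof.
have mle c : smeas (fun y => ((y <= c)%R%:R : R)%:C%C : R[i]^o).
  have := @smeas_if R R[i]^o _ _ _ (measurable_itv `]-oo, c])
    (@smeas_cst R R[i]^o 1) (@smeas_cst R R[i]^o 0).
  congr smeas; apply/funext => y; case: asboolP; rewrite /= in_itv /=.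
    by move=> ->.
  by move=> /negP/negbTE ->.
have := smeasB (mle b) (mle a); congr smeas; apply/funext => y.
by rewrite /signed_itv rmorphB.
Qed.

Lemma cmod_signed_itv a b y : cmod (signed_itv a b y) <= 1.
Proof.
rewrite /signed_itv cmod_real; case: (y <= b); case: (y <= a);
by rewrite /= ?subrr ?subr0 ?sub0r ?normrN ?normr0 ?normr1.
Qed.

Lemma signed_itv_out a b y : a <= b -> ~~ (a <= y <= b) -> signed_itv a b y = 0.
Proof.
rewrite /signed_itv => ab; case: (leP y b) => yb; case: (leP y a) => ya;
  rewrite /= ?subrr//.
  by rewrite andbT (ltW ya).
by move: (le_lt_trans ab yb); rewrite ltNge ya.
Qed.

Lemma bounded_smeasZ (E : normedModType R[i]) (c : R -> R[i]^o) (h : R -> E) :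
  bounded_smeas c -> bounded_smeas h -> bounded_smeas (fun y => c y *: h y).
Proof.
move=> [mc [M hM]] [mh [N hN]]; split; first exact: smeas_mul.
exists (M * N) => y; rewrite rnorm_scale; apply: ler_pM; rewrite ?cmod_ge0 ?rnorm_ge0//.
exact: hM.
Qed.

Lemma bounded_smeasD (E : normedModType R[i]) (h k : R -> E) :
  bounded_smeas h -> bounded_smeas k -> bounded_smeas (fun y => h y + k y).
Proof.
move=> [mh [M hM]] [mk [N hN]]; split; first exact: smeasD.
by exists (M + N) => y; rewrite (le_trans (rnormD _ _))// lerD.
Qed.

Lemma bounded_smeas_cst (E : normedModType R[i]) (v : E) : bounded_smeas (fun=> v).
Proof. by split; [exact: smeas_cst|exists (rnorm v)]. Qed.

Lemma compactly_signed_itv (E : normedModType R[i]) a b (h : R -> E) :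
  bounded_smeas h -> compactly_smeas (fun y => signed_itv a b y *: h y).
Proof.
move=> bh; split.
  apply: bounded_smeasZ => //; split; first exact: smeas_signed_itv.
  by exists 1 => y; exact: cmod_signed_itv.
exists (`|a| + `|b|) => y hy; rewrite /signed_itv.
have := ler_norm a; have := ler_norm b; have := ler_norm (- a); have := ler_norm (- b).
rewrite !normrN => h1 h2 h3 h4; have [y0|y0] := leP 0 y.
  rewrite (ger0_norm y0) in hy; have [-> ->] : (y <= b) = false /\ (y <= a) = false.
    by split; apply/negbTE; rewrite -ltNge; lra.
  by rewrite subrr scale0r.
rewrite (ltr0_norm y0) in hy; have [-> ->] : (y <= b) = true /\ (y <= a) = true by split; lra.
by rewrite subrr scale0r.
Qed.

Section OneSpace.
Context (E : normedModType R[i]) (cE : @seq_complete R E).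
Implicit Types (h k : R -> E).

Lemma bint_is h : compactly_smeas h -> is_bochner_integral h (bochner_integral h).
Proof.
move=> [[mh [M hM]] [T hT]]; have [v hv] := bochner_exists cE mh hM hT.
by rewrite (bochner_integralE mh hv).
Qed.

Lemma bint_linear (c : R[i]) h k : compactly_smeas h -> compactly_smeas k ->
  bochner_integral (fun y => c *: h y + k y) =
  c *: bochner_integral h + bochner_integral k.
Proof.
move=> bh bk; have [mh mk] := (bh.1.1, bk.1.1).
apply: bochner_integralE; first by apply: smeasD => //; exact: smeasZ.
by apply: bochner_linear => //; exact: bint_is.
Qed.

Lemma bint_dist h k : compactly_smeas h -> compactly_smeas k ->
  ((rnorm (bochner_integral h - bochner_integral k))%:E <=
   \int[mu]_y (rnorm (h y - k y))%:E)%E.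
Proof.
by move=> bh bk; apply: (bochner_dist bh.1.1 bk.1.1); exact: bint_is.
Qed.

Lemma oint_linear (c : R[i]) a b h k : bounded_smeas h -> bounded_smeas k ->
  oint a b (fun y => c *: h y + k y) = c *: oint a b h + oint a b k.
Proof.
move=> bh bk; rewrite !ointE -bint_linear; try exact: compactly_signed_itv.
by congr bochner_integral; apply/funext => y; rewrite scalerDr !scalerA mulrC.
Qed.

Lemma ointD a b h k : bounded_smeas h -> bounded_smeas k ->
  oint a b (fun y => h y + k y) = oint a b h + oint a b k.
Proof.
move=> bh bk; rewrite -[oint a b h]scale1r -oint_linear//.
by congr oint; apply/funext => y; rewrite scale1r.
Qed.

Lemma oint_chasles a b c h : bounded_smeas h ->
  oint a b h + oint b c h = oint a c h.
Proof.
move=> bh; rewrite -[oint a b h]scale1r !ointE -bint_linear;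
  try exact: compactly_signed_itv.
congr bochner_integral; apply/funext => y; rewrite scale1r -scalerDl.
by rewrite /signed_itv -rmorphD /= addrC addrA subrK.
Qed.

Lemma oint_refl a h : bounded_smeas h -> oint a a h = 0.
Proof. by move=> bh; apply: (addrI (oint a a h)); rewrite oint_chasles// addr0. Qed.

Lemma oint_opp a b h : bounded_smeas h -> oint a b h = - oint b a h.
Proof.
by move=> bh; apply/eqP; rewrite -addr_eq0 oint_chasles// oint_refl.
Qed.

Lemma oint_dist a b (r : R) h k : bounded_smeas h -> bounded_smeas k ->
  0 <= r -> (forall y, Num.min a b <= y <= Num.max a b -> rnorm (h y - k y) <= r) ->
  rnorm (oint a b h - oint a b k) <= r * `|b - a|.
Proof.
wlog ab : a b / a <= b => [H bh bk r0 hk|].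
  have [|ba] := leP a b; first by move=> ab; exact: H.
  rewrite (oint_opp a b bh) (oint_opp a b bk) -opprD rnormN distrC.
  by apply: (H b a) => //; [exact: ltW|rewrite minC maxC].
move=> bh bk r0; rewrite (min_idPl ab) (max_idPr ab) => hk.
rewrite ger0_norm ?subr_ge0// -lee_fin.
have [sh sk] := (compactly_signed_itv a b bh, compactly_signed_itv a b bk).
rewrite !ointE; apply: (le_trans (bint_dist sh sk)); apply: integral_itv_le => //.
- by apply: measurable_rnorm; apply: smeasB; [exact: sh.1.1|exact: sk.1.1].
- move=> y; rewrite rnorm_ge0 /= -scalerBr rnorm_scale.
  have [/hk hy|/(signed_itv_out ab) ->] := boolP (a <= y <= b); last first.
    by rewrite cmod0 mul0r.
  apply: le_trans hy; rewrite -[leRHS]mul1r ler_wpM2r ?rnorm_ge0//.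
  exact: cmod_signed_itv.
- by move=> y /(signed_itv_out ab) ->; rewrite !scale0r subr0 rnorm0.
Qed.

Lemma oint_eq a b h k : bounded_smeas h -> bounded_smeas k ->
  (forall y, Num.min a b <= y <= Num.max a b -> h y = k y) -> oint a b h = oint a b k.
Proof.
move=> bh bk hk; apply/eqP; rewrite -subr_eq0 -rnorm_eq0 eq_le rnorm_ge0 andbT.
have := @oint_dist a b 0 h k bh bk (lexx _); rewrite mul0r; apply => y /hk ->.
by rewrite subrr rnorm0.
Qed.

(** The constant function on the interval is a simple function. *)
Lemma oint_cst a b (v : E) : oint a b (fun=> v) = (b - a)%:C%C *: v.
Proof.
wlog ab : a b / a < b => [H|].
  have [|ba|->] := ltgtP a b; first exact: H.
    rewrite oint_opp ?H//; last exact: bounded_smeas_cst.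
    by rewrite -scaleNr -rmorphN opprB.
  by rewrite oint_refl ?subrr ?scale0r//; exact: bounded_smeas_cst.
pose A : set R := `]a, b]%classic.
have mA : measurable A by exact: measurable_itv.
have AE y : signed_itv a b y *: v = if `[< A y >] then v else 0.
  rewrite /signed_itv /A; case: asboolP => /=; rewrite in_itv /=.
    by move=> /andP[ay ->]; rewrite leNgt ay subr0 scale1r.
  case: (leP y b) => yb; case: (leP y a) => ya; rewrite /= ?subrr ?scale0r//.
  by move: (le_lt_trans (ltW ab) yb); rewrite ltNge ya.
have muA : mu A = (b - a)%:E by rewrite /A lebesgue_measure_itv /= lte_fin ab.
pose F (t : bool) := if t then v else 0.
have sA := simple_map_indic mA.
rewrite ointE (_ : (fun y => _) = F \o (fun y => `[< A y >])); last exact/funext.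
have iF : integrable_simple_fun (F \o (fun y => `[< A y >])).
  apply: (integrable_simple_bounded_support (T := `|a| + `|b|)).
    exact: simple_map_comp.
  move=> y hy; rewrite /F /= -AE.
  have bv := bounded_smeas_cst v.
  have := ler_norm a; have := ler_norm b; have := ler_norm (- a); have := ler_norm (- b).
  rewrite !normrN => h1 h2 h3 h4; rewrite (signed_itv_out (ltW ab)) ?scale0r//.
  by apply/negP => /andP[p q]; move: hy; rewrite ltNge ler_norml => /negP; apply; lra.
have mF : smeas (F \o (fun y => `[< A y >])) by exact: simple_smeas iF.1.
apply: bochner_integralE => //; split; first exact: smeas_strong.
exists (fun=> F \o (fun y => `[< A y >])); split => //.
  under eq_fun do under eq_integral do rewrite subrr rnorm0.
  by rewrite integral0; exact: cvg_cst.
rewrite (_ : simple_integral _ = (b - a)%:C%C *: v); first exact: cvg_cst.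
rewrite (simple_integral_refine (F := F) (K := A) sA mA); last 2 first.
- by rewrite muA ltry.
- by move=> y Ay; case: asboolP.
rewrite (bigD1_seq true)/=; last 2 first.
- rewrite in_fset_set; last exact: sA.1.
  rewrite inE; exists b => //; apply/asboolP; rewrite /A /= in_itv /= ab lexx.
  by [].
- exact: finmap.fset_uniq.
rewrite big1 ?addr0 => [|[]// _]; last by rewrite scaler0.
congr (_%:C%C *: _); rewrite (_ : _ `&` A = A) ?muA//.
by apply/seteqP; split=> [y []//|y Ay]; split=> //; exact/asboolP.
Qed.

Lemma oint_bound a b (r : R) h : bounded_smeas h -> 0 <= r ->
  (forall y, Num.min a b <= y <= Num.max a b -> rnorm (h y) <= r) ->
  rnorm (oint a b h) <= r * `|b - a|.
Proof.
move=> bh r0 hr; have := @oint_dist a b r h (fun=> 0) bh (bounded_smeas_cst _) r0.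
by rewrite oint_cst scaler0 subr0; apply => y /hr; rewrite subr0.
Qed.

End OneSpace.

Lemma oint_map (E F : normedModType R[i]) (f : E -> F) (h : R -> E) a b :
  @seq_complete R E ->
  (forall x y, f (x + y) = f x + f y) -> (forall (c : R[i]) x, f (c *: x) = c *: f x) ->
  (forall x, rnorm (f x) <= rnorm x) ->
  bounded_smeas h -> oint a b (fun y => f (h y)) = f (oint a b h).
Proof.
move=> cE fD fZ fn bh; have ch := compactly_signed_itv a b bh.
have ft u l : tends u l -> tends (fun n => f (u n)) (f l).
  have fB x y : f (x - y) = f x - f y by rewrite fD -scaleN1r fZ scaleN1r.
  by move=> ul e /ul[N hN]; exists N => n /hN; rewrite -fB; apply: le_lt_trans.
have e : (fun y => signed_itv a b y *: f (h y)) = (fun y => f (signed_itv a b y *: h y)).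
  by apply/funext => y; rewrite fZ.
rewrite !ointE e; apply: bochner_integralE.
  by apply: (smeas_comp ft); exact: ch.1.1.
by apply: bochner_map => //; [exact: ch.1.1|exact: bint_is].
Qed.

End IntervalIntegrals.

(** * Complex derivatives and the theorem of Goursat *)

Section ComplexDerivative.
Context (R : realType) (E : normedModType R[i]).
Implicit Types (f : R[i]^o -> E) (z w h : R[i]).

Definition cderiv f z (d : E) := forall e : R, 0 < e ->
  exists2 r : R, 0 < r & forall h, cmod h < r ->
    rnorm (f (z + h) - f z - h *: d) <= e * cmod h.

Lemma derivable_cderivP f z : derivable f z 1 <-> exists d, cderiv f z d.
Proof.
have key (h : R[i]) d : h != 0 ->
    rnorm (h^-1 *: ((f \o shift z) (h *: (1 : R[i]^o)) - f z) - d) =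
    rnorm (f (z + h) - f z - h *: d) / cmod h.
  move=> h0; rewrite /= [h *: _]mulr1 (addrC h z).
  have -> : h^-1 *: (f (z + h) - f z) - d = h^-1 *: (f (z + h) - f z - h *: d).
    by rewrite [RHS]scalerBr scalerA mulVf// scale1r.
  by rewrite rnorm_scale cmodV mulrC.
split=> [/cvg_ex[d /cvg_rnormP hd]|[d hd]]; [exists d => e e0|apply/cvg_ex; exists d].
  have := hd _ e0 => /(nbhs_rnormP (E := R[i]^o))[r r0 hr]; exists r => // h hh.
  have [->|h0] := eqVneq h 0; first by rewrite addr0 subrr scale0r subrr rnorm0 cmod0 mulr0.
  have := hr h; rewrite subr0 => /(_ hh h0); rewrite key//.
  by rewrite ltr_pdivrMr ?cmod_gt0// => /ltW.
apply/cvg_rnormP => e e0; have e2 : 0 < e / 2 by lra.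
have [r r0 hr] := hd _ e2; apply/(nbhs_rnormP (E := R[i]^o)); exists r => // h.
rewrite subr0 => hh h0; rewrite key// ltr_pdivrMr ?cmod_gt0//.
apply: (le_lt_trans (hr h hh)); rewrite ltr_pM2r ?cmod_gt0//; lra.
Qed.

Lemma cderiv_lipschitz f z d : cderiv f z d ->
  exists2 r : R, 0 < r & forall h, cmod h < r ->
    rnorm (f (z + h) - f z) <= (rnorm d + 1) * cmod h.
Proof.
move=> /(_ 1 ltr01)[r r0 hr]; exists r => // h /hr hh.
have := rnormD (f (z + h) - f z - h *: d) (h *: d); rewrite subrK rnorm_scale.
by lra.
Qed.

Lemma cderiv_continuous f z d (e : R) : cderiv f z d -> 0 < e ->
  exists2 r : R, 0 < r & forall w, cmod (w - z) < r -> rnorm (f w - f z) < e.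
Proof.
move=> /cderiv_lipschitz[r r0 hr] e0; have d0 := rnorm_ge0 d.
have d1 : 0 < rnorm d + 1 by lra.
exists (Num.min r (e / (rnorm d + 1))); first by rewrite lt_min r0 divr_gt0.
move=> w; rewrite lt_min ltr_pdivlMr// => /andP[w1 w2].
have := hr _ w1; rewrite subrKC => /le_lt_trans; apply.
by rewrite mulrC.
Qed.

End ComplexDerivative.

Lemma subr_swap (V : zmodType) (a b a' b' : V) : a - b - (a' - b') = a - a' - (b - b').
Proof. by rewrite !opprD !opprK addrACA. Qed.

Lemma zmod_path (V : zmodType) (a b c d k l : V) :
  b - c + (d - l) = 0 -> a + b + (d + k) - (a + l) = c + k.
Proof.
move=> /eqP; rewrite addrAC subr_eq0 => /eqP <-.
rewrite [a + b]addrC opprD -!addrA; congr (b + _).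
by rewrite (addrCA k) (addrCA d) addNKr [k - l]addrC.
Qed.

Lemma sum4_le (R : realType) (E : normedModType R[i]) (a b c d : E) (s := a + b + (c + d)) :
  [\/ rnorm s <= 4 * rnorm a, rnorm s <= 4 * rnorm b, rnorm s <= 4 * rnorm c |
      rnorm s <= 4 * rnorm d].
Proof.
have := rnormD (a + b) (c + d); have := rnormD a b; have := rnormD c d.
rewrite -/s => n1 n2 n3.
have [|h1] := leP (rnorm s) (4 * rnorm a); first by constructor 1.
have [|h2] := leP (rnorm s) (4 * rnorm b); first by constructor 2.
have [|h3] := leP (rnorm s) (4 * rnorm c); first by constructor 3.
constructor 4; lra.
Qed.

Section RectangleFunctions.
Context (R : realType) (E : normedModType R[i]) (J : R -> R -> R -> R -> E).
Hypothesis Jx : forall a m b c d, J a b c d = J a m c d + J m b c d.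
Hypothesis Jy : forall a b c m d, J a b c d = J a b c m + J a b m d.

(** Cut the rectangle into four and keep a quarter with the largest value. *)
Lemma rect_function_quarter (w h : R) (n : nat) (s : R * R) : exists s' : R * R,
  [/\ s'.1 = s.1 \/ s'.1 = s.1 + w / 2 ^+ n.+1,
      s'.2 = s.2 \/ s'.2 = s.2 + h / 2 ^+ n.+1 &
   rnorm (J s.1 (s.1 + w / 2 ^+ n) s.2 (s.2 + h / 2 ^+ n)) <=
   4 * rnorm (J s'.1 (s'.1 + w / 2 ^+ n.+1) s'.2 (s'.2 + h / 2 ^+ n.+1))].
Proof.
case: s => a c /=; set w' := w / 2 ^+ n.+1; set h' := h / 2 ^+ n.+1.
have half (x : R) : x / 2 ^+ n = x / 2 ^+ n.+1 + x / 2 ^+ n.+1.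
  by rewrite exprS; field; rewrite expf_eq0/=; apply/negP => /andP[_ /eqP]; lra.
rewrite (half w) (half h) -/w' -/h' !addrA.
rewrite (Jx a (a + w')) (Jy a _ c (c + h')).
rewrite (Jy (a + w') _ c (c + h')).
have [h4|h4|h4|h4] := sum4_le (J a (a + w') c (c + h'))
  (J a (a + w') (c + h') (c + h' + h')) (J (a + w') (a + w' + w') c (c + h'))
  (J (a + w') (a + w' + w') (c + h') (c + h' + h')).
- by exists (a, c); split; [left|left|exact: h4].
- by exists (a, c + h'); split; [left|right|exact: h4].
- by exists (a + w', c); split; [right|left|exact: h4].
- by exists (a + w', c + h'); split; [right|right|exact: h4].
Qed.

(** Goursat: repeated bisection gives nested rectangles with integrals at least
    1/4^n times the original one, but differentiability at their common point
    makes these integrals o(1/4^n). *)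
Lemma rect_function_zero (p q a b c d : R) :
  (forall x y (e : R), p <= x <= q -> 0 < e -> exists2 r : R, 0 < r &
     forall a w c h, p <= a -> a + w <= q -> 0 <= w -> 0 <= h -> a <= x <= a + w ->
       c <= y <= c + h -> w + h < r -> rnorm (J a (a + w) c (c + h)) <= e * (w + h) ^+ 2) ->
  p <= a <= b -> b <= q -> c <= d -> J a b c d = 0.
Proof.
move=> small /andP[pa ab] bq cd; set w := b - a; set h := d - c.
have w0 : 0 <= w by rewrite subr_ge0. have h0 : 0 <= h by rewrite subr_ge0.
have /choice[G hG] : forall ns : nat * (R * R), exists s' : R * R,
   [/\ s'.1 = ns.2.1 \/ s'.1 = ns.2.1 + w / 2 ^+ ns.1.+1,
      s'.2 = ns.2.2 \/ s'.2 = ns.2.2 + h / 2 ^+ ns.1.+1 &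
   rnorm (J ns.2.1 (ns.2.1 + w / 2 ^+ ns.1) ns.2.2 (ns.2.2 + h / 2 ^+ ns.1)) <=
   4 * rnorm (J s'.1 (s'.1 + w / 2 ^+ ns.1.+1) s'.2 (s'.2 + h / 2 ^+ ns.1.+1))].
  by move=> [n s]; exact: rect_function_quarter.
have [s s0 sS] : exists2 s : nat -> R * R, s 0%N = (a, c) & forall n, s n.+1 = G (n, s n).
  by exists (fix s n : R * R := if n is m.+1 then G (m, s m) else (a, c)).
pose x n := (s n).1; pose y n := (s n).2.
have pow0 n : 0 < (2 : R) ^+ n by rewrite exprn_gt0.
have half (t : R) n : t / 2 ^+ n = t / 2 ^+ n.+1 + t / 2 ^+ n.+1.
  by rewrite exprS; field; rewrite gt_eqF//=; lra.
have nest (t : R) (u : nat -> R) : 0 <= t ->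
    (forall n, u n.+1 = u n \/ u n.+1 = u n + t / 2 ^+ n.+1) ->
    exists l, forall n, u n <= l <= u n + t / 2 ^+ n.
  move=> t0 hu; have t0n n : 0 <= t / 2 ^+ n by rewrite divr_ge0// ltW.
  have inc : nondecreasing_seq u.
    apply/nondecreasing_seqP => n; have := t0n n.+1; case: (hu n) => ->; lra.
  have dec m n : (m <= n)%N -> u n + t / 2 ^+ n <= u m + t / 2 ^+ m.
    move=> /subnKC <-; elim: (n - m)%N => [|k ih]; first by rewrite addn0.
    apply: le_trans ih; rewrite addnS (half t (m + k)%N); have := t0n (m + k).+1.
    by case: (hu (m + k)%N) => ->; lra.
  exists (sup (range u)) => n; apply/andP; split.
    apply: ub_le_sup; last by exists n.
    exists (u 0%N + t / 2 ^+ 0) => _ [m _ <-].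
    by have := dec 0%N m (leq0n _); have := t0n m; lra.
  apply: ge_sup; first by exists (u 0%N), 0%N.
  move=> _ [m _ <-]; case: (leqP n m) => nm; first by have := dec _ _ nm; have := t0n m; lra.
  by have := inc _ _ (ltnW nm); have := t0n n; lra.
have xS n : x n.+1 = x n \/ x n.+1 = x n + w / 2 ^+ n.+1.
  by rewrite /x sS; have [hx _ _] := hG (n, s n).
have yS n : y n.+1 = y n \/ y n.+1 = y n + h / 2 ^+ n.+1.
  by rewrite /y sS; have [_ hy _] := hG (n, s n).
have [X hX] := nest w x w0 xS; have [Y hY] := nest h y h0 yS.
have hJ n : rnorm (J a b c d) <=
    4 ^+ n * rnorm (J (x n) (x n + w / 2 ^+ n) (y n) (y n + h / 2 ^+ n)).
  elim: n => [|n ih].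
    by rewrite /x /y s0 /= !expr0 !divr1 mul1r /w /h !subrKC.
  have step : rnorm (J (x n) (x n + w / 2 ^+ n) (y n) (y n + h / 2 ^+ n)) <=
      4 * rnorm (J (x n.+1) (x n.+1 + w / 2 ^+ n.+1) (y n.+1) (y n.+1 + h / 2 ^+ n.+1)).
    by rewrite /x /y sS; have [_ _ hJ] := hG (n, s n); exact: hJ.
  move: step ih; move: (rnorm (J (x n) _ _ _)) (rnorm (J (x n.+1) _ _ _)) => u v.
  move=> uv /le_trans; apply.
  have p4 : 0 < (4 : R) ^+ n by rewrite exprn_gt0.
  by rewrite exprSr -mulrA ler_pM2l.
have x_in n : p <= x n /\ x n + w / 2 ^+ n <= q.
  have aux m : a <= x m /\ x m + w / 2 ^+ m <= b.
    elim: m => [|m [ih1 ih2]]; first by rewrite /x s0 /= expr0 divr1 /w; lra.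
    have := half w m; have : 0 <= w / 2 ^+ m.+1 by rewrite divr_ge0// ltW.
    by move: ih1 ih2; case: (xS m) => ->; lra.
  by have [] := aux n; lra.
have XX : p <= X <= q.
  by have := hX 0%N; have [] := x_in 0%N; lra.
apply: rnorm_le_eps => e e0.
have wh0 : 0 < (w + h) ^+ 2 + 1 by have := sqr_ge0 (w + h); lra.
have e1 : 0 < e / ((w + h) ^+ 2 + 1) by rewrite divr_gt0.
have : e / ((w + h) ^+ 2 + 1) * ((w + h) ^+ 2 + 1) = e by rewrite divfK ?gt_eqF.
move: e1; set e' := e / _ => e1 ee; have [r r0 hr] := small X Y _ XX e1.
have [n hn] := geometric_small (w + h) r0.
have wn0 : 0 <= w / 2 ^+ n by rewrite divr_ge0// ltW.
have hn0 : 0 <= h / 2 ^+ n by rewrite divr_ge0// ltW.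
have whn : w / 2 ^+ n + h / 2 ^+ n = (w + h) / 2 ^+ n by rewrite -mulrDl.
have [x1 x2] := x_in n.
have := hr (x n) (w / 2 ^+ n) (y n) (h / 2 ^+ n) x1 x2 wn0 hn0 (hX n) (hY n).
rewrite whn -exprVn => /(_ hn) Jn.
apply: (le_trans (hJ n)); apply: (@le_trans _ _ (4 ^+ n * (e' * ((w + h) * 2^-1 ^+ n) ^+ 2))).
  by rewrite ler_pM2l ?exprn_gt0//; rewrite exprVn in Jn *.
have -> : 4 ^+ n * (e' * ((w + h) * 2^-1 ^+ n) ^+ 2) = e' * (w + h) ^+ 2.
  have t4 : 4 ^+ n * (2^-1 ^+ n) ^+ 2 = 1 :> R.
    by rewrite exprAC -exprMn (_ : 4 * 2^-1 ^+ 2 = 1 :> R) ?expr1n//; field.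
  by rewrite exprMn mulrCA [_ * (2^-1 ^+ n) ^+ 2]mulrC [4 ^+ n * _]mulrA t4 mul1r.
lra.
Qed.

End RectangleFunctions.

Section Primitive.
Context (R : realType) (E : normedModType R[i]) (cE : @seq_complete R E).

Definition clip (p q x : R) : R := Num.max p (Num.min q x).

Lemma clip_id p q x : p <= x <= q -> clip p q x = x.
Proof. by move=> /andP[px xq]; rewrite /clip (min_idPr xq) (max_idPr px). Qed.

Lemma clip_in p q x : p <= q -> p <= clip p q x <= q.
Proof. by move=> pq; rewrite /clip le_max lexx ge_max pq ge_min lexx. Qed.

Lemma clip_lip p q x y : p <= q -> `|clip p q x - clip p q y| <= `|x - y|.
Proof.
move=> pq; rewrite /clip; case: (leP q x) => h1; case: (leP q y) => h2;
  [case: (leP p q) => h3; case: (leP p q) => h4|case: (leP p q) => h3; case: (leP p y) => h4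
  |case: (leP p x) => h3; case: (leP p q) => h4|case: (leP p x) => h3; case: (leP p y) => h4];
  rewrite ?subrr ?normr0//; try (exfalso; lra);
  by rewrite ler_norml; apply/andP; split; case: (leP 0 (x - y)) => h5;
   rewrite ?(ger0_norm h5) ?(ltr0_norm h5); lra.
Qed.

Lemma cmod_complex (x y x' y' : R) :
  cmod (Complex x y - Complex x' y') <= `|x - x'| + `|y - y'|.
Proof. exact: cmod_le. Qed.

Context (f : R[i]^o -> E) (M : R).
Hypothesis holo : forall z, open_strip z -> exists d, cderiv f z d.
Hypothesis bd : forall z, open_strip z -> rnorm (f z) <= M.

Let M0 : 0 <= M.
Proof.
apply: (le_trans _ (bd (z := Complex (1 / 2 : R) 0) _)); first exact: rnorm_ge0.
by rewrite /open_strip /=; lra.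
Qed.

Let fcont x y (e : R) : 0 < x < 1 -> 0 < e -> exists2 r : R, 0 < r &
  forall x' y', `|x' - x| + `|y' - y| < r -> rnorm (f (Complex x' y') - f (Complex x y)) < e.
Proof.
move=> x01 e0; have [d hd] := holo (z := Complex x y) x01.
have [r r0 hr] := cderiv_continuous hd e0; exists r => // x' y' h.
by apply: hr; apply: le_lt_trans h; exact: cmod_complex.
Qed.

Lemma bounded_smeas_vertical x : 0 < x < 1 -> bounded_smeas (fun t => f (Complex x t)).
Proof.
move=> x01; split; last by exists M => t; exact: bd.
apply: smeas_continuous => y e e0; have [r r0 hr] := fcont y x01 e0.
by exists r => // t ht; apply: hr; rewrite subrr normr0 add0r.
Qed.

(* The rectangles considered below lie in [p, q] x R. Replacing the real part by
   its projection on [p, q] extends the integrands to R. *)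
Section Goursat.
Context (p q : R) (p0 : 0 < p) (pq : p <= q) (q1 : q < 1).

Let phi (x y : R) : E := f (Complex (clip p q x) y).

Let clip01 x : 0 < clip p q x < 1.
Proof.
by have /andP[h1 h2] := clip_in x pq; rewrite (lt_le_trans p0)// (le_lt_trans _ q1).
Qed.

Lemma bounded_smeas_horizontal c : bounded_smeas (fun t => f (Complex (clip p q t) c)).
Proof.
split; last by exists M => t; exact/bd/clip01.
apply: smeas_continuous => y e e0; have [r r0 hr] := fcont c (clip01 y) e0.
exists r => // t ht; apply: hr; rewrite subrr normr0 addr0.
by apply: le_lt_trans ht; exact: clip_lip.
Qed.

Let bh c : bounded_smeas (phi^~ c) := bounded_smeas_horizontal c.
Let bv x : bounded_smeas (phi x) := bounded_smeas_vertical (clip01 x).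

Let bsub (h k : R -> E) : bounded_smeas h -> bounded_smeas k ->
  bounded_smeas (fun y => h y - k y).
Proof.
move=> hh hk; have := bounded_smeasD hh (bounded_smeasZ (bounded_smeas_cst (-1 : R[i]^o)) hk).
by congr bounded_smeas; apply/funext => y; rewrite scaleN1r.
Qed.

(** The integral of f(z) dz along the boundary of the rectangle [a, b] x [c, d]. *)
Definition rect_int (a b c d : R) : E := locked_with oint_key
  (oint a b (fun t => phi t c - phi t d) + 'i%C *: oint c d (fun t => phi b t - phi a t)).

Let rect_intE a b c d : rect_int a b c d =
  oint a b (fun t => phi t c - phi t d) + 'i%C *: oint c d (fun t => phi b t - phi a t).
Proof. by rewrite /rect_int unlock. Qed.

Lemma rect_int_splitx a m b c d : rect_int a b c d = rect_int a m c d + rect_int m b c d.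
Proof.
rewrite 3!rect_intE addrACA (oint_chasles cE a m b (bsub (bh c) (bh d))).
congr (_ + _); rewrite -scalerDr -(ointD cE c d (bsub (bv m) (bv a)) (bsub (bv b) (bv m))).
by congr (_ *: oint _ _ _); apply/funext => t; rewrite [RHS]addrC addrA subrK.
Qed.

Lemma rect_int_splity a b c m d : rect_int a b c d = rect_int a b c m + rect_int a b m d.
Proof.
rewrite 3!rect_intE addrACA -scalerDr (oint_chasles cE c m d (bsub (bv b) (bv a))).
congr (_ + _); rewrite -(ointD cE a b (bsub (bh c) (bh m)) (bsub (bh m) (bh d))).
by congr oint; apply/funext => t; rewrite [RHS]addrA subrK.
Qed.

(* The bound by the affine approximation of f at a point of the rectangle. *)
Lemma rect_int_small (x y w h e : R) (d : E) a c : p <= a -> a + w <= q ->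
  0 <= w -> 0 <= h -> a <= x <= a + w -> c <= y <= c + h -> 0 <= e ->
  (forall k, cmod k <= w + h ->
     rnorm (f (Complex x y + k) - f (Complex x y) - k *: d) <= e * cmod k) ->
  rnorm (rect_int a (a + w) c (c + h)) <= 2 * e * (w + h) ^+ 2.
Proof.
move=> pa aq w0 h0 ax cy e0 hf.
pose A (u v : R) : E := f (Complex x y) + (Complex u v - Complex x y) *: d.
have appr u v : a <= u <= a + w -> c <= v <= c + h -> rnorm (phi u v - A u v) <= e * (w + h).
  move=> hu hv; have ku : clip p q u = u by apply: clip_id; lra.
  have kk : cmod (Complex u v - Complex x y) <= w + h.
    apply: (le_trans (cmod_complex _ _ _ _)); apply: lerD; rewrite ler_norml; lra.
  have := hf _ kk; rewrite subrKC /A opprD addrA /phi ku => /le_trans; apply.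
  by rewrite ler_wpM2l.
have cst_x t : A t c - A t (c + h) = (- ('i%C * h%:C%C)) *: d.
  rewrite /A opprD addrACA subrr add0r -scalerBl; congr (_ *: _).
  by apply/eqP; rewrite eq_complex /=; apply/andP; split; apply/eqP; ring.
have cst_y t : A (a + w) t - A a t = w%:C%C *: d.
  rewrite /A opprD addrACA subrr add0r -scalerBl; congr (_ *: _).
  by apply/eqP; rewrite eq_complex /=; apply/andP; split; apply/eqP; ring.
have aw : a <= a + w by lra.
have ch : c <= c + h by lra.
have r0 : 0 <= 2 * (e * (w + h)) by rewrite !mulr_ge0// addr_ge0.
have h1 : rnorm (oint a (a + w) (fun t => phi t c - phi t (c + h)) -
                 oint a (a + w) (fun=> (- ('i%C * h%:C%C)) *: d)) <= 2 * (e * (w + h)) * `|a + w - a|.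
  apply: oint_dist => //; [exact: bsub|exact: bounded_smeas_cst|] => t.
  rewrite (min_idPl aw) (max_idPr aw) -(cst_x t) => ht.
  have c1 : c <= c <= c + h by lra.
  have c2 : c <= c + h <= c + h by lra.
  rewrite subr_swap; apply: (le_trans (rnorm_subr _ _)).
  by have := appr t c ht c1; have := appr t (c + h) ht c2; lra.
have h2 : rnorm (oint c (c + h) (fun t => phi (a + w) t - phi a t) -
                 oint c (c + h) (fun=> w%:C%C *: d)) <= 2 * (e * (w + h)) * `|c + h - c|.
  apply: oint_dist => //; [exact: bsub|exact: bounded_smeas_cst|] => t.
  rewrite (min_idPl ch) (max_idPr ch) -(cst_y t) => ht.
  have c1 : a <= a <= a + w by lra.
  have c2 : a <= a + w <= a + w by lra.
  rewrite subr_swap; apply: (le_trans (rnorm_subr _ _)).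
  by have := appr a t c1 ht; have := appr (a + w) t c2 ht; lra.
have nn (u t : R) : 0 <= t -> `|u + t - u| = t.
  by move=> t0; rewrite addrAC subrr add0r ger0_norm.
have mm (u t : R) : (u + t - u)%:C%C = t%:C%C by rewrite addrAC subrr add0r.
rewrite (oint_cst cE) (nn _ _ w0) (mm a w) in h1.
rewrite (oint_cst cE) (nn _ _ h0) (mm c h) in h2.
(* the two constant terms cancel: w(-ih) + i(hw) = 0 *)
have z0 : w%:C%C *: ((- ('i%C * h%:C%C)) *: d) + 'i%C *: (h%:C%C *: (w%:C%C *: d)) = 0.
  rewrite !scalerA -scalerDl; set k := (X in X *: d); suff -> : k = 0 by rewrite scale0r.
  by rewrite /k; ring.
rewrite -[rect_int _ _ _ _]subr0 -z0 rect_intE opprD addrACA -scalerBr.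
apply: (le_trans (rnormD _ _)); rewrite rnorm_scale cmodi mul1r.
apply: (le_trans (lerD h1 h2)).
by rewrite -mulrDr expr2 !mulrA.
Qed.

Lemma rect_int0 a b c d : p <= a <= b -> b <= q -> c <= d -> rect_int a b c d = 0.
Proof.
move=> ab bq cd; apply: (@rect_function_zero _ _ rect_int rect_int_splitx rect_int_splity p q) => //.
move=> x y e px e0; have x01 : 0 < x < 1 by move: p0 q1; lra.
have [dz hd] := holo (z := Complex x y) x01.
have e2 : 0 < e / 2 by lra.
have [r r0 hr] := hd _ e2; exists r => // a' w c' h h1 h2 h3 h4 h5 h6 h7.
have := @rect_int_small x y w h (e / 2) dz a' c' h1 h2 h3 h4 h5 h6 (ltW e2).
rewrite (_ : 2 * (e / 2) = e); last by field.
by apply => k hk; apply: hr; exact: le_lt_trans h7.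
Qed.

Lemma rect_int_any a b c d : p <= a <= q -> p <= b <= q -> rect_int a b c d = 0.
Proof.
have neg u v (k k' : R -> E) : bounded_smeas k -> (forall t, k' t = - k t) ->
    oint u v k' = - oint u v k.
  move=> hk kk; have fZ (z : R[i]) (t : E) : - (z *: t) = z *: - t by rewrite scalerN.
  have fn (t : E) : rnorm (- t) <= rnorm t by rewrite rnormN.
  rewrite -(oint_map (f := -%R) u v cE (@opprD _) fZ fn hk).
  by congr oint; apply/funext.
have swapx u v t t' : rect_int u v t t' = - rect_int v u t t'.
  rewrite 2!rect_intE opprD -scalerN; congr (_ + _ *: _).
    by rewrite oint_opp//; exact: bsub.
  by apply: neg; [exact: bsub|move=> y; rewrite opprB].
have swapy u v t t' : rect_int u v t t' = - rect_int u v t' t.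
  rewrite 2!rect_intE opprD -scalerN; congr (_ + _ *: _).
    by apply: neg; [exact: bsub|move=> y; rewrite opprB].
  by rewrite oint_opp//; exact: bsub.
move=> ha hb; wlog ab : a b ha hb / a <= b => [H|].
  by have [|/ltW] := leP a b; [exact: H|rewrite swapx => /H ->; rewrite ?oppr0].
wlog cd : c d / c <= d => [H|].
  by have [|/ltW] := leP c d; [exact: H|rewrite swapy => /H ->; rewrite ?oppr0].
by apply: rect_int0 => //; lra.
Qed.

End Goursat.

Let hint (a b c : R) : E :=
  oint a b (fun t => f (Complex (clip (Num.min a b) (Num.max a b) t) c)).

Let hintE p q a b c : 0 < p -> q < 1 -> p <= a <= q -> p <= b <= q ->
  hint a b c = oint a b (fun t => f (Complex (clip p q t) c)).
Proof.
move=> p0 q1 /andP[pa aq] /andP[pb bq].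
have mm : Num.min a b <= Num.max a b by rewrite ge_min !le_max lexx.
have m0 : p <= Num.min a b by rewrite le_min pa pb.
have m1 : Num.max a b <= q by rewrite ge_max aq bq.
apply: oint_eq => //; try by apply: bounded_smeas_horizontal; lra.
by move=> t ht; rewrite !clip_id//; move/andP: ht => [h1 h2]; lra.
Qed.

(** The integral of f along a horizontal and then a vertical segment. *)
Let F (z : R[i]^o) : E :=
  hint (1 / 2) (complex.Re z) 0 +
  'i%C *: oint 0 (complex.Im z) (fun t => f (Complex (complex.Re z) t)).

Let F_incr x y u v : 0 < x < 1 -> 0 < x + u < 1 ->
  exists p q, [/\ 0 < p, q < 1, p <= x <= q & p <= x + u <= q] /\
  F (Complex (x + u) (y + v)) - F (Complex x y) =
  oint x (x + u) (fun t => f (Complex (clip p q t) y)) +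
  'i%C *: oint y (y + v) (fun t => f (Complex (x + u) t)).
Proof.
move=> x01 u01.
pose p := Num.min (1 / 2) (Num.min x (x + u)); pose q := Num.max (1 / 2) (Num.max x (x + u)).
have p0 : 0 < p by rewrite !lt_min; lra.
have q1 : q < 1 by rewrite !gt_max; lra.
have h2 : p <= 1 / 2 <= q by rewrite /p /q ge_min le_max lexx.
have hx : p <= x <= q by rewrite /p /q !ge_min !le_max lexx !orbT.
have hu : p <= x + u <= q by rewrite /p /q !ge_min !le_max lexx !orbT.
have pq : p <= q by lra.
exists p, q; split=> //; rewrite /F /= !(hintE _ p0 q1)//.
have bh c := bounded_smeas_horizontal p0 pq q1 c.
have bvx := bounded_smeas_vertical x01; have bvu := bounded_smeas_vertical u01.
have := rect_int_any p0 pq q1 0 y hx hu; rewrite /rect_int unlock !clip_id//.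
have sub_oint a b (h k : R -> E) : bounded_smeas h -> bounded_smeas k ->
    oint a b (fun t => h t - k t) = oint a b h - oint a b k.
  move=> hh hk; apply: (addIr (oint a b k)); rewrite subrK -ointD//.
    by congr oint; apply/funext => t; rewrite subrK.
  have := bounded_smeasD hh (bounded_smeasZ (bounded_smeas_cst (-1 : R[i]^o)) hk).
  by congr bounded_smeas; apply/funext => t; rewrite scaleN1r.
rewrite (sub_oint _ _ _ _ (bh 0) (bh y)) (sub_oint _ _ _ _ bvu bvx).
rewrite -(oint_chasles cE (1 / 2) x (x + u) (bh 0)) -(oint_chasles cE 0 y (y + v) bvu).
by rewrite scalerBr scalerDr; exact: zmod_path.
Qed.

(** The primitive of f; its increments along vertical segments are the
    integrals that the boundary values are compared with. *)
Lemma primitive : exists G : R[i]^o -> E,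
  [/\ forall z, open_strip z -> cderiv G z (f z),
      forall x y u v, 0 < x < 1 -> 0 < x + u < 1 ->
        rnorm (G (Complex (x + u) (y + v)) - G (Complex x y)) <= M * (`|u| + `|v|) &
      forall x a b, 0 < x < 1 -> G (Complex x b) - G (Complex x a) =
        'i%C *: oint a b (fun t => f (Complex x t))].
Proof.
exists F; split.
- move=> [x y] x01 e e0.
  have e2 : 0 < e / 2 by lra.
  have [r r0 hr] := fcont y x01 e2.
  have x01' : 0 < x < 1 := x01.
  exists (Num.min (r / 2) (Num.min x (1 - x))); first by rewrite !lt_min; lra.
  move=> [u v]; rewrite !lt_min => /and3P[h1 h2 h3].
  have hu : `|u| <= cmod (Complex u v) := ler_Re (Complex u v).
  have hv : `|v| <= cmod (Complex u v) := ler_Im (Complex u v).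
  have u01 : 0 < x + u < 1 by move: hu; rewrite ler_norml => /andP[]; lra.
  have [p [q [[p0 q1 px pu] hF]]] := F_incr y v x01' u01.
  have -> : (Complex x y + Complex u v : R[i]) = Complex (x + u) (y + v) by [].
  rewrite hF; have pq : p <= q by lra.
  have bh := bounded_smeas_horizontal p0 pq q1 y; have bvu := bounded_smeas_vertical u01.
  have -> : Complex u v *: f (Complex x y) =
      oint x (x + u) (fun=> f (Complex x y)) + 'i%C *: oint y (y + v) (fun=> f (Complex x y)).
    rewrite !(oint_cst cE) scalerA -scalerDl; congr (_ *: _).
    by apply/eqP; rewrite eq_complex /=; apply/andP; split; apply/eqP; ring.
  rewrite opprD addrACA -scalerBr; apply: (le_trans (rnormD _ _)).
  rewrite rnorm_scale cmodi mul1r.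
  have b1 : rnorm (oint x (x + u) (fun t => f (Complex (clip p q t) y)) -
      oint x (x + u) (fun=> f (Complex x y))) <= e / 2 * `|x + u - x|.
    apply: oint_dist => //; [exact: bounded_smeas_cst|exact: ltW|] => t ht.
    apply/ltW/hr; rewrite subrr normr0 addr0 clip_id; last first.
      have m1 : p <= Num.min x (x + u) by rewrite le_min; lra.
      have m2 : Num.max x (x + u) <= q by rewrite ge_max; lra.
      by lra.
    have : `|t - x| <= `|u|.
      move: ht; have [u0|u0] := leP 0 u.
        have xu : x <= x + u by lra.
        by rewrite (min_idPl xu) (max_idPr xu) ler_norml (ger0_norm u0); lra.
      have xu : x + u <= x by lra.
      by rewrite (min_idPr xu) (max_idPl xu) ler_norml (ltr0_norm u0); lra.
    by lra.
  have b2 : rnorm (oint y (y + v) (fun t => f (Complex (x + u) t)) -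
      oint y (y + v) (fun=> f (Complex x y))) <= e / 2 * `|y + v - y|.
    apply: oint_dist => //; [exact: bounded_smeas_cst|exact: ltW|] => t ht.
    apply/ltW/hr; rewrite addrAC subrr add0r.
    have : `|t - y| <= `|v|.
      move: ht; have [v0|v0] := leP 0 v.
        have xu : y <= y + v by lra.
        by rewrite (min_idPl xu) (max_idPr xu) ler_norml (ger0_norm v0); lra.
      have xu : y + v <= y by lra.
      by rewrite (min_idPr xu) (max_idPl xu) ler_norml (ltr0_norm v0); lra.
    by lra.
  apply: (le_trans (lerD b1 b2)); rewrite ![_ + _ - _]addrAC !subrr !add0r -mulrDr.
  have cc : `|u| + `|v| <= 2 * cmod (Complex u v) by lra.
  by have := ler_wpM2l (ltW e2) cc; rewrite mulrA divfK//; lra.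
- move=> x y u v x01 u01; have [p [q [[p0 q1 px pu] ->]]] := F_incr y v x01 u01.
  have pq : p <= q by lra.
  have bh := bounded_smeas_horizontal p0 pq q1 y; have bvu := bounded_smeas_vertical u01.
  apply: (le_trans (rnormD _ _)); rewrite rnorm_scale cmodi mul1r mulrDr.
  apply: lerD.
    rewrite -[u in `|u|](addrK x) [u + x]addrC; apply: (oint_bound cE bh M0) => t _.
    apply: bd; rewrite /open_strip /=.
    by have /andP[c1 c2] := clip_in t pq; lra.
  rewrite -[v in `|v|](addrK y) [v + y]addrC; apply: (oint_bound cE bvu M0) => t _.
  exact: bd.
- move=> x a b x01; rewrite /F /= opprD addrACA subrr add0r -scalerBr; congr (_ *: _).
  by rewrite -(oint_chasles cE 0 a b (bounded_smeas_vertical x01)) addrC addKr.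
Qed.

End Primitive.

(** * The maximum principle *)

Section MaximumPrinciple.
Context (R : realType).

(** A discrete form of subharmonicity: up to o(s^2), the value at a point is at
    most the mean value over the four points at distance s. For the norm of a
    holomorphic function this follows from Taylor expansion to the second order. *)
Definition four_point_sub (phi : R -> R -> R) (x y : R) := forall e : R, 0 < e ->
  exists2 r : R, 0 < r & forall s, 0 < s < r ->
    4 * phi x y - e * s ^+ 2 <=
    phi (x + s) y + phi (x - s) y + phi x (y + s) + phi x (y - s).

Definition continuous_on_rect (a b c d : R) (phi : R -> R -> R) :=
  forall x y, a <= x <= b -> c <= y <= d -> forall e : R, 0 < e ->
  exists2 r : R, 0 < r & forall x' y', a <= x' <= b -> c <= y' <= d ->
    `|x' - x| + `|y' - y| < r -> `|phi x' y' - phi x y| < e.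

(** The projection onto the rectangle reduces this to the compactness of intervals. *)
Lemma rect_max (a b c d : R) (phi : R -> R -> R) : a <= b -> c <= d ->
  continuous_on_rect a b c d phi ->
  exists x y, [/\ a <= x <= b, c <= y <= d &
    forall x' y', a <= x' <= b -> c <= y' <= d -> phi x' y' <= phi x y].
Proof.
move=> ab cd cphi.
pose psi (p : R * R) := phi (clip a b p.1) (clip c d p.2).
have cpsi : continuous psi.
  move=> [x y]; apply/cvgrPdist_lt => e e0.
  have [r r0 hr] := cphi _ _ (clip_in x ab) (clip_in y cd) _ e0.
  have r2 : 0 < r / 2 by lra.
  apply: filterS (nbhsx_ballx (x, y) _ r2) => -[x' y'] [/= bx by_]; rewrite distrC; apply: hr; try exact: clip_in.
  rewrite -ball_normE /= in bx; rewrite -ball_normE /= in by_.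
  have := clip_lip x' x ab; have := clip_lip y' y cd.
  by rewrite (distrC x') (distrC y'); lra.
pose K : set (R * R) := `[a, b]%classic `*` `[c, d]%classic.
have K0 : K !=set0 by exists (a, c); split; rewrite /= in_itv /= lexx.
have cK : compact K by apply: compact_setX; exact: segment_compact.
have [[x y] /= xyK hm] := compact_EVT_max K0 cK (continuous_subspaceT cpsi).
move: xyK; rewrite inE => -[/=]; rewrite !in_itv /= => hx hy.
exists x, y; split=> // x' y' hx' hy'.
have := hm (x', y'); rewrite inE /psi /= !clip_id//; apply.
by split; rewrite /= in_itv.
Qed.

(** Adding a small multiple of x^2 makes the inequality strict, which excludes a
    maximum at a point of U. *)
Lemma max_principle (a b c d m : R) (U : R -> R -> Prop) (phi : R -> R -> R) :
  a <= b -> c <= d -> continuous_on_rect a b c d phi ->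
  (forall x y, U x y -> a < x < b /\ c < y < d) ->
  (forall x y, U x y -> four_point_sub phi x y) ->
  (forall x y, a <= x <= b -> c <= y <= d -> ~ U x y -> phi x y <= m) ->
  forall x y, a <= x <= b -> c <= y <= d -> phi x y <= m.
Proof.
move=> ab cd cphi Uin sub bdry x0 y0 hx0 hy0; rewrite leNgt; apply/negP => h0.
pose B := a ^+ 2 + b ^+ 2 + 1.
have a2 : 0 <= a ^+ 2 by exact: sqr_ge0.
have b2 : 0 <= b ^+ 2 by exact: sqr_ge0.
have B0 : 0 < B by rewrite /B; lra.
have hB x : a <= x <= b -> 0 <= x ^+ 2 <= B.
  move=> /andP[ax xb]; rewrite sqr_ge0 /B /=; have [x0'|x0'] := leP 0 x.
    have : x ^+ 2 <= b ^+ 2 by rewrite !expr2; nra.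
    by lra.
  have : x ^+ 2 <= a ^+ 2 by rewrite !expr2; nra.
  by lra.
pose e := (phi x0 y0 - m) / (2 * B).
have e0 : 0 < e by rewrite divr_gt0//; lra.
have eB : 2 * (e * B) = phi x0 y0 - m by rewrite /e; field; rewrite gt_eqF.
clearbody e; pose psi x y := phi x y + e * x ^+ 2.
have cpsi : continuous_on_rect a b c d psi.
  move=> x y hx hy t t0; have t2 : 0 < t / 2 by lra.
  have [r r0 hr] := cphi x y hx hy _ t2.
  have D0 : 0 < 2 * e * (`|a| + `|b| + 1).
    have ab0 : 0 < `|a| + `|b| + 1 by have := normr_ge0 a; have := normr_ge0 b; lra.
    by rewrite mulr_gt0// mulr_gt0.
  exists (Num.min r (t / 2 / (2 * e * (`|a| + `|b| + 1)))).
    by rewrite lt_min r0 divr_gt0.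
  move=> x' y' hx' hy'; rewrite lt_min ltr_pdivlMr// => /andP[h1 h2].
  have := hr x' y' hx' hy' h1 => h3.
  have -> : psi x' y' - psi x y = phi x' y' - phi x y + e * ((x' - x) * (x' + x)).
    by rewrite /psi; ring.
  apply: (le_lt_trans (ler_normD _ _)).
  have bnd z : a <= z <= b -> `|z| <= `|a| + `|b|.
    move=> /andP[z1 z2]; have := ler_norm b; have := ler_norm (- a); rewrite normrN.
    have := normr_ge0 a; have := normr_ge0 b.
    by rewrite ler_norml; lra.
  have s1 : `|x' + x| <= 2 * (`|a| + `|b| + 1).
    have := ler_normD x' x; have := bnd _ hx; have := bnd _ hx'; lra.
  have : `|e * ((x' - x) * (x' + x))| <= `|x' - x| * (2 * e * (`|a| + `|b| + 1)).
    rewrite 2!normrM (gtr0_norm e0) mulrCA ler_wpM2l//.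
    by have := ler_wpM2l (ltW e0) s1; lra.
  have : `|x' - x| * (2 * e * (`|a| + `|b| + 1)) <=
      (`|x' - x| + `|y' - y|) * (2 * e * (`|a| + `|b| + 1)).
    by rewrite ler_wpM2r ?(ltW D0)// lerDl.
  by lra.
have [x1 [y1 [hx1 hy1 hm]]] := rect_max ab cd cpsi.
have h1 : m < phi x1 y1.
  have := hm _ _ hx0 hy0; rewrite /psi.
  have /andP[p1 p2] := hB _ hx0; have /andP[p3 p4] := hB _ hx1.
  have := mulr_ge0 (ltW e0) p1; have := ler_wpM2l (ltW e0) p4; lra.
have U1 : U x1 y1.
  by apply: contrapT => nU; have := bdry _ _ hx1 hy1 nU; rewrite leNgt h1.
have [/andP[i1 i2] /andP[i3 i4]] := Uin _ _ U1.
have [r r0 hr] := sub _ _ U1 _ e0.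
pose s := Num.min (r / 2) (Num.min (Num.min (x1 - a) (b - x1)) (Num.min (y1 - c) (d - y1))).
have s0 : 0 < s by rewrite !lt_min; lra.
have : s <= s by []; rewrite {2}/s !le_min => /and3P[s1 /andP[s2 s3] /andP[s4 s5]].
have sr : 0 < s < r by lra.
have := hr _ sr.
have m1 := hm (x1 + s) y1 ltac:(lra) hy1; have m2 := hm (x1 - s) y1 ltac:(lra) hy1.
have m3 := hm x1 (y1 + s) hx1 ltac:(lra); have m4 := hm x1 (y1 - s) hx1 ltac:(lra).
rewrite /psi in m1 m2 m3 m4.
have s2' : 0 < e * s ^+ 2 by rewrite mulr_gt0// exprn_gt0.
have q1 : e * (x1 + s) ^+ 2 = e * x1 ^+ 2 + 2 * (e * (x1 * s)) + e * s ^+ 2 by ring.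
have q2 : e * (x1 - s) ^+ 2 = e * x1 ^+ 2 - 2 * (e * (x1 * s)) + e * s ^+ 2 by ring.
by lra.
Qed.

End MaximumPrinciple.

Section MeanValueInequality.
Context (R : realType) (E : normedModType R[i]).

(** At a maximum t > 0 of |g(t) - g(0)| - C' t the left difference quotients of g
    would have norm at least C' > C. *)
Lemma mean_value_inequality (g : R -> E) (C : R) :
  (forall t, 0 <= t <= 1 -> forall e : R, 0 < e -> exists2 r : R, 0 < r &
     forall s, `|s| < r -> rnorm (g (t + s) - g t) <= (C + e) * `|s|) ->
  0 <= C -> rnorm (g 1 - g 0) <= C.
Proof.
move=> hg C0; apply/ler_addgt0Pr => e e0.
have e2 : 0 < e / 2 by lra.
pose k t := rnorm (g (clip 0 1 t) - g 0) - (C + e) * clip 0 1 t.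
have l01 : 0 <= 1 :> R by [].
have ck : {within `[0, 1], continuous k}.
  apply: continuous_subspaceT => t; apply/cvgrPdist_lt => d d0.
  have [r r0 hr] := hg _ (clip_in t l01) _ e2.
  have Ce : 0 < 2 * (C + e) by lra.
  have rd : 0 < Num.min r (d / (2 * (C + e))) by rewrite lt_min r0 divr_gt0.
  apply: filterS (nbhsx_ballx t _ rd) => t'; rewrite -ball_normE /= lt_min ltr_pdivlMr// => /andP[t1 t2].
  have cl := clip_lip t' t l01; rewrite (distrC t') in cl.
  have := hr (clip 0 1 t' - clip 0 1 t) (le_lt_trans cl t1); rewrite subrKC => h1.
  rewrite distrC /k opprB; set u := clip 0 1 t; set u' := clip 0 1 t'.
  have h2 := rnorm_lip (g u' - g 0) (g u - g 0).
  rewrite opprB addrA subrK in h2.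
  have -> : rnorm (g u' - g 0) - (C + e) * u' + ((C + e) * u - rnorm (g u - g 0)) =
     (rnorm (g u' - g 0) - rnorm (g u - g 0)) + (C + e) * (u - u') by ring.
  apply: (le_lt_trans (ler_normD _ _)); rewrite normrM (distrC u) ger0_norm; last by lra.
  have h3 := ler_wpM2l (_ : 0 <= C + e) cl.
  rewrite -/u -/u' in h1 h3.
  have h4 : (C + e / 2) * `|u' - u| <= (C + e) * `|u' - u|.
    by rewrite ler_wpM2r//; lra.
  have := h3 ltac:(lra); lra.
have [t1 t1in hm] := EVT_max l01 ck.
have cl1 t : 0 <= t <= 1 -> clip 0 1 t = t by exact: clip_id.
move: t1in; rewrite in_itv /= => t1in.
have k1 := hm 1; rewrite in_itv /= l01 lexx in k1; have {}k1 := k1 isT.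
have [t10|t1pos] := leP t1 0.
  have t1e : t1 = 0 by lra.
  move: k1; rewrite t1e /k !cl1; [|lra|lra].
  by rewrite subrr rnorm0; lra.
exfalso; have [r r0 hr] := hg _ t1in _ e2.
pose s := Num.min (r / 2) t1.
have s0 : 0 < s by rewrite lt_min; lra.
have sr : s < r by rewrite gt_min; apply/orP; left; lra.
have st : s <= t1 by rewrite ge_min lexx orbT.
have := hr (- s); rewrite normrN gtr0_norm// => /(_ sr) h1.
have in2 : 0 <= t1 - s <= 1 by lra.
have := hm (t1 - s); rewrite in_itv /= => /(_ in2); rewrite /k !cl1//.
have := rnorm_tri (g (t1 - s)) (g t1) (g 0); rewrite (rnormB (g t1) (g (t1 - s))).
have := mulr_gt0 e2 s0; lra.
Qed.

End MeanValueInequality.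

(** * Twice differentiable functions of a complex variable *)

(** The neighbourhoods of 0 in the complex plane, in terms of the modulus. *)
Definition small_h (R : realType) : set_system R[i] :=
  [set P | exists2 r : R, 0 < r & forall h, cmod h < r -> P h].
Arguments small_h R : clear implicits.

Global Instance small_h_filter (R : realType) : Filter (small_h R).
Proof.
split; first by exists 1.
- move=> A B [r r0 hr] [s s0 hs]; exists (Num.min r s); first by rewrite lt_min r0.
  by move=> h; rewrite lt_min => /andP[/hr h1 /hs h2].
- by move=> A B AB [r r0 hr]; exists r => // h /hr/AB.
Qed.

Section DerivativeRules.
Context (R : realType).

(** Caratheodory's form of differentiability, for which the rules of calculus
    reduce to the continuity of the algebraic operations. *)
Lemma cderiv_caratheodory (E : normedModType R[i]) (f : R[i]^o -> E) z d :
  cderiv f z d <-> exists q : R[i]^o -> E,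
    [/\ forall h, f (z + h) - f z = h *: q h, q 0 = d & q h @[h --> small_h R] --> d].
Proof.
split=> [hd|[q [hq q0 cq]] e e0].
  exists (fun h => if h == 0 then d else h^-1 *: (f (z + h) - f z)); split.
  - move=> h; case: eqVneq => [->|h0]; first by rewrite addr0 subrr scale0r.
    by rewrite scalerA mulfV// scale1r.
  - by rewrite eqxx.
  apply/cvg_rnormP => e e0; have e2 : 0 < e / 2 by lra.
  have [r r0 hr] := hd _ e2; exists r => // h.
  move=> hh; case: eqVneq => [_|h0]; first by rewrite subrr rnorm0.
  have -> : h^-1 *: (f (z + h) - f z) - d = h^-1 *: (f (z + h) - f z - h *: d).
    by rewrite [RHS]scalerBr scalerA mulVf// scale1r.
  rewrite rnorm_scale cmodV mulrC ltr_pdivrMr ?cmod_gt0//.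
  apply: (le_lt_trans (hr h hh)); rewrite ltr_pM2r ?cmod_gt0//; lra.
have := (cvg_rnormP _ _ _).1 cq _ e0 => -[r r0 hr].
exists r => // h hh; rewrite hq -scalerBr rnorm_scale mulrC ler_wpM2r ?cmod_ge0//.
by apply/ltW/hr.
Qed.

Lemma cvg_id0 : (h : R[i]^o) @[h --> small_h R] --> (0 : R[i]^o).
Proof.
by apply/cvg_rnormP => e e0; exists e => // h hh; rewrite subr0.
Qed.

Lemma cderiv_cvg (E : normedModType R[i]) (f : R[i]^o -> E) z d : cderiv f z d ->
  f (z + h) @[h --> small_h R] --> f z.
Proof.
move=> /cderiv_caratheodory[q [hq _ cq]].
rewrite (_ : (fun h => _) = (fun h : R[i] => h *: q h + f z)); last first.
  by apply/funext => h; rewrite -hq subrK.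
rewrite -[X in _ --> X]add0r -[X in _ --> X + _](scale0r d).
by apply: cvgD; [apply: cvgZ; [exact: cvg_id0|exact: cq]|exact: cvg_cst].
Qed.

Lemma cderiv_cst (E : normedModType R[i]) (v : E) z : cderiv (fun=> v) z 0.
Proof.
by move=> e e0; exists 1 => // h _; rewrite subrr scaler0 subr0 rnorm0 mulr_ge0 ?cmod_ge0// ltW.
Qed.

Lemma cderiv_id z : cderiv (fun w : R[i]^o => w : R[i]^o) z 1.
Proof.
move=> e e0; exists 1 => // h _; rewrite (_ : h *: (1 : R[i]^o) = h); last exact: mulr1.
by rewrite addrAC addrK subrr rnorm0 mulr_ge0 ?cmod_ge0 ?ltW.
Qed.

Lemma cderivD (E : normedModType R[i]) (f g : R[i]^o -> E) z a b :
  cderiv f z a -> cderiv g z b -> cderiv (fun w => f w + g w) z (a + b).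
Proof.
move=> /cderiv_caratheodory[q [hq q0 cq]] /cderiv_caratheodory[p [hp p0 cp]].
apply/cderiv_caratheodory; exists (fun h => q h + p h); split.
- by move=> h; rewrite opprD addrACA hq hp scalerDr.
- by rewrite q0 p0.
- exact: cvgD.
Qed.

Lemma cderiv_scale (E : normedModType R[i]) (w : R[i]^o -> R[i]^o) (f : R[i]^o -> E) z a b :
  cderiv w z a -> cderiv f z b -> cderiv (fun u => w u *: f u) z (a *: f z + w z *: b).
Proof.
move=> hw hf; have cf := cderiv_cvg hf.
move: hw hf => /cderiv_caratheodory[q [hq q0 cq]] /cderiv_caratheodory[p [hp p0 cp]].
apply/cderiv_caratheodory; exists (fun h => q h *: f (z + h) + w z *: p h); split.
- move=> h; rewrite scalerDr [h *: (_ *: p h)]scalerA mulrC -scalerA -hp scalerA.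
  rewrite (_ : h * q h = w (z + h) - w z); last by rewrite hq.
  by rewrite scalerBl scalerBr addrA subrK.
- by rewrite q0 p0 addr0.
- by apply: cvgD; [apply: cvgZ; [exact: cq|exact: cf]|exact: cvgZr].
Qed.

Lemma cderivV (w : R[i]^o -> R[i]^o) z a : cderiv w z a -> w z != 0 ->
  cderiv (fun u => (w u)^-1 : R[i]^o) z (- a * ((w z)^-1 * (w z)^-1)).
Proof.
move=> hw w0; have cw := cderiv_cvg hw.
have cVw : (w (z + h))^-1 @[h --> small_h R] --> (w z)^-1 by exact: cvgV.
have nz : \forall h \near small_h R, w (z + h) != 0.
  exact: (@cvgr_neq0 _ _ _ _ _ _ _ cw).
move: hw => /cderiv_caratheodory[q [hq q0 cq]].
apply/cderiv_caratheodory.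
exists (fun h => if w (z + h) == 0 then h^-1 * ((w (z + h))^-1 - (w z)^-1)
                 else - q h * ((w (z + h))^-1 * (w z)^-1)); split.
- move=> h; case: eqVneq => [e|e].
    have h0 : h != 0 by apply: contra_neq w0 => h0; rewrite -e h0 addr0.
    by rewrite -[RHS]/(h * (h^-1 * _)) mulVKf.
  have : w (z + h) - w z = h * q h by exact: hq.
  move=> e2; rewrite (_ : h *: _ = - (h * q h) * ((w (z + h))^-1 * (w z)^-1)); last first.
    by rewrite -[LHS]/(h * (- q h * ((w (z + h))^-1 * (w z)^-1))); ring.
  by rewrite -e2; field; rewrite w0 e.
- by rewrite addr0 (negbTE w0) q0.
- apply: cvg_trans (_ : (- q h * ((w (z + h))^-1 * (w z)^-1)) @[h --> small_h R] --> _).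
    apply: near_eq_cvg; apply: filterS nz => h /negbTE ->; by [].
  apply: cvgM; first exact: cvgN.
  by apply: cvgM; [exact: cVw|exact: cvg_cst].
Qed.

Lemma cderiv_shift (E : normedModType R[i]) (f : R[i]^o -> E) c z d :
  cderiv f (z + c) d -> cderiv (fun w => f (w + c)) z d.
Proof.
by move=> hf e /hf[r r0 hr]; exists r => // h /hr; rewrite (addrAC z c).
Qed.

End DerivativeRules.

Section TwiceDifferentiable.
Context (R : realType).

(** The regularity that a difference quotient of a primitive of a differentiable
    function has by construction. *)
Definition holo2_at (E : normedModType R[i]) (v : R[i]^o -> E) (z : R[i]) :=
  exists v' : R[i]^o -> E,
    (exists2 r : R, 0 < r & forall w, cmod (w - z) < r -> cderiv v w (v' w)) /\
    exists d, cderiv v' z d.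

Lemma holo2_deriv (E : normedModType R[i]) (v : R[i]^o -> E) z :
  holo2_at v z -> exists d, cderiv v z d.
Proof.
by move=> [v' [[r r0 hr] _]]; exists (v' z); apply: hr; rewrite subrr cmod0.
Qed.

Lemma holo2_cst (E : normedModType R[i]) (v : E) z : holo2_at (fun=> v) z.
Proof.
exists (fun=> 0); split; last by exists 0; exact: cderiv_cst.
by exists 1 => // w _; exact: cderiv_cst.
Qed.

Lemma holo2_id z : holo2_at (fun w : R[i]^o => w : R[i]^o) z.
Proof.
exists (fun=> 1); split; last by exists 0; exact: cderiv_cst.
by exists 1 => // w _; exact: cderiv_id.
Qed.

Lemma holo2D (E : normedModType R[i]) (v w : R[i]^o -> E) z :
  holo2_at v z -> holo2_at w z -> holo2_at (fun u => v u + w u) z.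
Proof.
move=> [v' [[r r0 hr] [d hd]]] [w' [[s s0 hs] [e he]]].
exists (fun u => v' u + w' u); split; last by exists (d + e); exact: cderivD.
exists (Num.min r s); first by rewrite lt_min r0.
by move=> u; rewrite lt_min => /andP[/hr h1 /hs h2]; exact: cderivD.
Qed.

Lemma holo2M (E : normedModType R[i]) (c : R[i]^o -> R[i]^o) (v : R[i]^o -> E) z :
  holo2_at c z -> holo2_at v z -> holo2_at (fun u => c u *: v u) z.
Proof.
move=> hc hv; have [a ha] := holo2_deriv hc; have [b hb] := holo2_deriv hv.
move: hc hv => [c' [[r r0 hr] [d hd]]] [v' [[s s0 hs] [e he]]].
exists (fun u => c' u *: v u + c u *: v' u); split; last first.
  by eexists; exact: (cderivD (cderiv_scale hd hb) (cderiv_scale ha he)).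
exists (Num.min r s); first by rewrite lt_min r0.
by move=> u; rewrite lt_min => /andP[/hr h1 /hs h2]; exact: cderiv_scale.
Qed.

Lemma holo2V (c : R[i]^o -> R[i]^o) z :
  holo2_at c z -> c z != 0 -> holo2_at (fun u => (c u)^-1 : R[i]^o) z.
Proof.
move=> hc c0; have [a ha] := holo2_deriv hc.
have e0 : 0 < cmod (c z) by rewrite cmod_gt0.
have [t t0 ht] := cderiv_continuous ha e0.
move: hc => [c' [[r r0 hr] [d hd]]].
exists (fun u => - c' u * ((c u)^-1 * (c u)^-1)); split.
  exists (Num.min r t); first by rewrite lt_min r0.
  move=> u; rewrite lt_min => /andP[/hr h1 /ht h2]; apply: cderivV => //.
  apply: contraTneq h2 => ->; rewrite sub0r rnormN -leNgt; exact: lexx.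
have hV := cderivV ha c0.
have hN : cderiv (fun u => - c' u : R[i]^o) z (0 *: c' z + (-1) *: d).
  have := cderiv_scale (cderiv_cst (-1 : R[i]^o) z) hd.
  by congr cderiv; apply/funext => u; exact: mulN1r.
by eexists; apply: (cderiv_scale hN); exact: (cderiv_scale hV hV).
Qed.

Lemma holo2_shift (E : normedModType R[i]) (v : R[i]^o -> E) c z :
  holo2_at v (z + c) -> holo2_at (fun w => v (w + c)) z.
Proof.
move=> [v' [[r r0 hr] [d hd]]]; exists (fun w => v' (w + c)); split.
  exists r => // w hw; apply: cderiv_shift; apply: hr.
  by rewrite opprD addrACA subrr addr0.
by exists d; exact: cderiv_shift.
Qed.

Lemma holo2_near (E : normedModType R[i]) (v w : R[i]^o -> E) z (r : R) : 0 < r ->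
  (forall u, cmod (u - z) < r -> v u = w u) -> holo2_at v z -> holo2_at w z.
Proof.
move=> r0 vw [v' [[s s0 hs] [d hd]]]; exists v'; split; last by exists d.
exists (Num.min (r / 2) s); first by rewrite lt_min s0; lra.
move=> u; rewrite lt_min => /andP[u1 /hs hu] e /hu[t t0 ht].
exists (Num.min t (r / 2)); first by rewrite lt_min t0; lra.
move=> h; rewrite lt_min => /andP[/ht h1 h2].
rewrite -!vw//; first by lra.
by have := cmodD (u - z) h; rewrite (addrAC u); lra.
Qed.

Lemma zmod_taylor (V : zmodType) (w v a b x y z p : V) :
  w - (a + b) - (x + y + z) - (v - a - x) = w - v - p + (p - b - y) - z.
Proof.
rewrite -[RHS]addrA -!addrA addKr !addrA !opprD !opprK !addrA.
rewrite [LHS](ACl (1*7*3*5*6*(2*8)*(4*9))) /= [- a + a]addNr [- x + x]addNr !addr0.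
by [].
Qed.

Lemma zmod_pair (V : zmodType) (w u v a d : V) :
  (w - v - a - d) + (u - v + a - d) = w + u - (v + v) - (d + d).
Proof.
rewrite !addrA !opprD !addrA [LHS](ACl (1*5*2*6*4*8*(3*7))) /= addNr addr0.
by [].
Qed.

Lemma zmod_four (V : zmodType) (w1 w2 w3 w4 v a b d : V) :
  (w1 - v - a - d) + (w2 - v + a - d) + ((w3 - v - b + d) + (w4 - v + b + d)) =
  w1 + w2 + (w3 + w4) - (v + v + (v + v)).
Proof.
have := zmod_pair w3 w4 v b (- d); rewrite !opprK => ->; rewrite zmod_pair.
rewrite !opprD !opprK !addrA [LHS](ACl (1*2*7*8*3*4*9*10*((5*11)*(6*12)))) /=.
by rewrite !addNr !addr0.
Qed.

Context (E : normedModType R[i]).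

(** The mean value inequality for the remainder on the segment from z to z + h. *)
Lemma holo2_taylor (v : R[i]^o -> E) z : holo2_at v z -> exists a b,
  forall e : R, 0 < e -> exists2 r : R, 0 < r & forall h, cmod h < r ->
    rnorm (v (z + h) - v z - h *: a - (h ^+ 2 / 2) *: b) <= e * cmod h ^+ 2.
Proof.
move=> [v' [[r r0 hr] [b hb]]]; exists (v' z), b => e e0.
have [s s0 hs] := hb _ e0.
exists (Num.min r s); first by rewrite lt_min r0.
move=> h; rewrite lt_min => /andP[h1 h2].
pose T (t : R) : R[i] := t%:C%C * h.
pose g t := v (z + T t) - T t *: v' z - (T t ^+ 2 / 2) *: b.
have T0 : T 0 = 0 by rewrite /T mul0r.
have T1 : T 1 = h by rewrite /T mul1r.
have -> : v (z + h) - v z - h *: v' z - (h ^+ 2 / 2) *: b = g 1 - g 0.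
  rewrite /g T0 T1 expr0n /= mul0r !scale0r !subr0 addr0.
  by rewrite -!addrA; congr (_ + _); rewrite [LHS]addrC -addrA.
apply: mean_value_inequality; last first.
  by apply: mulr_ge0; [exact: ltW|rewrite exprn_ge0 ?cmod_ge0].
move=> t t01 d d0.
have Tt : cmod (T t) <= cmod h.
  rewrite /T cmodM cmod_real ger0_norm; last by lra.
  by rewrite ler_piMl ?cmod_ge0//; lra.
have wr : cmod (z + T t - z) < r by rewrite addrAC subrr add0r; lra.
have N1 : 0 < 2 * (cmod h + 1) by have := cmod_ge0 h; lra.
have d1 : 0 < d / (2 * (cmod h + 1)) by rewrite divr_gt0.
have [q q0 hq] := hr _ wr _ d1.
have N2 : 0 < cmod h ^+ 2 * rnorm b + 1.
  by have := mulr_ge0 (sqr_ge0 (cmod h)) (rnorm_ge0 b); lra.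
exists (Num.min (q / (cmod h + 1)) (d / (cmod h ^+ 2 * rnorm b + 1))).
  by rewrite lt_min !divr_gt0//; have := cmod_ge0 h; lra.
move=> u; have hh1 : 0 < cmod h + 1 by have := cmod_ge0 h; lra.
rewrite lt_min !ltr_pdivlMr// => /andP[u1 u2].
have Tu : cmod (T u) = `|u| * cmod h by rewrite /T cmodM cmod_real.
have TD : T (t + u) = T t + T u by rewrite /T rmorphD /= mulrDl.
have -> : g (t + u) - g t = (v (z + T t + T u) - v (z + T t) - T u *: v' (z + T t)) +
    T u *: (v' (z + T t) - v' z - T t *: b) - (T u ^+ 2 / 2) *: b.
  rewrite /g TD addrA.
  have -> : (T t + T u) ^+ 2 / 2 = T t ^+ 2 / 2 + T u * T t + T u ^+ 2 / 2 by field.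
  rewrite !scalerDl !scalerBr scalerA; exact: zmod_taylor.
have v1 := hq (T u); rewrite Tu in v1.
have v2 := hs (T t) (le_lt_trans Tt h2).
have uq : `|u| * cmod h < q by have := normr_ge0 u; lra.
have {}v1 := v1 uq.
apply: (le_trans (rnorm_subr _ _)).
have := rnormD (v (z + T t + T u) - v (z + T t) - T u *: v' (z + T t))
  (T u *: (v' (z + T t) - v' z - T t *: b)).
rewrite !rnorm_scale Tu cmodM cmodX Tu cmodV.
have -> : cmod (2 : R[i]) = 2 by rewrite -[2 : R[i]](rmorph_nat (real_complex R)) cmod_real ger0_norm.
have c0 := cmod_ge0 h; have u0 := normr_ge0 u; have b0 := rnorm_ge0 b.
have w1 : d / (2 * (cmod h + 1)) * (`|u| * cmod h) <= d / 2 * `|u|.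
  rewrite [leRHS](_ : _ = d / (2 * (cmod h + 1)) * (`|u| * (cmod h + 1))); last by field; lra.
  by rewrite ler_pM2l// ler_wpM2l//; lra.
have w2 : `|u| * cmod h * rnorm (v' (z + T t) - v' z - T t *: b) <= `|u| * (e * cmod h ^+ 2).
  rewrite -mulrA ler_wpM2l//; have := ler_wpM2l c0 (le_trans v2 (ler_wpM2l (ltW e0) Tt)).
  by rewrite mulrCA expr2.
have w3 : (`|u| * cmod h) ^+ 2 / 2 * rnorm b <= d / 2 * `|u|.
  have -> : (`|u| * cmod h) ^+ 2 / 2 * rnorm b = `|u| * (`|u| * (cmod h ^+ 2 * rnorm b)) / 2 by field.
  have : `|u| * (`|u| * (cmod h ^+ 2 * rnorm b)) <= `|u| * d.
    by rewrite ler_wpM2l//; lra.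
  by lra.
move=> w4; have : `|u| * (e * cmod h ^+ 2) = e * cmod h ^+ 2 * `|u| by ring.
lra.
Qed.

(** In the sum over the points z + s, z - s, z + is, z - is the linear and the
    quadratic terms of the Taylor expansion cancel. *)
Lemma holo2_four_point (v : R[i]^o -> E) x y : holo2_at v (Complex x y) ->
  four_point_sub (fun x y => rnorm (v (Complex x y))) x y.
Proof.
move=> /holo2_taylor[a [b tay]] e e0; have e4 : 0 < e / 4 by lra.
have [r r0 hr] := tay _ e4; exists r => // s /andP[s0 sr].
pose z : R[i] := Complex x y; pose S : R[i] := s%:C%C.
have S1 : cmod S = s by rewrite cmod_real gtr0_norm.
have S2 : cmod (- S) = s by rewrite cmodN.
have S3 : cmod ('i%C * S) = s by rewrite cmodM cmodi mul1r.
have S4 : cmod (- ('i%C * S)) = s by rewrite cmodN.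
have p1 : Complex (x + s) y = z + S by apply/eqP; rewrite eq_complex /= addr0 !eqxx.
have p2 : Complex (x - s) y = z - S by apply/eqP; rewrite eq_complex /= oppr0 addr0 !eqxx.
have p3 : Complex x (y + s) = z + 'i%C * S.
  by apply/eqP; rewrite eq_complex /=; apply/andP; split; apply/eqP; ring.
have p4 : Complex x (y - s) = z - 'i%C * S.
  by apply/eqP; rewrite eq_complex /=; apply/andP; split; apply/eqP; ring.
rewrite p1 p2 p3 p4 -/z.
have := hr S; rewrite S1 => /(_ sr) h1; have := hr (- S); rewrite S2 => /(_ sr) h2.
have := hr ('i%C * S); rewrite S3 => /(_ sr) h3.
have := hr (- ('i%C * S)); rewrite S4 => /(_ sr) h4.
have ii : ('i%C * S) ^+ 2 = - S ^+ 2 by rewrite exprMn sqr_i mulN1r.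
rewrite sqrrN !(scaleNr, opprK) in h2; rewrite ii !(mulNr, scaleNr, opprK) in h3.
rewrite sqrrN ii !(mulNr, scaleNr, opprK) in h4.
move: h1 h2 h3 h4; rewrite -/z.
move: (S *: a) (('i%C * S) *: a) ((S ^+ 2 / 2) *: b) => A B D h1 h2 h3 h4.
have sum := zmod_four (v (z + S)) (v (z - S)) (v (z + 'i%C * S)) (v (z - 'i%C * S)) (v z) A B D.
set e1 := v (z + S) - _ - _ - _ in sum h1.
set e2 := v (z - S) - _ + _ - _ in sum h2; set e3 := v (z + _) - _ - _ + _ in sum h3.
set e5 := v (z - _) - _ + _ + _ in sum h4.
set W := v (z + S) + _ + _ in sum.
have n1 := rnormD (e1 + e2) (e3 + e5); have n2 := rnormD e1 e2; have n3 := rnormD e3 e5.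
have n4 : rnorm W <= rnorm (v (z + S)) + rnorm (v (z - S)) +
    (rnorm (v (z + 'i%C * S)) + rnorm (v (z - 'i%C * S))).
  have := rnormD (v (z + S) + v (z - S)) (v (z + 'i%C * S) + v (z - 'i%C * S)).
  have := rnormD (v (z + S)) (v (z - S)).
  have := rnormD (v (z + 'i%C * S)) (v (z - 'i%C * S)); rewrite -/W; lra.
have n5 : 4 * rnorm (v z) = rnorm (v z + v z + (v z + v z)).
  have -> : v z + v z + (v z + v z) = (4%:R : R)%:C%C *: v z.
    by rewrite rmorph_nat scaler_nat !mulrS mulr0n addr0 !addrA.
  by rewrite rnorm_scale cmod_real ger0_norm.
have n6 := rnorm_lip (v z + v z + (v z + v z)) W.
rewrite rnormB -sum ler_norml in n6; rewrite n5; lra.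
Qed.

End TwiceDifferentiable.

(** * The Schwarz lemma and uniform limits *)

Section FourPointRules.
Context (R : realType).
Implicit Types (phi psi : R -> R -> R).

Lemma four_point_near phi psi x y (t : R) : 0 < t ->
  (forall x' y', `|x' - x| + `|y' - y| < t -> phi x' y' = psi x' y') ->
  four_point_sub psi x y -> four_point_sub phi x y.
Proof.
move=> t0 e h d /h[r r0 hr]; exists (Num.min r t); first by rewrite lt_min r0.
move=> s /andP[s0]; rewrite lt_min => /andP[sr st].
have ns : `|s| < t by rewrite gtr0_norm.
have e0 : phi x y = psi x y by apply: e; rewrite !subrr normr0 addr0.
have e1 : phi (x + s) y = psi (x + s) y.
  by apply: e; rewrite addrAC !subrr add0r normr0 addr0.
have e2 : phi (x - s) y = psi (x - s) y.
  by apply: e; rewrite addrAC !subrr sub0r normrN normr0 addr0.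
have e3 : phi x (y + s) = psi x (y + s).
  by apply: e; rewrite addrAC !subrr add0r normr0 add0r.
have e4 : phi x (y - s) = psi x (y - s).
  by apply: e; rewrite addrAC !subrr sub0r normrN normr0 add0r.
by rewrite e0 e1 e2 e3 e4; apply: hr; rewrite s0.
Qed.

Lemma four_pointD phi psi x y : four_point_sub phi x y -> four_point_sub psi x y ->
  four_point_sub (fun x y => phi x y + psi x y) x y.
Proof.
move=> h k d d0; have d2 : 0 < d / 2 by lra.
have [r r0 hr] := h _ d2; have [q q0 hq] := k _ d2.
exists (Num.min r q); first by rewrite lt_min r0.
move=> s /andP[s0]; rewrite lt_min => /andP[sr sq].
have := hr s ltac:(by rewrite s0); have := hq s ltac:(by rewrite s0); lra.
Qed.

Lemma four_point_cst (c : R) x y : four_point_sub (fun _ _ => c) x y.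
Proof.
move=> d d0; exists 1 => // s _; have := mulr_ge0 (ltW d0) (sqr_ge0 s); lra.
Qed.

Lemma four_pointM phi (c : R) x y : 0 < c -> four_point_sub phi x y ->
  four_point_sub (fun x y => c * phi x y) x y.
Proof.
move=> c0 h d d0; have [r r0 hr] := h _ (divr_gt0 d0 c0); exists r => // s /hr hs.
have := ler_wpM2l (ltW c0) hs.
have -> : c * (4 * phi x y - d / c * s ^+ 2) = 4 * (c * phi x y) - d * s ^+ 2.
  by field; rewrite gt_eqF.
lra.
Qed.

(** The four points h + s, h - s, h + is, h - is multiply to h^4 - s^4. *)
Lemma four_point_ln x y : 0 < cmod (Complex x y) ->
  four_point_sub (fun x y => @ln R (cmod (Complex x y))) x y.
Proof.
move=> h0 e e0; pose h : R[i] := Complex x y; pose a := cmod h.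
have a0 : 0 < a by [].
pose r := Num.min (a / 2) (Num.min 1 (e * a ^+ 4 / 2)).
exists r; first by rewrite !lt_min ltr01 !divr_gt0// mulr_gt0// exprn_gt0.
move=> s /andP[s0]; rewrite !lt_min => /and3P[s1 s2 s3].
pose S : R[i] := s%:C%C.
have p1 : Complex (x + s) y = h + S by apply/eqP; rewrite eq_complex /= addr0 !eqxx.
have p2 : Complex (x - s) y = h - S by apply/eqP; rewrite eq_complex /= oppr0 addr0 !eqxx.
have p3 : Complex x (y + s) = h + 'i%C * S.
  by apply/eqP; rewrite eq_complex /=; apply/andP; split; apply/eqP; ring.
have p4 : Complex x (y - s) = h - 'i%C * S.
  by apply/eqP; rewrite eq_complex /=; apply/andP; split; apply/eqP; ring.
rewrite p1 p2 p3 p4 -/h -/a.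
have S1 : cmod S = s by rewrite cmod_real gtr0_norm.
have pos k : cmod k = s -> 0 < cmod (h + k).
  move=> ks; have := cmodD (h + k) (- k); rewrite addrK cmodN ks -/a; lra.
have q1 := pos S S1; have q2 := pos (- S) ltac:(by rewrite cmodN).
have q3 := pos ('i%C * S) ltac:(by rewrite cmodM cmodi mul1r).
have q4 := pos (- ('i%C * S)) ltac:(by rewrite cmodN cmodM cmodi mul1r).
rewrite -!lnM ?posrE ?mulr_gt0// -!cmodM.
have -> : (h + S) * (h - S) * (h + 'i%C * S) * (h - 'i%C * S) = h ^+ 4 - S ^+ 4.
  have -> : (h + S) * (h - S) * (h + 'i%C * S) * (h - 'i%C * S) =
     (h ^+ 2 - S ^+ 2) * (h ^+ 2 - 'i%C ^+ 2 * S ^+ 2) by ring.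
  by rewrite sqr_i; ring.
have a4 : 0 < a ^+ 4 by rewrite exprn_gt0.
have s4 : 0 < s ^+ 4 by rewrite exprn_gt0.
have s41 : s ^+ 4 <= s ^+ 2 * (e * a ^+ 4 / 2).
  rewrite (_ : s ^+ 4 = s ^+ 2 * (s * s)); last by ring.
  rewrite ler_wpM2l ?sqr_ge0//; apply: (@le_trans _ _ (s * 1)); last by lra.
  by rewrite ler_wpM2l//; lra.
have s42 : s ^+ 4 <= a ^+ 4 / 2.
  have : s ^+ 4 <= (a / 2) ^+ 4 by rewrite lerXn2r ?nnegrE//; lra.
  by rewrite expr_div_n (_ : 2 ^+ 4 = 16 :> R); [lra|ring].
apply: (@le_trans _ _ (ln (a ^+ 4 - s ^+ 4))); last first.
  rewrite ler_ln ?posrE; [|lra|].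
    have := cmodD (h ^+ 4 - S ^+ 4) (S ^+ 4); rewrite subrK !cmodX S1 -/a; lra.
  have := cmodD (h ^+ 4 - S ^+ 4) (S ^+ 4); rewrite subrK !cmodX S1 -/a; lra.
have -> : a ^+ 4 - s ^+ 4 = a ^+ 4 * (1 + s ^+ 4 / (a ^+ 4 - s ^+ 4))^-1.
  by field; apply/andP; split; rewrite gt_eqF//; lra.
have t0 : 0 <= s ^+ 4 / (a ^+ 4 - s ^+ 4) by rewrite divr_ge0//; lra.
have t1 : s ^+ 4 / (a ^+ 4 - s ^+ 4) <= e * s ^+ 2.
  rewrite ler_pdivrMr; last by lra.
  have : e * s ^+ 2 * (a ^+ 4 / 2) <= e * s ^+ 2 * (a ^+ 4 - s ^+ 4).
    by rewrite ler_wpM2l ?mulr_ge0 ?sqr_ge0//; lra.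
  lra.
rewrite lnM ?posrE ?invr_gt0//; last by lra.
rewrite lnV ?posrE; last by lra.
rewrite lnXn// -mulr_natl.
have := @le_ln1Dx R (s ^+ 4 / (a ^+ 4 - s ^+ 4)) ltac:(lra).
lra.
Qed.

End FourPointRules.

Section RectFilter.
Context (R : realType) (a b c d x y : R).

(** [continuous_on_rect] is convergence along this filter ([rect_nearP]), so that sums
    and products can be treated with the limit lemmas. *)
Definition rect_near : set_system (R * R) :=
  [set P | exists2 r : R, 0 < r & forall x' y', a <= x' <= b -> c <= y' <= d ->
    `|x' - x| + `|y' - y| < r -> P (x', y')].

Global Instance rect_near_filter : Filter rect_near.
Proof.
split; first by exists 1.
- move=> A B [r r0 hr] [s s0 hs]; exists (Num.min r s); first by rewrite lt_min r0.
  by move=> x' y' h1 h2; rewrite lt_min => /andP[k1 k2]; split; [exact: hr|exact: hs].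
- by move=> A B AB [r r0 hr]; exists r => // x' y' h1 h2 h3; apply/AB/hr.
Qed.

Lemma rect_nearP (phi : R -> R -> R) :
  (phi p.1 p.2 @[p --> rect_near] --> phi x y) <->
  (forall e : R, 0 < e -> exists2 r : R, 0 < r & forall x' y', a <= x' <= b -> c <= y' <= d ->
    `|x' - x| + `|y' - y| < r -> `|phi x' y' - phi x y| < e).
Proof.
split=> [/cvgrPdist_lt h e /h[r r0 hr]|h]; first last.
  apply/cvgrPdist_lt => e /h[r r0 hr]; exists r => // x' y' h1 h2 h3 /=.
  by rewrite distrC; exact: hr.
by exists r => // x' y' h1 h2 h3; rewrite distrC; exact: (hr x' y').
Qed.

End RectFilter.

Lemma zmod_flat (V : zmodType) (a b c f g h : V) :
  g - h = a - b - (c - f) - ((a - c - g) - (b - f - h)).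
Proof.
rewrite !opprD !opprK !addrA [RHS](ACl (7*10*((1*5)*(2*8)*(3*6)*(4*9)))) /=.
by rewrite !subrr !addNr !addr0.
Qed.

Lemma zmod_limit (V : zmodType) (a b c f g h : V) :
  c - f - g = (a - b - h) - (a - c - (b - f)) + (h - g).
Proof.
rewrite !opprD !opprK !addrA [RHS](ACl (5*7*9*((1*4)*(2*6)*(3*8)))) /=.
by rewrite subrr !addNr !addr0.
Qed.

Section Schwarz.
Context (R : realType) (E : normedModType R[i]).

(** Schwarz lemma. The quotient q = (v(z0 + h) - v(z0)) / h is bounded by 2m/r on
    the boundary of the square. The term t log|h| keeps |q| + t log|h| away from
    its maximum near the puncture h = 0, where q is merely bounded. *)
Lemma schwarz (v : R[i]^o -> E) (z0 : R[i]) (r m : R) : 0 < r ->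
  (forall x y, `|x| <= r -> `|y| <= r -> holo2_at v (z0 + Complex x y)) ->
  (forall x y, `|x| <= r -> `|y| <= r -> rnorm (v (z0 + Complex x y)) <= m) ->
  forall x y, `|x| <= r -> `|y| <= r ->
  rnorm (v (z0 + Complex x y) - v z0) <= 2 * m / r * cmod (Complex x y).
Proof.
move=> r0 hv hm x0 y0 hx0 hy0.
pose D (h : R[i]^o) : E := v (z0 + h) - v z0.
have zero : Complex 0 0 = 0 :> R[i] by [].
have hr0 : `|0 : R| <= r by rewrite normr0 ltW.
have hm0 := hm 0 0 hr0 hr0; rewrite zero addr0 in hm0.
have m0 : 0 <= m by apply: le_trans hm0; exact: rnorm_ge0.
set h0 := Complex x0 y0.
have [->|h0n0] := eqVneq h0 0; first by rewrite addr0 subrr rnorm0 cmod0 mulr0.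
have c0 : 0 < cmod h0 by rewrite cmod_gt0.
have [d hd] := holo2_deriv (hv 0 0 hr0 hr0); rewrite zero addr0 in hd.
have [q q0 hq] := cderiv_lipschitz hd.
set L := rnorm d + 1 in hq.
rewrite mulrC -ler_pdivrMl// mulrC.
apply/ler_addgt0Pr => e e0.
pose K := ln (2 * r / cmod h0).
have K0 : 0 <= K.
  have := cmod_le h0; rewrite /h0 /= -/h0 => hh.
  apply: ln_ge0; rewrite ler_pdivlMr//; lra.
pose t := e / (K + 1).
have t0 : 0 < t by rewrite divr_gt0//; lra.
have tK : t * K <= e by rewrite /t mulrAC ler_pdivrMr; nra.
have r2 : 0 < 2 * r by lra.
pose M0 := Num.min (Num.min q r) (Num.min (cmod h0) (2 * r * expR (- (L / t)))).
have M00 : 0 < M0 by rewrite !lt_min q0 r0 c0 mulr_gt0 ?expR_gt0.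
have [rho [rho0 rho1 rho2 rho3 rho4]] : exists rho, [/\ 0 < rho, rho < q, rho < r,
    rho < cmod h0 & rho < 2 * r * expR (- (L / t))].
  exists (M0 / 2); have : M0 / 2 < M0 by lra.
  by rewrite {2}/M0 !lt_min => /andP[/andP[-> ->] /andP[-> ->]]; split=> //; lra.
pose N x y := Num.max (cmod (Complex x y)) rho.
have Nrho x y : rho <= N x y by rewrite le_max lexx orbT.
have N0 x y : 0 < N x y by apply: lt_le_trans (Nrho x y).
pose phi x y := rnorm (D (Complex x y)) * (N x y)^-1 + t * (ln (N x y) + - ln (2 * r)).
have nr x : (- r <= x <= r) = (`|x| <= r) by rewrite ler_norml.
have N2r x y : `|x| <= r -> `|y| <= r -> N x y <= 2 * r.
  move=> hx hy; rewrite ge_max; apply/andP; split; last by lra.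
  by have := cmod_le (Complex x y); rewrite /=; lra.
have lnN x y : `|x| <= r -> `|y| <= r -> t * (ln (N x y) + - ln (2 * r)) <= 0.
  move=> hx hy; rewrite pmulr_rle0// subr_le0 ler_ln ?posrE//; exact: N2r.
have phi_le : phi x0 y0 <= 2 * m / r.
  apply: (@max_principle R (- r) r (- r) r (2 * m / r)
    (fun x y => (- r < x < r /\ - r < y < r) /\ rho < cmod (Complex x y))); try lra.
  - move=> x y; rewrite !nr => hx hy; apply/rect_nearP; rewrite /phi.
    have cN : N p.1 p.2 @[p --> rect_near (- r) r (- r) r x y] --> N x y.
      apply/rect_nearP => d' d0; exists d' => // x' y' _ _ hh; apply: le_lt_trans hh.
      apply: (@le_trans _ _ (cmod (Complex x' y' - Complex x y))); last exact: cmod_complex.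
      have := cmodD (Complex x' y' - Complex x y) (Complex x y); rewrite subrK.
      have := cmodD (Complex x y - Complex x' y') (Complex x' y'); rewrite subrK cmodB.
      have := cmod_ge0 (Complex x' y' - Complex x y).
      rewrite /N; set A := cmod _; set B := cmod (Complex x y); set C := cmod (Complex x' y').
      move=> h1 h2 h3; rewrite ler_norml.
      by case: (leP C rho) => h4; case: (leP B rho) => h5; lra.
    apply: cvgD; first apply: cvgM.
    + apply/(@rect_nearP _ _ _ _ _ _ _ (fun x y => rnorm (D (Complex x y)))) => d' d0.
      have [dd hdd] := holo2_deriv (hv x y hx hy).
      have [s s0 hs] := cderiv_continuous hdd d0; exists s => // x' y' _ _ hh.
      apply: (le_lt_trans (rnorm_lip _ _)); rewrite /D opprB addrA subrK; apply: hs.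
      rewrite opprD addrACA subrr add0r; apply: le_lt_trans hh; exact: cmod_complex.
    + by apply: cvgV => //; rewrite gt_eqF.
    apply: cvgM; first exact: cvg_cst.
    apply: cvgD; last exact: cvg_cst.
    apply: (@continuous_cvg _ _ _ _ _ _ (@ln R)) => //; exact: continuous_ln.
  - by move=> x y [[] ].
  - move=> x y [[hx hy] hrho].
    have hx' : `|x| <= r by rewrite -nr; lra.
    have hy' : `|y| <= r by rewrite -nr; lra.
    have xy0 : 0 < cmod (Complex x y) by lra.
    apply: (@four_point_near _ _ (fun x y => rnorm ((Complex x y)^-1 *: D (Complex x y)) +
      t * (ln (cmod (Complex x y)) + - ln (2 * r))) _ _ (cmod (Complex x y) - rho)).
    + lra.
    + move=> x' y' hh; rewrite /phi /N.
      have := cmodD (Complex x y - Complex x' y') (Complex x' y'); rewrite subrK.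
      have := cmod_complex x y x' y'; rewrite (distrC x) (distrC y) => h1 h2.
      have h3 : rho <= cmod (Complex x' y') by lra.
      by rewrite (max_idPl h3) rnorm_scale cmodV mulrC.
    apply: four_pointD; last first.
      apply: four_pointM => //; apply: four_pointD; last exact: four_point_cst.
      exact: four_point_ln.
    apply: (@holo2_four_point _ _ (fun h => h^-1 *: D h)).
    apply: holo2M; first by apply: (holo2V (holo2_id _)); rewrite -cmod_gt0.
    rewrite /D; apply: holo2D; last exact: holo2_cst.
    have := @holo2_shift _ _ v z0 (Complex x y); rewrite addrC => /(_ (hv x y hx' hy')).
    by apply: (@holo2_near _ _ _ _ _ 1) => // u _; rewrite addrC.
  - move=> x y; rewrite !nr => hx hy nU; have lnxy := lnN x y hx hy.
    have mr : 0 <= 2 * m / r by rewrite divr_ge0 ?mulr_ge0// ltW.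
    have [h1|h1] := leP (cmod (Complex x y)) rho.
      rewrite /phi /N (max_idPr h1).
      have lr : ln rho <= ln (2 * r) - L / t.
        rewrite -[- (L / t)]expRK -lnM ?posrE ?expR_gt0//.
        by rewrite ler_ln ?posrE ?mulr_gt0 ?expR_gt0// ltW.
      have : t * (ln rho + - ln (2 * r)) <= - L.
        have := ler_wpM2l (ltW t0) (_ : ln rho + - ln (2 * r) <= - (L / t)).
        by rewrite mulrN mulrCA mulfV ?gt_eqF// mulr1; apply; lra.
      have : rnorm (D (Complex x y)) * rho^-1 <= L.
        rewrite ler_pdivrMr//; apply: (le_trans (hq _ (le_lt_trans h1 rho1))).
        by rewrite ler_wpM2l// /L; have := rnorm_ge0 d; lra.
      lra.
    rewrite /phi /N (max_idPl (ltW h1)).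
    have rc : r <= cmod (Complex x y).
      have := ler_Re (Complex x y); have := ler_Im (Complex x y); rewrite /= => i1 i2.
      rewrite leNgt; apply/negP => cr; apply: nU; split=> //.
      by rewrite -!ltr_norml; split; lra.
    have cr0 : 0 < cmod (Complex x y) by lra.
    have : rnorm (D (Complex x y)) * (cmod (Complex x y))^-1 <= 2 * m / r.
      apply: ler_pM; rewrite ?rnorm_ge0 ?invr_ge0 ?cmod_ge0//.
        by have := rnorm_subr (v (z0 + Complex x y)) (v z0); have := hm x y hx hy; rewrite /D; lra.
      by rewrite lef_pV2 ?posrE.
    by move: lnxy; rewrite /N (max_idPl (ltW h1)); lra.
  - by rewrite nr.
  - by rewrite nr.
move: phi_le; rewrite /phi /N -/h0 (max_idPl (ltW rho3)).
have KE : K = ln (2 * r) - ln (cmod h0) by rewrite /K lnM ?posrE ?invr_gt0// lnV ?posrE.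
have -> : ln (cmod h0) + - ln (2 * r) = - K by rewrite KE opprB.
by rewrite /D mulrN; lra.
Qed.

(** By the Schwarz lemma the difference quotients of the approximations converge
    uniformly near the point. *)
Lemma uniform_limit_derivable (cE : @seq_complete R E) (v : nat -> R[i]^o -> E) (l : R[i]^o -> E)
  (z0 : R[i]) (r : R) : 0 < r ->
  (forall n x y, `|x| <= r -> `|y| <= r -> holo2_at (v n) (z0 + Complex x y)) ->
  (forall e : R, 0 < e -> exists N, forall n x y, (N <= n)%N -> `|x| <= r -> `|y| <= r ->
     rnorm (v n (z0 + Complex x y) - l (z0 + Complex x y)) <= e) ->
  exists d, cderiv l z0 d.
Proof.
move=> r0 hv hl; have hr0 : `|0 : R| <= r by rewrite normr0 ltW.
have zero : z0 + Complex 0 0 = z0 by rewrite -[RHS]addr0.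
have /choice[d hd] : forall n, exists d, cderiv (v n) z0 d.
  by move=> n; have := holo2_deriv (hv n 0 0 hr0 hr0); rewrite zero.
(* the differences of the approximations are flat *)
have flat e : 0 < e -> exists N, forall n n' (h : R[i]), (N <= n)%N -> (N <= n')%N -> cmod h <= r ->
    rnorm (v n (z0 + h) - v n' (z0 + h) - (v n z0 - v n' z0)) <= e * cmod h.
  move=> e0; have e1 : 0 < e * r / 4 by rewrite divr_gt0 ?mulr_gt0.
  have [N hN] := hl _ e1; exists N => n n' [x y] nN nN' hh.
  have hx := le_trans (ler_Re (Complex x y)) hh; have hy := le_trans (ler_Im (Complex x y)) hh.
  rewrite /= in hx hy.
  pose w (z : R[i]^o) := v n z + (-1 : R[i]) *: v n' z.
  have hw x' y' : `|x'| <= r -> `|y'| <= r -> holo2_at w (z0 + Complex x' y').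
    move=> hx' hy'; apply: holo2D; first exact: hv.
    by apply: holo2M; [exact: (holo2_cst (-1 : R[i]^o))|exact: hv].
  have mw x' y' : `|x'| <= r -> `|y'| <= r -> rnorm (w (z0 + Complex x' y')) <= e * r / 2.
    move=> hx' hy'; rewrite /w scaleN1r.
    have := hN n x' y' nN hx' hy'; have := hN n' x' y' nN' hx' hy'.
    have := rnorm_tri (l (z0 + Complex x' y')) (v n (z0 + Complex x' y')) (v n' (z0 + Complex x' y')).
    by rewrite (rnormB (l _)); lra.
  have := schwarz r0 hw mw hx hy; rewrite /w !scaleN1r.
  by rewrite (_ : 2 * (e * r / 2) / r = e)//; field; rewrite gt_eqF.
have dist n n' e : 0 < e -> (forall h : R[i], cmod h <= r ->
    rnorm (v n (z0 + h) - v n' (z0 + h) - (v n z0 - v n' z0)) <= e * cmod h) ->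
    rnorm (d n - d n') <= e.
  move=> e0 hh; apply/ler_addgt0Pr => t t0; have t2 : 0 < t / 2 by lra.
  have [q q0 hq] := hd n _ t2; have [q' q0' hq'] := hd n' _ t2.
  pose s := Num.min (r / 2) (Num.min (q / 2) (q' / 2)).
  have s0 : 0 < s by rewrite !lt_min; lra.
  have : s <= s by []; rewrite {2}/s !le_min => /and3P[s1 s2 s3].
  pose S : R[i] := s%:C%C; have S1 : cmod S = s by rewrite cmod_real gtr0_norm.
  have k1 := hq S; have k2 := hq' S; have k3 := hh S; rewrite S1 in k1 k2 k3.
  have {}k1 := k1 ltac:(lra); have {}k2 := k2 ltac:(lra); have {}k3 := k3 ltac:(lra).
  rewrite -(ler_pM2l s0) -{1}S1 -rnorm_scale.
  set X := v n (z0 + S) - v n z0 - S *: d n in k1.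
  set Y := v n' (z0 + S) - v n' z0 - S *: d n' in k2.
  set Z := v n (z0 + S) - _ - _ in k3.
  have -> : S *: (d n - d n') = Z - (X - Y).
    by rewrite scalerBr; exact: zmod_flat.
  have := rnorm_subr Z (X - Y); have := rnorm_subr X Y; lra.
have [d0 hd0] : exists d0, tends d d0.
  apply: cE => e e0; have e2 : 0 < e / 2 by lra.
  have [N hN] := flat _ e2; exists N => n n' nN nN'.
  have := dist n n' _ e2 (fun h => hN n n' h nN nN'); lra.
exists d0 => e e0; have e3 : 0 < e / 3 by lra.
have [N hN] := flat _ e3; have [N' hN'] := hd0 _ e3.
pose n := maxn N N'; have [q q0 hq] := hd n _ e3.
exists (Num.min q r); first by rewrite lt_min q0.
move=> h; rewrite lt_min => /andP[h1 h2].
have k1 := hq h h1; have k2 := hN' n (leq_maxr _ _).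
have k3 : rnorm (v n (z0 + h) - l (z0 + h) - (v n z0 - l z0)) <= e / 3 * cmod h.
  apply/ler_addgt0Pr => t t0; have t2 : 0 < t / 2 by lra.
  have [N2 hN2] := hl _ t2; pose n' := maxn N N2.
  have k4 := hN n n' h (leq_maxl _ _) (leq_maxl _ _) (ltW h2).
  have k5 : rnorm (v n' (z0 + h) - l (z0 + h)) <= t / 2.
    case: h h1 h2 k1 k4 => x y h1 h2 _ _.
    have := hN2 n' x y (leq_maxr _ _).
    apply; first exact: (le_trans (ler_Re (Complex x y)) (ltW h2)).
    exact: (le_trans (ler_Im (Complex x y)) (ltW h2)).
  have k6 : rnorm (v n' z0 - l z0) <= t / 2.
    by have := hN2 n' 0 0 (leq_maxr _ _) hr0 hr0; rewrite zero.
  have -> : v n (z0 + h) - l (z0 + h) - (v n z0 - l z0) =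
    (v n (z0 + h) - v n' (z0 + h) - (v n z0 - v n' z0)) +
    ((v n' (z0 + h) - l (z0 + h)) - (v n' z0 - l z0)).
    by rewrite addrACA -opprD !addrA !subrK.
  have := rnormD (v n (z0 + h) - v n' (z0 + h) - (v n z0 - v n' z0))
    ((v n' (z0 + h) - l (z0 + h)) - (v n' z0 - l z0)).
  have := rnorm_subr (v n' (z0 + h) - l (z0 + h)) (v n' z0 - l z0); lra.
have -> : l (z0 + h) - l z0 - h *: d0 =
   (v n (z0 + h) - v n z0 - h *: d n) - (v n (z0 + h) - l (z0 + h) - (v n z0 - l z0)) +
   h *: (d n - d0).
  by rewrite scalerBr; exact: zmod_limit.
have := rnormD ((v n (z0 + h) - v n z0 - h *: d n) - (v n (z0 + h) - l (z0 + h) - (v n z0 - l z0)))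
  (h *: (d n - d0)).
have := rnorm_subr (v n (z0 + h) - v n z0 - h *: d n) (v n (z0 + h) - l (z0 + h) - (v n z0 - l z0)).
rewrite rnorm_scale; have := ler_wpM2l (cmod_ge0 h) (ltW k2); lra.
Qed.

End Schwarz.

(** * Smooth bump functions *)

Section Bumps.
Context (R : realType).

(** The functions x^(-k) exp(-1/x) for x > 0, extended by 0: their derivatives are
    again combinations of such functions. *)
Definition flat (k : nat) (x : R) : R :=
  if 0 < x then expR (- k%:R * ln x - x^-1) else 0.

Lemma exp_dominates (k : nat) : exists2 C : R, 0 <= C &
  forall u : R, 0 < u -> u ^+ k * expR (- u) <= C.
Proof.
case: k => [|k]; first by exists 1 => // u u0; rewrite expr0 mul1r expR_le1; lra.
exists (k.+1%:R ^+ k.+1); first by rewrite exprn_ge0.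
move=> u u0; rewrite expRN ler_pdivrMr ?expR_gt0//.
have k0 : 0 < k.+1%:R :> R by rewrite ltr0n.
have ku : u = k.+1%:R * (u / k.+1%:R) by rewrite mulrC divfK ?gt_eqF.
rewrite {2}ku expRM_natl -exprMn lerXn2r ?nnegrE ?mulr_ge0 ?expR_ge0 ?ltW//.
rewrite [ltLHS]ku ltr_pM2l//; apply: lt_le_trans (expR_ge1Dx _).
by rewrite ltrDr.
Qed.

Lemma flat_ge0 k x : 0 <= flat k x.
Proof. by rewrite /flat; case: ifP; rewrite ?expR_ge0. Qed.

(** This bound gives the derivative 0 at the origin. *)
Lemma flat_small (k : nat) : exists2 C : R, 0 <= C & forall x, flat k x <= C * x ^+ 2.
Proof.
have [C C0 hC] := exp_dominates k.+2; exists C => // x; rewrite /flat.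
case: ltP => x0; last by rewrite mulr_ge0// sqr_ge0.
have xi0 : 0 < x^-1 by rewrite invr_gt0.
have := ler_wpM2r (sqr_ge0 x) (hC _ xi0).
have -> : - k%:R * ln x - x^-1 = k%:R * ln x^-1 - x^-1 by rewrite lnV ?posrE// mulrN mulNr.
rewrite expRD expRM_natl lnK ?posrE// 2!exprS.
have -> : x^-1 * (x^-1 * x^-1 ^+ k) * expR (- x^-1) * x ^+ 2 = x^-1 ^+ k * expR (- x^-1).
  by move: (x^-1 ^+ k) (expR _) => a b; field; rewrite gt_eqF.
by [].
Qed.

Lemma is_derive_flat (k : nat) (x : R) :
  is_derive x 1 (flat k) (- k%:R * flat k.+1 x + flat k.+2 x).
Proof.
have [x0|x0|->] := ltgtP x 0.
- have -> : - k%:R * flat k.+1 x + flat k.+2 x = 0.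
    by rewrite /flat !ltNge !(ltW x0)/= mulr0 addr0.
  apply: (@near_eq_is_derive _ _ _ (cst 0)) => //.
  near=> y; rewrite /flat ltNge ltW//=; near: y; exact: lt_nbhsl.
- apply: (@near_eq_is_derive _ _ _ (expR \o (fun y => - k%:R * ln y - y^-1))).
    near=> y; rewrite /flat; have -> : 0 < y by near: y; exact: lt_nbhsr.
    by [].
  have xn : x != 0 by rewrite gt_eqF.
  have dl := is_derive1_ln x0.
  have d1 : is_derive x 1 (fun y : R => - k%:R * ln y - y^-1) (- k%:R * x^-1 + x ^- 2).
    have d1 : is_derive x 1 (fun y : R => y^-1) (- x ^- 2 *: 1) by exact: is_deriveV.
    apply: is_derive_eq; rewrite -[_ *: 1]/(- x ^- 2 * 1) mulr1 opprK.
    by congr (_ + _).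
  have := @is_derive1_comp R expR (fun y => - k%:R * ln y - y^-1) x _ _ (is_derive_expR _) d1.
  move=> dd; apply: (is_derive_eq dd); rewrite /flat x0.
  have e (j : nat) : expR (- j.+1%:R * ln x - x^-1) = expR (- j%:R * ln x - x^-1) * x^-1.
    have xi : x^-1 = expR (- ln x) by rewrite expRN lnK.
    rewrite [X in _ = _ * X]xi -expRD; congr expR.
    by rewrite -natr1; ring.
  by rewrite !e; move: (expR _) => a; field.
- have -> : - k%:R * flat k.+1 0 + flat k.+2 0 = 0 by rewrite /flat ltxx mulr0 addr0.
  have L : h^-1 *: ((flat k \o shift 0) (h *: 1) - flat k 0) @[h --> (0 : R)^'] --> (0 : R).
    have [C C0 hC] := flat_small k.
    apply/cvgrPdist_lt => e e0; have C1 : 0 < C + 1 by lra.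
    have r0 : 0 < e / (C + 1) by rewrite divr_gt0.
    apply: filterS (nbhsx_ballx (0 : R) _ r0) => h; rewrite -ball_normE /= sub0r normrN => hh h0.
    have -> : flat k 0 = 0 by rewrite /flat ltxx.
    rewrite sub0r normrN subr0 addr0 /= -[h^-1 *: _]/(h^-1 * _) -[h *: 1]/(h * 1) mulr1.
    rewrite normrM (ger0_norm (flat_ge0 _ _)) normfV mulrC ltr_pdivrMr ?normr_gt0//.
    apply: (le_lt_trans (hC h)); rewrite -real_normK ?num_real// expr2 mulrA.
    rewrite ltr_pM2r ?normr_gt0//; move: hh; rewrite ltr_pdivlMr// => hh.
    by have := normr_ge0 h; lra.
  apply: DeriveDef; first by apply/cvg_ex; exists 0.
  exact: cvg_lim.
Unshelve. all: by end_near.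
Qed.

(** A class of smooth functions that is closed under differentiation. *)
Inductive flat_expr : (R -> R) -> Prop :=
| flat_affine k (a b : R) : flat_expr (fun x => flat k (a * x + b))
| flat_add f g : flat_expr f -> flat_expr g -> flat_expr (fun x => f x + g x)
| flat_mul f g : flat_expr f -> flat_expr g -> flat_expr (fun x => f x * g x)
| flat_scale (c : R) f : flat_expr f -> flat_expr (fun x => c * f x).

Lemma flat_expr_derive f : flat_expr f ->
  exists2 g, flat_expr g & forall x : R, is_derive x (1 : R) f (g x).
Proof.
elim=> {f} [k a b|f g _ [f' hf df] _ [g' hg dg]|f g hf0 [f' hf df] hg0 [g' hg dg]|c f _ [f' hf df]].
- exists (fun x => a * (- k%:R * flat k.+1 (a * x + b) + flat k.+2 (a * x + b))).
    by apply/flat_scale/flat_add; [apply/flat_scale/flat_affine|exact: flat_affine].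
  move=> x; have d1 : is_derive x 1 (fun x : R => a * x + b) a.
    by apply: is_derive_eq; rewrite addr0 -[a *: 1]/(a * 1) mulr1.
  have := @is_derive1_comp R (flat k) (fun x => a * x + b) x _ _ (is_derive_flat _ _) d1.
  by move=> dd; apply: (is_derive_eq dd); rewrite mulrC.
- exists (fun x => f' x + g' x); first exact: flat_add.
  by move=> x; have d1 := df x; have d2 := dg x; exact: is_deriveD.
- exists (fun x => f' x * g x + f x * g' x); first by apply: flat_add; exact: flat_mul.
  move=> x; have d1 := df x; have d2 := dg x.
  have dd := is_deriveM d1 d2; apply: (is_derive_eq dd).
  by rewrite addrC -[f x *: _]/(f x * _) -[g x *: _]/(g x * _) (mulrC (g x)).
- exists (fun x => c * f' x); first exact: flat_scale.
  by move=> x; have d1 := df x; exact: is_deriveZ.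
Qed.

Lemma flat_expr_smooth f : flat_expr f -> forall n y, derivable (derive1n n f) y 1.
Proof.
move=> hf n y; elim: n f hf => [|n ih] f hf.
  by have [g _ dg] := flat_expr_derive hf; have [] := dg y.
rewrite derive1Sn; have [g hg dg] := flat_expr_derive hf.
suff -> : f^`()%classic = g by exact: ih.
by apply/funext => x; rewrite derive1E; have [] := dg x.
Qed.

(** As n tends to infinity these bumps tend to the indicator function of ]a, b[. *)
Definition bump (a b : R) (n : nat) (y : R) : R :=
  flat 0 (n.+1%:R * y + - (n.+1%:R * a)) * flat 0 (- n.+1%:R * y + n.+1%:R * b).

Lemma flat0E x : 0 < x -> flat 0 x = expR (- x^-1).
Proof. by move=> x0; rewrite /flat x0 mulNr mul0r oppr0 add0r. Qed.

Lemma flat_le0 k x : x <= 0 -> flat k x = 0.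
Proof. by move=> x0; rewrite /flat ltNge x0. Qed.

Lemma flat0_le1 x : flat 0 x <= 1.
Proof.
have [x0|x0] := leP x 0; first by rewrite flat_le0.
by rewrite flat0E// expR_le1 oppr_le0 invr_ge0 ltW.
Qed.

Lemma bump01 a b n y : 0 <= bump a b n y <= 1.
Proof.
by rewrite mulr_ge0 ?flat_ge0//= mulr_ile1 ?flat_ge0 ?flat0_le1.
Qed.

Lemma bump_out a b n y : ~~ (a < y < b) -> bump a b n y = 0.
Proof.
rewrite negb_and -!leNgt => /orP[ya|by_]; rewrite /bump.
  by rewrite flat_le0 ?mul0r// -mulrN -mulrDr pmulr_rle0// subr_le0.
by rewrite [flat 0 (- _ * _ + _)]flat_le0 ?mulr0// mulNr addrC -mulrBr pmulr_rle0// subr_le0.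
Qed.

Lemma bump_cvg a b y : a < y < b -> bump a b n y @[n --> \oo] --> (1 : R).
Proof.
move=> /andP[ay yb].
have key (c : R) : 0 < c -> flat 0 (n.+1%:R * c) @[n --> \oo] --> (1 : R).
  move=> c0; rewrite -[X in _ --> X]expR0.
  rewrite (_ : (fun n => _) = (fun n : nat => expR (- (n.+1%:R^-1 * c^-1)))); last first.
    by apply/funext => n; rewrite flat0E ?mulr_gt0// invfM.
  apply: continuous_cvg; first exact: continuous_expR.
  rewrite -[X in _ --> X]oppr0; apply: cvgN; rewrite -[X in _ --> X](mul0r c^-1).
  by apply: cvgM; [exact: cvg_harmonic|exact: cvg_cst].
rewrite -[X in _ --> X]mul1r.
rewrite (_ : (fun n => _) = (fun n : nat => flat 0 (n.+1%:R * (y - a)) * flat 0 (n.+1%:R * (b - y)))).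
  by apply: cvgM; apply: key; rewrite subr_gt0.
apply/funext => n; rewrite /bump; congr (flat 0 _ * flat 0 _); first by rewrite mulrBr.
by rewrite mulrBr mulNr addrC.
Qed.

Lemma bump_test a b n : test_function (fun y => (bump a b n y)%:C%C).
Proof.
have hb : flat_expr (bump a b n) by apply: flat_mul; exact: flat_affine.
split.
- exact: flat_expr_smooth hb.
- move=> m y /=; rewrite (_ : derive1n m _ = cst 0); first exact: derivable_cst.
  elim: m => [|m ih]; first by apply/funext.
  by rewrite derive1nS ih; apply/funext => x; rewrite derive1_cst.
apply: (@subclosed_compact _ _ `[a, b]%classic); [exact: closed_closure|exact: segment_compact|].
have cl : closed (`[a, b]%classic : set R).
  by apply: compact_closed; [exact: Rhausdorff|exact: segment_compact].
rewrite [X in _ `<=` X]((closure_id _).1 cl); apply: closure_subset => y /= /eqP h; rewrite in_itv /=.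
have : a < y < b by apply: contrapT => /negP/(bump_out n) e; apply: h; rewrite e.
lra.
Qed.

End Bumps.

(** * Integrals against test functions *)

Lemma invS_small (R : realType) (e : R) : 0 < e ->
  exists N, forall n, (N <= n)%N -> n.+1%:R^-1 < e.
Proof.
move=> e0; exists (Num.bound e^-1) => n hn.
rewrite -[ltRHS]invrK ltf_pV2 ?posrE ?invr_gt0 ?ltr0n//.
have : e^-1 < (Num.bound e^-1)%:R by rewrite archi_boundP// invr_ge0 ltW.
by move/lt_le_trans; apply; rewrite ler_nat; lia.
Qed.

Section TestFunctions.
Context (R : realType).
Local Notation mu := (@lebesgue_measure R).

Lemma nbhs_real (y : R) (A : set R) : nbhs y A ->
  exists2 d : R, 0 < d & forall t, `|t - y| < d -> A t.
Proof.
move=> /nbhs_ballP[d d0 hd]; exists d => // t ht; apply: hd.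
by rewrite -ball_normE /= distrC.
Qed.

Lemma test_function_continuous (phi : R -> R[i]) y (e : R) : test_function phi -> 0 < e ->
  exists2 d : R, 0 < d & forall t, `|t - y| < d -> cmod (phi t - phi y) < e.
Proof.
move=> [hr hi _] e0; have e2 : 0 < e / 2 by lra.
have cr := differentiable_continuous ((derivable1_diffP _ _).1 (hr 0%N y)).
have ci := differentiable_continuous ((derivable1_diffP _ _).1 (hi 0%N y)).
have [r r0 br] := nbhs_real ((cvgrPdist_lt _ _).1 cr _ e2).
have [s s0 bs] := nbhs_real ((cvgrPdist_lt _ _).1 ci _ e2).
exists (Num.min r s); first by rewrite lt_min r0.
move=> t; rewrite lt_min => /andP[/br h1 /bs h2]; apply: (le_lt_trans (cmod_le _)).
move: h1 h2; rewrite /derive1n /=; case: (phi t) (phi y) => [a b] [c d] /=.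
rewrite ![`|c - a|]distrC ![`|d - b|]distrC; lra.
Qed.

Lemma test_function_compactly (phi : R -> R[i]) :
  test_function phi -> compactly_smeas (phi : R -> R[i]^o).
Proof.
move=> tphi; have cphi := test_function_continuous _ tphi.
have [T hT] : exists T : R, forall y, T < `|y| -> phi y = 0.
  have [_ _ /compact_bounded[T [_ hT]]] := tphi.
  exists (T + 1) => y yT; apply: contrapT => /eqP phin.
  have cl : closure [set z | phi z != 0] y by apply: subset_closure.
  have T1 : T < T + 1 by lra.
  by have := hT _ T1 y cl; rewrite /= leNgt yT.
split; last by exists T.
split; first by apply: smeas_continuous => y e e0; exact: cphi.
have TT : - `|T| <= `|T| by have := normr_ge0 T; lra.
have [c _ hc] : exists2 c, c \in `[- `|T|, `|T|]%R &
    forall t, t \in `[- `|T|, `|T|]%R -> cmod (phi t) <= cmod (phi c).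
  apply: EVT_max => //; apply: continuous_subspaceT => y.
  apply/cvgrPdist_lt => e e0; have [d d0 hd] := cphi y e e0.
  apply: filterS (nbhsx_ballx y _ d0) => t; rewrite -ball_normE /= distrC => /hd.
  rewrite cmodB; apply: le_lt_trans; exact: (@rnorm_lip _ R[i]^o).
exists (cmod (phi c)) => y; have [/hT ->|yT] := ltP T `|y|.
  by rewrite rnorm0 cmod_ge0.
by apply: hc; rewrite in_itv /= -ler_norml (le_trans yT)// ler_norm.
Qed.

Lemma at_right0P (P : R -> Prop) :
  (exists2 r : R, 0 < r & forall e, 0 < e < r -> P e) -> \forall e \near (0 : R)^'+, P e.
Proof.
move=> [r r0 hr]; apply: filterS (nbhsx_ballx (0 : R) _ r0) => e.
rewrite -ball_normE /= sub0r normrN => er e0; apply: hr; rewrite e0 /=.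
exact: le_lt_trans (ler_norm e) er.
Qed.

Lemma at_right0_inv (P : R -> Prop) : (\forall e \near (0 : R)^'+, P e) ->
  exists2 r : R, 0 < r & forall e, 0 < e < r -> P e.
Proof.
move=> /nbhs_real[r r0 hr]; exists r => // e /andP[e0 er]; apply: hr => //.
by rewrite subr0 gtr0_norm.
Qed.

Context (E : normedModType R[i]) (cE : @seq_complete R E).

Lemma compactly_scale (c : R -> R[i]^o) (h : R -> E) :
  compactly_smeas c -> bounded_smeas h -> compactly_smeas (fun y => c y *: h y).
Proof.
move=> [bc [T hT]] bh; split; first exact: bounded_smeasZ.
by exists T => y /hT ->; rewrite scale0r.
Qed.

(** Against a bounded function, weights may be replaced by others close to them in
    mean; this passes from bumps to indicator functions. *)
Lemma bint_weight (c c' : R -> R[i]^o) (h : R -> E) (M k : R) :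
  compactly_smeas c -> compactly_smeas c' -> bounded_smeas h ->
  (forall y, rnorm (h y) <= M) -> 0 <= M ->
  (\int[mu]_y (cmod (c y - c' y))%:E <= k%:E)%E ->
  rnorm (bochner_integral (fun y => c y *: h y) - bochner_integral (fun y => c' y *: h y))
    <= M * k.
Proof.
move=> hc hc' bh hM M0 hk; rewrite -lee_fin.
apply: (le_trans (bint_dist cE (compactly_scale hc bh) (compactly_scale hc' bh))).
have mcc := @measurable_rnorm R R[i]^o _ (smeasB hc.1.1 hc'.1.1).
apply: (@le_trans _ _ (\int[mu]_y (M%:E * (cmod (c y - c' y))%:E))%E).
  apply: ge0_le_integral => //.
  - by move=> y _; rewrite lee_fin rnorm_ge0.
  - apply: measurable_dist.
      exact: (compactly_scale hc bh).1.1.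
    exact: (compactly_scale hc' bh).1.1.
  - by apply: measurable_funeM; exact/measurable_EFinP.
  move=> y _; rewrite -EFinM lee_fin -scalerBl rnorm_scale mulrC.
  by rewrite ler_wpM2r ?cmod_ge0.
rewrite ge0_integralZl_EFin//; first by rewrite EFinM lee_wpmul2l.
- by move=> y _; rewrite lee_fin cmod_ge0.
- exact/measurable_EFinP.
Qed.

(** Pointwise bounded convergence of the integrands as the parameter tends to 0. *)
Lemma bint_limit (c : R -> R[i]^o) (h : R -> R -> E) (l : R -> E) (M : R) :
  compactly_smeas c ->
  (forall t, 0 < t < 1 -> bounded_smeas (h t) /\ forall y, rnorm (h t y) <= M) ->
  bounded_smeas l -> (forall y, rnorm (l y) <= M) ->
  (forall y (e : R), 0 < e -> exists2 r : R, 0 < r & forall t, 0 < t < r -> rnorm (h t y - l y) < e) ->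
  bochner_integral (fun y => c y *: h t y) @[t --> (0 : R)^'+] -->
  bochner_integral (fun y => c y *: l y).
Proof.
move=> hc hh bl lM hl; apply/cvg_rnormP => e e0; apply: at_right0P.
apply: contrapT => nex.
have seq n : exists t : R, 0 < t < n.+2%:R^-1 /\
    e <= rnorm (bochner_integral (fun y => c y *: h t y) - bochner_integral (fun y => c y *: l y)).
  apply: contrapT => nt; apply: nex; exists n.+2%:R^-1; first by rewrite invr_gt0 ltr0n.
  move=> t ht; rewrite ltNge; apply/negP => he; apply: nt; by exists t.
move/choice: seq => [t ht].
have n2 n : n.+2%:R^-1 < 1 :> R by rewrite invf_lt1 ?ltr0n// ltr1n.
have t01 n : 0 < t n < 1.
  by have [/andP[-> h2] _] := ht n; rewrite (lt_trans h2).
have [[mc [Mc hMc]] [T hT]] := hc.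
have cl := compactly_scale hc bl; have ch n := compactly_scale hc (hh _ (t01 n)).1.
have lim0 : (\int[mu]_y (rnorm (c y *: h (t n) y - c y *: l y))%:E)%E @[n --> \oo] --> 0%E.
  apply: (@bounded_convergence0 _ T (Mc * (2 * M))).
  - by move=> n; apply: measurable_rnorm; apply: smeasB; [exact: (ch n).1.1|exact: cl.1.1].
  - move=> n y; rewrite rnorm_ge0 /= -scalerBr rnorm_scale.
    apply: ler_pM; rewrite ?cmod_ge0 ?rnorm_ge0//; first exact: hMc.
    have := rnorm_subr (h (t n) y) (l y); have := lM y; have := (hh _ (t01 n)).2 y; lra.
  - by move=> n y /hT ->; rewrite !scale0r subrr rnorm0.
  apply: aeW => y; apply/cvgrPdist_lt => d d0.
  have c1 : 0 < cmod (c y) + 1 by have := cmod_ge0 (c y); lra.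
  have [r r0 hr] := hl y _ (divr_gt0 d0 c1).
  have [N hN] : exists N : nat, r^-1 < N%:R.
    by exists (Num.bound r^-1); rewrite archi_boundP// invr_ge0 ltW.
  exists N => // n /= Nn; rewrite sub0r normrN ger0_norm ?rnorm_ge0// -scalerBr rnorm_scale.
  have tr : 0 < t n < r.
    have [/andP[-> h2] _] := ht n; apply: (lt_le_trans h2).
    rewrite -[leRHS]invrK lef_pV2 ?posrE ?invr_gt0 ?ltr0n//.
    by apply: (le_trans (ltW hN)); rewrite ler_nat; lia.
  have := hr _ tr; rewrite ltr_pdivlMr// => h3.
  by have := rnorm_ge0 (h (t n) y - l y); have := cmod_ge0 (c y); nra.
have [N hN] := cvge0_lt lim0 e0.
have := bint_dist cE (ch N) cl; have [_ h1] := ht N.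
move=> /le_lt_trans/(_ (hN N (leqnn N))); rewrite lte_fin ltNge h1.
by [].
Qed.

End TestFunctions.

Section BumpApproximation.
Context (R : realType) (a b : R) (ab : a < b).
Local Notation mu := (@lebesgue_measure R).

Lemma signed_itvE y : signed_itv a b y = (if a < y <= b then 1 else 0).
Proof.
rewrite /signed_itv; case: (leP y b) => yb; case: (leP y a) => ya; rewrite /= ?subrr ?subr0//.
by move: (le_lt_trans (le_trans ya (ltW ab)) yb); rewrite ltxx.
Qed.

Lemma compactly_signed : compactly_smeas (signed_itv a b).
Proof.
have := compactly_signed_itv a b (bounded_smeas_cst (1 : R[i]^o)).
by congr compactly_smeas; apply/funext => y; exact: mulr1.
Qed.

Lemma bump_approx (e : R) : 0 < e -> exists n,
  (\int[mu]_y (cmod ((bump a b n y)%:C%C - signed_itv a b y))%:E <= e%:E)%E.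
Proof.
move=> e0.
have cb n := test_function_compactly (bump_test a b n).
have out n y : `|a| + `|b| < `|y| -> (bump a b n y)%:C%C - signed_itv a b y = 0.
  move=> hy; have ny : ~~ (a <= y <= b).
    apply/negP => /andP[h1 h2]; move: hy; rewrite ltNge ler_norml => /negP; apply.
    have := ler_norm b; have := ler_norm (- a); rewrite normrN.
    by have := normr_ge0 a; have := normr_ge0 b; lra.
  rewrite (signed_itv_out (ltW ab) ny) subr0 bump_out//; apply: contra ny; lra.
have lim0 : (\int[mu]_y (cmod ((bump a b n y)%:C%C - signed_itv a b y))%:E)%E @[n --> \oo] --> 0%E.
  apply: (@bounded_convergence0 _ (`|a| + `|b|) 1).
  - move=> n; have := @measurable_rnorm R R[i]^o _ (smeasB (cb n).1.1 compactly_signed.1.1).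
    by [].
  - move=> n y; rewrite cmod_ge0 /= signed_itvE; have /andP[b0 b1] := bump01 a b n y.
    case: ifP => _; last by rewrite subr0 cmod_real ger0_norm.
    by rewrite -(rmorph1 (real_complex R)) -rmorphB cmod_real distrC ger0_norm; lra.
  - by move=> n y /(out n) ->; rewrite cmod0.
  exists [set b]; split; [exact: measurable_set1|exact: lebesgue_measure_set1|].
  move=> y /=; apply: contra_notP => yb; rewrite signed_itvE.
  have [ayb|nayb] := boolP (a < y <= b).
    have ayb' : a < y < b.
      by move/andP: ayb => [-> /=]; rewrite le_eqVlt => /orP[/eqP/yb|].
    have := bump_cvg ayb'; move/cvgrPdist_lt => h; apply/cvgrPdist_lt => d d0.
    apply: filterS (h d d0) => n hn; rewrite sub0r normrN ger0_norm ?cmod_ge0//.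
    by rewrite -(rmorph1 (real_complex R)) -rmorphB cmod_real distrC.
  rewrite (_ : (fun n => _) = cst 0); first exact: cvg_cst.
  apply/funext => n; rewrite bump_out ?subr0 ?cmod0//; apply: contra nayb; lra.
by have [N hN] := cvge0_lt lim0 e0; exists N; exact/ltW/hN.
Qed.

End BumpApproximation.

(** * Distributional boundary values *)

Section Boundary.
Context (R : realType) (P : compatible_pair R).
Local Notation mu := (@lebesgue_measure R).
Local Notation incl := (@Defs.incl R P _).
Implicit Types (f F : R[i]^o -> Sigma P).

Definition strip_continuous (E : normedModType R[i]) (F : R[i]^o -> E) :=
  forall z, closed_strip z -> forall e : R, 0 < e -> exists2 r : R, 0 < r &
    forall w, closed_strip w -> cmod (w - z) < r -> rnorm (F w - F z) < e.

Lemma strip_continuous_cvg (E : normedModType R[i]) (F : R[i]^o -> E) : strip_continuous F <->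
  forall z, closed_strip z -> F @ within (@closed_strip R) (nbhs z) --> F z.
Proof.
split=> [h z Sz|h z Sz e e0].
  apply/cvg_rnormP => e /(h z Sz)[r r0 hr].
  by apply/(@nbhs_rnormP R R[i]^o z); exists r => // w wz Sw; exact: hr.
have [r r0 hr] := (@nbhs_rnormP R R[i]^o z _).1 ((cvg_rnormP _ _ _).1 (h z Sz) _ e0).
by exists r => // w Sw wz; exact: hr.
Qed.

Lemma strip_continuousP F : {within (@closed_strip R), continuous F} <-> strip_continuous F.
Proof. by rewrite subspace_continuousP strip_continuous_cvg. Qed.

Lemma continuous_realP (E : normedModType R[i]) (g : R -> E) : continuous g <->
  forall y (e : R), 0 < e -> exists2 d : R, 0 < d &
    forall t, `|t - y| < d -> rnorm (g t - g y) < e.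
Proof.
split=> [cg y e e0|h y]; first exact: (nbhs_real ((cvg_rnormP _ _ _).1 (cg y) _ e0)).
apply/cvg_rnormP => e /(h y)[d d0 hd]; apply: filterS (nbhsx_ballx y _ d0) => t.
by rewrite -ball_normE /= distrC; exact: hd.
Qed.

Lemma bounded_smeas_incl k (g : R -> Defs.space P k) :
  bounded_smeas g -> bounded_smeas (fun y => incl (g y)).
Proof.
move=> [mg [M hM]]; split; first exact: (smeas_comp (@tends_incl R P k)).
by exists M => y; apply: le_trans (hM y); exact: rnorm_incl.
Qed.

Lemma oint_incl k a b (g : R -> Defs.space P k) : bounded_smeas g ->
  oint a b (fun y => incl (g y)) = incl (oint a b g).
Proof.
move=> bg; apply: (oint_map (f := @Defs.incl R P k)) => //.
- exact: complete_seq_complete.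
- exact: inclD.
- exact: inclZ.
- exact: rnorm_incl.
Qed.

Lemma holo_cderiv f : (forall z, open_strip z -> derivable f z 1) ->
  forall z, open_strip z -> exists d, cderiv f z d.
Proof. by move=> h z /h/derivable_cderivP. Qed.

(** The real part of [near_bpoint]. *)
Definition bx (k : bool) (t : R) : R := if k then 1 - t else t.

Lemma bx01 k t : 0 < t < 1 -> 0 < bx k t < 1.
Proof. by case: k; rewrite /bx; lra. Qed.

(** The choice of the distance t of the parallel line in [Hinfty_primitive]. *)
Lemma small_constants (M e t : R) : 0 <= M -> 0 < e -> 0 <= t -> t <= e / (16 * (M + 1)) ->
  M * t <= e / 16 /\ M * (e / (4 * (M + 1))) <= e / 4.
Proof.
move=> M0 e0 t0 te; have M1 : 0 < M + 1 by lra.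
have h1 : (M + 1) * (e / (16 * (M + 1))) = e / 16 by field; rewrite gt_eqF.
have h2 : (M + 1) * (e / (4 * (M + 1))) = e / 4 by field; rewrite gt_eqF.
have e4 : 0 < e / (4 * (M + 1)) by rewrite divr_gt0// mulr_gt0.
split; last by rewrite -h2 ler_wpM2r ?(ltW e4)//; lra.
by rewrite -h1; apply: ler_pM => //; lra.
Qed.

(** The increment D1 - D2 of the primitive along the boundary is compared with the
    integral J of the boundary values: G1 - G2 is the increment along a parallel line,
    B the integral of f there, and A and I are the integrals of f and of the boundary
    values against the same bump. *)
Lemma boundary_estimate (E : normedModType R[i]) (D1 D2 G1 G2 I J A B : E) (e : R) :
  G1 - G2 = 'i%C *: B -> rnorm (D1 - G1) <= e / 16 -> rnorm (D2 - G2) <= e / 16 ->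
  rnorm (I - J) <= e / 4 -> rnorm (A - I) < e / 4 -> rnorm (A - B) <= e / 4 ->
  rnorm (D1 - D2 - 'i%C *: J) <= e.
Proof.
move=> GB h1 h2 h3 h4 h5.
have -> : D1 - D2 - 'i%C *: J = D1 - G1 - (D2 - G2) + 'i%C *: (B - A + (A - I + (I - J))).
  have -> : B - A + (A - I + (I - J)) = B - J by rewrite !addrA !subrK.
  by rewrite scalerBr -GB [D1 - G1 - _]subr_swap addrA subrK.
have n1 := rnormD (D1 - G1 - (D2 - G2)) ('i%C *: (B - A + (A - I + (I - J)))).
have n2 := rnorm_subr (D1 - G1) (D2 - G2).
have n3 := rnormD (B - A) (A - I + (I - J)); have n4 := rnormD (A - I) (I - J).
rewrite rnorm_scale cmodi mul1r in n1; rewrite (rnormB B A) in n3.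
have n5 := rnorm_ge0 (D1 - G1); lra.
Qed.

Lemma open_near_bpoint k (t y : R) : 0 < t < 1 -> open_strip (near_bpoint k t y : R[i]^o).
Proof. exact: bx01. Qed.

Lemma open_closed_strip (z : R[i]^o) : open_strip z -> closed_strip z.
Proof. by move=> /andP[h1 h2]; apply/andP; split; exact: ltW. Qed.

Lemma closed_bpoint k y : closed_strip (bpoint k y : R[i]^o).
Proof. by case: k; rewrite /closed_strip /bpoint /= ?lexx ?ler01. Qed.

(** The inclusion of the Calderon space: a continuous extension has the right
    distributional boundary values by bounded convergence. *)
Lemma A_space_Hinfty f : A_space f -> Hinfty f.
Proof.
move=> [[hf _] [F [/strip_continuousP cF Ff] hg]]; split=> // k.
have [g [cg [Mg hMg] Fg]] := hg k; have [holo [M hM]] := hf.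
have sg : smeas g by apply: smeas_continuous; exact/continuous_realP.
have bg : bounded_smeas g by split=> //; exists Mg.
exists g; first by split; [exact: smeas_strong|exists Mg; exact: aeW].
move=> phi /test_function_compactly tphi.
apply: (bint_limit (sigma_complete (P := P)) (M := Num.max M Mg) tphi (l := fun y => incl (g y))
  (h := fun t y => f (near_bpoint k t y))).
- move=> t t01; split; last first.
    by move=> y; rewrite le_max hM//; exact: (bx01 k t01).
  exact: (bounded_smeas_vertical (holo_cderiv holo) hM (bx01 k t01)).
- exact: bounded_smeas_incl.
- by move=> y; rewrite le_max; apply/orP; right; apply: le_trans (hMg y); exact: rnorm_incl.
move=> y e e0; have Sb := closed_bpoint k y.
have [r r0 hr] := cF _ Sb _ e0; exists (Num.min r 1); first by rewrite lt_min r0 ltr01.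
move=> t /andP[t0]; rewrite lt_min => /andP[tr t1]; rewrite -Fg -Ff; last first.
  by apply: (bx01 k); rewrite t0.
apply: hr; first by apply/open_closed_strip/open_near_bpoint; rewrite t0.
apply: (le_lt_trans (cmod_complex _ _ _ _)); rewrite subrr normr0 addr0.
case: (k) => /=; first by rewrite addrAC subrr sub0r normrN gtr0_norm.
by rewrite subr0 gtr0_norm.
Qed.

Lemma bochner_integral_ae (E : normedModType R[i]) (h k : R -> E) (N : set R) :
  measurable N -> mu N = 0%E -> (forall y, ~ N y -> h y = k y) ->
  bochner_integral h = bochner_integral k.
Proof.
move=> mN N0 hk; rewrite /bochner_integral; congr xget; apply/funext => v.
apply/propext; split; first exact: (bochner_ae mN N0).
by apply: (bochner_ae mN N0) => y /hk.
Qed.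

(** Change the function to 0 on a null set. *)
Lemma Linfty_representative (E : normedModType R[i]) (g : R -> E) : Linfty g ->
  exists g' N M, [/\ measurable N, mu N = 0%E, forall y, ~ N y -> g y = g' y,
    smeas g' & forall y, rnorm (g' y) <= M].
Proof.
move=> [[s ss [N1 [mN1 N10 h1]]] [M [N2 [mN2 N20 h2]]]].
pose N : set R := N1 `|` N2; have mN : measurable N by exact: measurableU.
exists (fun y => if `[< N y >] then 0 else g y), N, (Num.max M 0); split=> //.
- by apply: null_set_setU.
- by move=> y Ny; case: asboolP.
- exists (fun n y => if `[< N y >] then 0 else s n y).
    by move=> n; apply: (simple_map_if mN (simple_map_cst R (0 : E))); exact: ss.
  move=> y; case: asboolP => Ny; first exact: tends_cst.
  apply/tendsP; apply: contrapT => ny; apply: Ny; left; exact: h1.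
- move=> y; case: asboolP => Ny; first by rewrite rnorm0 le_max lexx orbT.
  rewrite le_max; apply/orP; left; apply: contrapT => ny; apply: Ny; right; exact: h2.
Qed.

(** The primitive of f extends to a Lipschitz function on the closed strip, and its
    increments along the boundary are the integrals of the boundary values: apply
    the definition to bumps approximating the indicator function of an interval. *)
Lemma Hinfty_primitive f : Hinfty f ->
  exists (G : R[i]^o -> Sigma P) (g : forall k, R -> Defs.space P k) (M : R),
  [/\ forall z, open_strip z -> cderiv G z (f z),
      forall z, open_strip z -> exists d, cderiv f z d,
      forall z w, closed_strip z -> closed_strip w -> rnorm (G z - G w) <=
        M * (`|complex.Re z - complex.Re w| + `|complex.Im z - complex.Im w|),
      forall k, smeas (g k) /\ forall y, rnorm (g k y) <= M &
      forall k a b, a < b ->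
        G (bpoint k b) - G (bpoint k a) = 'i%C *: incl (oint a b (g k))].
Proof.
move=> [[/holo_cderiv holo [Mf hMf]] hb].
have [G [dG LG vG]] := primitive (sigma_complete (P := P)) holo hMf.
have cS := sigma_complete (P := P).
have M0 : 0 <= Mf.
  have S2 : open_strip (Complex (1 / 2 : R) 0) by rewrite /open_strip /=; lra.
  exact: le_trans (rnorm_ge0 _) (hMf _ S2).
(* the points of the closed strip are approached from inside, towards the middle *)
pose s n : R := 1 - n.+2%:R^-1.
have s01 n : 0 < s n < 1.
  have : n.+2%:R^-1 < 1 :> R by rewrite invf_lt1 ?ltr0n// ltr1n.
  have : 0 < n.+2%:R^-1 :> R by rewrite invr_gt0 ltr0n.
  by rewrite /s; move: (n.+2%:R^-1) => q; lra.
pose sx n x : R := 1 / 2 + s n * (x - 1 / 2).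
have sx01 n x : 0 <= x <= 1 -> 0 < sx n x < 1.
  by move=> x01; rewrite /sx; have /andP[h1 h2] := s01 n; nra.
have LG' x y x' y' : 0 < x < 1 -> 0 < x' < 1 ->
    rnorm (G (Complex x y) - G (Complex x' y')) <= Mf * (`|x - x'| + `|y - y'|).
  move=> hx hx'; have := LG x' y' (x - x') (y - y') hx'; rewrite !subrKC; exact.
have s_small (e : R) : 0 < e -> exists N, forall n, (N <= n)%N -> n.+2%:R^-1 < e.
  by move=> /invS_small[N hN]; exists N => n Nn; apply: hN; exact: leqW.
have Mf1 : 0 < Mf + 1 by lra.
have sdist n n' x : 0 <= x <= 1 -> `|sx n x - sx n' x| <= n.+2%:R^-1 + n'.+2%:R^-1.
  move=> x01; have -> : sx n x - sx n' x = (n'.+2%:R^-1 - n.+2%:R^-1) * (x - 1 / 2).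
    by rewrite /sx /s; ring.
  have n0 : 0 < n.+2%:R^-1 :> R by rewrite invr_gt0 ltr0n.
  have n0' : 0 < n'.+2%:R^-1 :> R by rewrite invr_gt0 ltr0n.
  move: n0 n0'; move: (n.+2%:R^-1) (n'.+2%:R^-1) => p q p0 q0.
  by rewrite ler_norml; have /andP[x0 x1] := x01; nra.
have exG z : exists l, closed_strip z -> tends (fun n => G (Complex (sx n (complex.Re z)) (complex.Im z))) l.
  have [Sz|nSz] := pselect (closed_strip z); last by exists 0.
  have [l hl] : exists l, tends (fun n => G (Complex (sx n (complex.Re z)) (complex.Im z))) l.
    apply: cS => e e0; have e2 : 0 < e / (2 * (Mf + 1)) by rewrite divr_gt0// mulr_gt0.
    have [N hN] := s_small _ e2; exists N => n n' /hN hn /hN hn'.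
    apply: (le_lt_trans (LG' _ _ _ _ (sx01 n _ Sz) (sx01 n' _ Sz))).
    rewrite subrr normr0 addr0; have hs := sdist n n' _ Sz.
    apply: (le_lt_trans (ler_wpM2l M0 hs)).
    have : (Mf + 1) * (n.+2%:R^-1 + n'.+2%:R^-1) < e.
      have -> : e = (Mf + 1) * (e / (2 * (Mf + 1)) + e / (2 * (Mf + 1))) by field; rewrite gt_eqF.
      by rewrite ltr_pM2l// ltrD.
    have n0 : 0 < n.+2%:R^-1 :> R by rewrite invr_gt0 ltr0n.
    have n0' : 0 < n'.+2%:R^-1 :> R by rewrite invr_gt0 ltr0n.
    by move: n0 n0'; move: (n.+2%:R^-1) (n'.+2%:R^-1) => p q; lra.
  by exists l.
have [Gb hGb] : exists Gb : R[i]^o -> Sigma P, forall z, closed_strip z ->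
    tends (fun n => G (Complex (sx n (complex.Re z)) (complex.Im z))) (Gb z).
  by have /choice[Gb hGb] := exG; exists Gb.
have GbE z : open_strip z -> Gb z = G z.
  move=> Sz; have Sz' : closed_strip z by move: Sz; rewrite /open_strip /closed_strip /=; lra.
  apply: (tends_uniq (hGb z Sz')) => e e0.
  have e2 : 0 < e / (Mf + 1) by rewrite divr_gt0.
  have [N hN] := s_small _ e2; exists N => n /hN hn.
  case: z Sz Sz' => x y Sz Sz' /=; apply: (le_lt_trans (LG' _ _ _ _ (sx01 n _ Sz') Sz)).
  rewrite subrr normr0 addr0; have -> : sx n x - x = - n.+2%:R^-1 * (x - 1 / 2).
    by rewrite /sx /s; ring.
  have n0 : 0 < n.+2%:R^-1 :> R by rewrite invr_gt0 ltr0n.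
  have : `|- n.+2%:R^-1 * (x - 1 / 2)| <= n.+2%:R^-1.
    have /andP[h1 h2] : 0 <= x <= 1 := Sz'.
    by move: n0; move: (n.+2%:R^-1) => p p0; rewrite ler_norml; nra.
  move=> h; apply: (le_lt_trans (ler_wpM2l M0 h)).
  by move: hn n0; rewrite ltr_pdivlMr//; move: (n.+2%:R^-1) => p; lra.
have LGb z w : closed_strip z -> closed_strip w -> rnorm (Gb z - Gb w) <=
    Mf * (`|complex.Re z - complex.Re w| + `|complex.Im z - complex.Im w|).
  move=> Sz Sw; have := tendsD (hGb z Sz) (tends_scale (-1) (hGb w Sw)); rewrite scaleN1r.
  move=> /tends_le h; rewrite -[Gb z - Gb w]subr0; apply: h => n; rewrite scaleN1r subr0.
  apply: (le_trans (LG' _ _ _ _ (sx01 n _ Sz) (sx01 n _ Sw))).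
  rewrite ler_wpM2l// lerD2r /sx opprD addrACA subrr add0r -mulrBr opprB addrA subrK.
  have /andP[h1 h2] := s01 n; rewrite normrM gtr0_norm// ler_piMl//; lra.
have hg k : exists g : R -> Defs.space P k, [/\ smeas g, exists M, forall y, rnorm (g y) <= M &
    has_boundary_value f g].
  have [g Lg bv] := hb k; have [g' [N [M [mN N0 gg' sg' hM]]]] := Linfty_representative Lg.
  exists g'; split; [exact: sg'|by exists M|].
  move=> phi tphi; have e : bochner_integral (fun y => phi y *: incl (g y)) =
      bochner_integral (fun y => phi y *: incl (g' y)).
    by apply: (bochner_integral_ae mN N0) => y /gg' ->.
  by rewrite -e; exact: bv.
pose g k := sval (cid (hg k)).
have gP k : [/\ smeas (g k), exists M, forall y, rnorm (g k y) <= M & has_boundary_value f (g k)].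
  exact: (svalP (cid (hg k))).
have [M1 hM1] : exists M, forall y, rnorm (g false y) <= M by case: (gP false).
have [M2 hM2] : exists M, forall y, rnorm (g true y) <= M by case: (gP true).
pose M := Num.max Mf (Num.max M1 M2).
have MfM : Mf <= M by rewrite le_max lexx.
have gM k y : rnorm (g k y) <= M.
  by case: k; rewrite /M !le_max ?hM1 ?hM2 ?orbT.
exists Gb, g, M; split; [|exact: holo| | |].
- move=> z Sz e e0; have [r r0 hr] := dG z Sz e e0.
  have Sz' : 0 < complex.Re z < 1 := Sz.
  exists (Num.min r (Num.min (complex.Re z) (1 - complex.Re z))).
    by rewrite !lt_min r0; lra.
  move=> h; rewrite !lt_min => /and3P[h1 h2 h3]; rewrite !GbE//; first exact: hr.
  have := ler_Re h; rewrite ler_norml /open_strip /=.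
  by rewrite (_ : complex.Re (z + h) = complex.Re z + complex.Re h); [lra|case: (z) (h) => ? ? []].
- move=> z w Sz Sw; apply: (le_trans (LGb z w Sz Sw)).
  by rewrite ler_wpM2r// addr_ge0.
- by move=> k; have [sg _ _] := gP k; split.
move=> k a b ab; have [sg _ bv] := gP k.
have bg : bounded_smeas (g k) by split=> //; exists M.
have big := bounded_smeas_incl bg.
have M0' : 0 <= M by lra.
apply/eqP; rewrite -subr_eq0; apply/eqP/rnorm_le_eps => e e0.
have e4 : 0 < e / (4 * (M + 1)) by rewrite divr_gt0//; lra.
have [n hn] := bump_approx ab e4.
have tb := bump_test a b n; have cb := test_function_compactly tb.
set c : R -> R[i]^o := fun y => (bump a b n y)%:C%C in cb.
have w1 : rnorm (bochner_integral (fun y => c y *: incl (g k y)) - oint a b (fun y => incl (g k y)))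
    <= M * (e / (4 * (M + 1))).
  rewrite ointE; apply: (bint_weight cS cb (compactly_signed a b) big) => //.
  by move=> y; apply: le_trans (gM k y); exact: rnorm_incl.
have e5 : 0 < e / 4 by lra.
have [r r0 hr] := at_right0_inv ((cvg_rnormP _ _ _).1 (bv _ tb) _ e5).
pose t := Num.min (r / 2) (Num.min (1 / 2) (e / (16 * (M + 1)))).
have e16 : 0 < e / (16 * (M + 1)) by rewrite divr_gt0//; lra.
have t0 : 0 < t by rewrite !lt_min; lra.
have : t <= t by []; rewrite {2}/t !le_min => /and3P[tr t1 te].
have tr' : 0 < t < r by lra.
have w2 := hr _ tr'; have t01 : 0 < t < 1 by lra.
have bf := bounded_smeas_vertical holo hMf (bx01 k t01).
have w3 : rnorm (bochner_integral (fun y => c y *: f (near_bpoint k t y)) -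
    oint a b (fun y => f (near_bpoint k t y))) <= M * (e / (4 * (M + 1))).
  rewrite ointE; apply: (bint_weight cS cb (compactly_signed a b) bf) => //.
  by move=> y; apply: le_trans MfM; apply: hMf; exact: bx01.
have w4 := vG (bx k t) a b (bx01 k t01).
have Sb := closed_bpoint k.
have w5 y : rnorm (Gb (bpoint k y) - G (near_bpoint k t y)) <= M * t.
  have So : open_strip (near_bpoint k t y) := bx01 k t01.
  have Sc := open_closed_strip So.
  rewrite -GbE//; apply: (le_trans (LGb _ _ (Sb y) Sc)).
  rewrite /= subrr normr0 addr0; apply: ler_pM => //.
  by case: (k) => /=; rewrite ?sub0r ?normrN ?opprB ?(addrC 1) ?subrK ger0_norm ?(ltW t0).
have [Mt Me] := small_constants M0' e0 (ltW t0) te.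
rewrite -oint_incl//.
apply: (boundary_estimate w4 (le_trans (w5 b) Mt) (le_trans (w5 a) Mt) (le_trans w1 Me) w2).
exact: (le_trans w3 Me).
Qed.

End Boundary.

(** * Lebesgue differentiation of vector valued functions *)

Lemma exchange_sums (V : zmodType) (a b c d s : V) : a + b = s -> c + d = s -> b - c = d - a.
Proof.
move=> <- e; have -> : b = c + d - a by rewrite e addrC addKr.
by rewrite addrAC [c + d]addrC addrK.
Qed.

Section Averages.
Context (R : realType).
Local Notation mu := (@lebesgue_measure R).

Definition average (E : normedModType R[i]) (g : R -> E) (d y : R) : E :=
  (2 * d)^-1%:C%C *: oint (y - d) (y + d) g.

Lemma cmod_inv_double (d : R) : 0 < d -> cmod ((2 * d)^-1%:C%C) = (2 * d)^-1.
Proof. by move=> d0; rewrite cmod_real ger0_norm// invr_ge0 mulr_ge0// ltW. Qed.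

Context (E : normedModType R[i]) (cE : @seq_complete R E).
Context (g : R -> E) (M : R) (sg : smeas g) (gM : forall y, rnorm (g y) <= M).

Let bg : bounded_smeas g. Proof. by split=> //; exists M. Qed.
Let M0 : 0 <= M. Proof. exact: le_trans (rnorm_ge0 (g 0)) (gM 0). Qed.

Lemma average_bound d y : 0 < d -> rnorm (average g d y) <= M.
Proof.
move=> d0; rewrite /average rnorm_scale cmod_inv_double//.
have d2 : 0 < 2 * d by rewrite mulr_gt0.
rewrite mulrC ler_pdivrMr//.
apply: (le_trans (oint_bound cE bg M0 (fun t _ => gM t))).
have -> : y + d - (y - d) = 2 * d by ring.
by rewrite gtr0_norm.
Qed.

(** Both intervals contain the same middle part; what remains are two intervals of
    length |y - y'|. *)
Lemma average_lipschitz d y y' : 0 < d ->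
  rnorm (average g d y - average g d y') <= M / d * `|y - y'|.
Proof.
move=> d0; rewrite /average -scalerBr rnorm_scale cmod_inv_double//.
have d2 : 0 < 2 * d by rewrite mulr_gt0.
rewrite mulrC ler_pdivrMr//.
have h1 := oint_chasles cE (y' - d) (y - d) (y + d) bg.
have h2 := oint_chasles cE (y' - d) (y' + d) (y + d) bg.
rewrite (exchange_sums h1 h2); apply: (le_trans (rnorm_subr _ _)).
have -> : M / d * `|y - y'| * (2 * d) = M * `|y - y'| + M * `|y - y'|.
  by field; rewrite gt_eqF.
have e1 : y + d - (y' + d) = y - y' by ring.
have e2 : y - d - (y' - d) = y - y' by ring.
apply: lerD; [rewrite -e1|rewrite -e2]; exact: (oint_bound cE bg M0 (fun t _ => gM t)).
Qed.

Lemma smeas_average d : 0 < d -> smeas (average g d).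
Proof.
move=> d0; apply: smeas_continuous => y e e0.
have Md : 0 < M / d + 1 by rewrite ltr_wpDl// divr_ge0// ltW.
exists (e / (M / d + 1)); first by rewrite divr_gt0.
move=> y' hy; apply: (le_lt_trans (average_lipschitz y' y d0)).
rewrite ltr_pdivlMr// in hy; apply: le_lt_trans hy.
by rewrite mulrC ler_wpM2l// lerDl.
Qed.

(** The ball of radius 2d contains ]y - d, y + d], including its end point, at the
    price of a factor 2. *)
Lemma oint_davg d y (v : E) (e : R) : 0 < d ->
  (davg (fun t => rnorm (g t - v))%R y (2 * d)%R <= e%:E)%E ->
  rnorm (oint (y - d) (y + d) g - oint (y - d) (y + d) (fun=> v)) <=
  2 * d * (rnorm (g y - v) + 2 * e).
Proof.
move=> d0; have d2 : 0 < 2 * d by rewrite mulr_gt0.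
set psi := fun t => rnorm (g t - v).
have mpsi : measurable_fun setT psi by apply: measurable_rnorm; exact: smeasB (smeas_cst v).
rewrite /davg /iavg lebesgue_measure_ball; last exact: ltW.
rewrite inver gt_eqF; last by rewrite pmulrn_lgt0.
rewrite lee_pdivrMl; last by rewrite pmulrn_lgt0.
set B : set R := ball y (2 * d); set I := (\int[mu]_(t in B) _)%E => hI.
have bv := bounded_smeas_cst v.
have h := bint_dist cE (compactly_signed_itv (y - d) (y + d) bg)
  (compactly_signed_itv (y - d) (y + d) bv).
rewrite -lee_fin !ointE; apply: (le_trans h).
have yd : y - d <= y + d by lra.
pose s t : R := if y - d <= t <= y + d then psi y else 0.
have ms : measurable_fun setT s.
  have -> : s = fun t => if t \in `[y - d, y + d] then psi y else 0.
    by apply/funext => t; rewrite in_itv.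
  apply: measurable_fun_ifT => //; apply: (measurable_fun_bool true).
  by rewrite setTI; exact: measurable_itv.
have mc : measurable_fun setT (fun t => `|psi t - psi y|).
  have mpsi' : measurable_fun setT (fun t => psi t - psi y).
    by apply: measurable_funB; [exact: mpsi|exact: measurable_cst].
  exact: (measurableT_comp (@normr_measurable R setT) mpsi').
pose w t : R := if t \in B then `|psi t - psi y| else 0.
have mw : measurable_fun setT w.
  apply: measurable_fun_ifT => //; apply: (measurable_fun_bool true).
  rewrite setTI (_ : _ @^-1` _ = B); first exact: measurable_ball.
  by apply/seteqP; split=> t /= tB; [exact: set_mem|exact: mem_set].
have w0 t : 0 <= w t by rewrite /w; case: ifP.
have s0 t : 0 <= s t by rewrite /s; case: ifP => // _; exact: rnorm_ge0.
have Iw : (I = \int[mu]_t (w t)%:E)%E.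
  rewrite /I integral_mkcond; apply: eq_integral => t _.
  by rewrite patchE /w; case: ifP.
have step : (\int[mu]_t (rnorm (signed_itv (y - d) (y + d) t *: g t -
    signed_itv (y - d) (y + d) t *: v))%R%:E <= \int[mu]_t ((w t)%:E + (s t)%:E))%E.
  apply: ge0_le_integral => //.
  - by move=> t _; rewrite lee_fin rnorm_ge0.
  - by apply: measurable_dist; apply: (compactly_signed_itv _ _ _).1.1.
  - by apply: emeasurable_funD; exact/measurable_EFinP.
  move=> t _; rewrite -scalerBr rnorm_scale -EFinD lee_fin.
  have [tyd|ntyd] := boolP (y - d <= t <= y + d); last first.
    by rewrite signed_itv_out// cmod0 mul0r addr_ge0.
  have -> : s t = psi y by rewrite /s tyd.
  have -> : w t = `|psi t - psi y|.
    rewrite /w ifT// inE /B -ball_normE /= ltr_norml.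
    by move: tyd d0; lra.
  apply: (@le_trans _ _ (psi t)).
    by rewrite ler_piMl ?rnorm_ge0// cmod_signed_itv.
  by have := ler_norm (psi t - psi y); lra.
have mw' : measurable_fun setT (EFin \o w) by exact/measurable_EFinP.
have ms' : measurable_fun setT (EFin \o s) by exact/measurable_EFinP.
apply: (le_trans step).
have -> : (\int[mu]_t ((w t)%:E + (s t)%:E) = \int[mu]_t (w t)%:E + \int[mu]_t (s t)%:E)%E.
  by apply: (ge0_integralD mu measurableT _ mw' _ ms') => t _; rewrite lee_fin.
have hs : (\int[mu]_t (s t)%:E <= (psi y * (y + d - (y - d)))%R%:E)%E.
  apply: integral_itv_le => //; first exact: rnorm_ge0.
    by move=> t; rewrite /s; case: ifP => _; rewrite ?lexx ?rnorm_ge0.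
  by move=> t /negbTE; rewrite /s => ->.
rewrite -Iw; apply: (le_trans (leeD hI hs)); rewrite -EFinM -EFinD lee_fin.
by rewrite -[rnorm (g y - v)]/(psi y) -mulr_natr le_eqVlt; apply/orP; left; apply/eqP; ring.
Qed.

Lemma average_davg d y (v : E) (e : R) : 0 < d ->
  (davg (fun t => rnorm (g t - v))%R y (2 * d)%R <= e%:E)%E ->
  rnorm (average g d y - g y) <= 2 * (rnorm (g y - v) + e).
Proof.
move=> d0 he; have d2 : 0 < 2 * d by rewrite mulr_gt0.
have h := oint_davg d0 he.
have hv : (2 * d)^-1%:C%C *: oint (y - d) (y + d) (fun=> v) = v.
  have yd : y + d - (y - d) = 2 * d by ring.
  by rewrite oint_cst// yd scalerA -rmorphM mulVf ?scale1r// gt_eqF.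
apply: (le_trans (rnorm_tri v _ _)); rewrite [rnorm (v - _)]rnormB.
have : rnorm (average g d y - v) <= rnorm (g y - v) + 2 * e.
  rewrite -{1}hv /average -scalerBr rnorm_scale cmod_inv_double//.
  by rewrite mulrC ler_pdivrMr// mulrC.
lra.
Qed.

(** Lebesgue differentiation for vector valued functions: apply the scalar theorem
    to the distances of g to the countably many values of its approximants. *)
Lemma average_ae : {ae mu, forall y, forall e : R, 0 < e ->
  exists2 r : R, 0 < r & forall d, 0 < d < r -> rnorm (average g d y - g y) <= e}.
Proof.
have [s ss ls] := sg.
pose v n j : E := nth 0 (finmap.enum_fset (fset_set (range (s n)))) j.
have key : {ae mu, forall y, forall n j, lebesgue_pt (fun t => rnorm (g t - v n j)) y}.
  apply/ae_foralln => n; apply/ae_foralln => j.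
  apply: lebesgue_differentiation; split.
  - by apply: measurable_rnorm; exact: smeasB (smeas_cst _).
  - exact: openT.
  move=> K _ cK; have mK := compact_measurable cK.
  apply: (@le_lt_trans _ _ (\int[mu]_(x in K) (M + rnorm (v n j))%R%:E)%E).
    have mn : measurable_fun K (fun t => `|rnorm (g t - v n j)|%R%:E).
      have mg : measurable_fun setT (fun t => rnorm (g t - v n j)).
        by apply: measurable_rnorm; exact: smeasB (smeas_cst _).
      have /measurable_EFinP := measurableT_comp (@normr_measurable R setT) mg.
      exact: measurable_funTS.
    apply: (ge0_le_integral mu mK _ mn (measurable_cst _)) => t _; rewrite lee_fin//.
    rewrite ger0_norm ?rnorm_ge0//.
    by apply: (le_trans (rnorm_subr _ _)); rewrite lerD2r.
  rewrite integral_cst//= lte_mul_pinfty ?lee_fin ?addr_ge0 ?rnorm_ge0//.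
  exact: compact_finite_measure.
apply: negligibleS key => y; apply: contra_not => hy e e0.
have e8 : 0 < e / 4 by lra.
have [n hn] := ls y _ e8; have {}hn := hn n (leqnn n).
have [j jv] : exists j, v n j = s n y.
  have : s n y \in finmap.enum_fset (fset_set (range (s n))).
    by rewrite in_fset_set; [rewrite inE; exists y|exact: (ss n).1].
  by move=> /(nthP 0)[j _ <-]; exists j.
have hl : \forall r \near (0 : R)^'+, (davg (fun t => rnorm (g t - v n j))%R y r <= (e / 4)%:E)%E.
  have := hy n j; rewrite /lebesgue_pt => hh.
  have := hh [set z | (z <= (e / 4)%:E)%E]; apply.
  have : nbhs 0%E [set z : \bar R | (z < (e / 4)%:E)%E].
    by apply: open_ereal_lt'; rewrite lte_fin.
  by apply: filterS => z /= /ltW.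
have [r r0 hr] := at_right0_inv hl.
exists (r / 2); first by rewrite divr_gt0.
move=> d /andP[d0 dr]; have d2 : 0 < 2 * d < r by lra.
have := average_davg d0 (hr _ d2); rewrite jv (rnormB (g y)); lra.
Qed.

(** Bounded convergence, applied to [average_ae]. *)
Lemma average_mean (T : R) : 0 <= T -> forall e : R, 0 < e -> exists N, forall n, (N <= n)%N ->
  (\int[mu]_y (if `|y| <= T then rnorm (average g n.+1%:R^-1 y - g y) else 0)%R%:E < e%:E)%E.
Proof.
move=> T0 e e0; apply: cvge0_lt => //.
have d0 n : 0 < n.+1%:R^-1 :> R by rewrite invr_gt0 ltr0n.
apply: (@bounded_convergence0 _ T (M + M)).
- move=> n; apply: measurable_fun_ifT => //.
    apply: measurable_fun_ler => //; exact: measurableT_comp.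
  by apply: measurable_rnorm; apply: smeasB => //; exact: smeas_average.
- move=> n y; case: ifP => _; last by rewrite lexx addr_ge0.
  rewrite rnorm_ge0; apply: (le_trans (rnorm_subr _ _)).
  by apply: lerD => //; exact: average_bound.
- by move=> n y; rewrite ltNge => /negbTE ->.
apply: negligibleS average_ae => y; apply: contra_not => hy.
apply/cvgrPdist_le => e' e'0; have [r r0 hr] := hy _ e'0.
have [N hN] := invS_small r0; exists N => // n /= /hN hn; rewrite sub0r normrN; case: ifP => _; last by rewrite normr0 ltW.
by rewrite ger0_norm ?rnorm_ge0// hr// d0.
Qed.

End Averages.

(** * Holomorphic functions on the closed strip *)

Section StripFunctions.
Context (R : realType).
Implicit Types (E : normedModType R[i]) (c : R[i]^o -> R[i]^o).

Lemma strip_continuousD E (v w : R[i]^o -> E) : strip_continuous v -> strip_continuous w ->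
  strip_continuous (fun z => v z + w z).
Proof.
move=> /strip_continuous_cvg cv /strip_continuous_cvg cw; apply/strip_continuous_cvg => z Sz.
by apply: cvgD; [exact: cv|exact: cw].
Qed.

Lemma strip_continuous_scale E c (v : R[i]^o -> E) : strip_continuous c -> strip_continuous v ->
  strip_continuous (fun z => c z *: v z).
Proof.
move=> /strip_continuous_cvg cc /strip_continuous_cvg cv; apply/strip_continuous_cvg => z Sz.
by apply: cvgZ; [exact: cc|exact: cv].
Qed.

Lemma strip_continuous_holo2 E (v : R[i]^o -> E) :
  (forall z, closed_strip z -> holo2_at v z) -> strip_continuous v.
Proof.
move=> hv z Sz e e0; have [d hd] := holo2_deriv (hv z Sz).
by have [r r0 hr] := cderiv_continuous hd e0; exists r => // w _; exact: hr.
Qed.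

(** Continuity on the closed strip and decay at infinity are the hypotheses of the
    maximum principle on the unbounded strip. *)
Definition strip_holomorphic E (v : R[i]^o -> E) :=
  [/\ forall z, open_strip z -> holo2_at v z, strip_continuous v &
      exists C : R, forall z, closed_strip z -> rnorm (v z) * (1 + `|complex.Im z|) <= C].

Lemma strip_holomorphicD E (v w : R[i]^o -> E) : strip_holomorphic v -> strip_holomorphic w ->
  strip_holomorphic (fun z => v z + w z).
Proof.
move=> [hv cv [C hC]] [hw cw [D hD]]; split; last 1 first.
- exists (C + D) => z Sz; apply: le_trans (lerD (hC z Sz) (hD z Sz)).
  by rewrite -mulrDl ler_wpM2r ?rnormD// addr_ge0.
- by move=> z Sz; apply: holo2D; [exact: hv|exact: hw].
- exact: strip_continuousD.
Qed.

Lemma strip_holomorphic_scale E c (v : R[i]^o -> E) (B : R) :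
  (forall z, closed_strip z -> holo2_at c z) -> (forall z, closed_strip z -> cmod (c z) <= B) ->
  strip_holomorphic v -> strip_holomorphic (fun z => c z *: v z).
Proof.
move=> hc cB [hv cv [C hC]]; split; last 1 first.
- exists (B * C) => z Sz; rewrite rnorm_scale -mulrA; apply: ler_pM => //.
  + exact: cmod_ge0.
  + by rewrite mulr_ge0 ?rnorm_ge0// addr_ge0.
  + exact: cB.
  + exact: hC.
- by move=> z Sz; apply: holo2M; [exact: hc (open_closed_strip Sz)|exact: hv].
- by apply: strip_continuous_scale => //; exact: strip_continuous_holo2.
Qed.

(** On a long rectangle the horizontal sides contribute at most e. *)
Lemma strip_max E (v : R[i]^o -> E) (m : R) : strip_holomorphic v -> 0 <= m ->
  (forall k y, rnorm (v (bpoint k y)) <= m) -> forall z, closed_strip z -> rnorm (v z) <= m.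
Proof.
move=> [hv cv [C hC]] m0 hm [x0 y0] S0; apply/ler_addgt0Pr => e e0.
have C0 : 0 <= C.
  by apply: le_trans (hC _ S0); rewrite mulr_ge0 ?rnorm_ge0// addr_ge0.
pose Y := C / e + `|y0| + 1; have Ce : 0 <= C / e by rewrite divr_ge0// ltW.
have ny := normr_ge0 y0; have Y0 : 0 <= Y by rewrite /Y; lra.
have := @max_principle R 0 1 (- Y) Y (m + e) (fun x y => 0 < x < 1 /\ - Y < y < Y)
  (fun x y => rnorm (v (Complex x y))).
apply=> //; try lra.
- move=> x y x01 yY d d0; have [r r0 hr] := cv (Complex x y) x01 _ d0.
  exists r => // x' y' x'01 _ hh; apply: (le_lt_trans (rnorm_lip _ _)); apply: hr => //.
  by apply: le_lt_trans hh; exact: cmod_complex.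
- by move=> x y [x01 _]; apply: holo2_four_point; exact: hv.
- move=> x y x01 yY; have [x00|x00] := eqVneq x 0.
    by move=> _; have := hm false y; rewrite /bpoint /= x00; lra.
  have [x1|x1] := eqVneq x 1.
    by move=> _; have := hm true y; rewrite /bpoint /= x1; lra.
  move=> nU; have yY' : `|y| = Y.
    apply/eqP; rewrite eq_le ler_norml yY andTb leNgt ltr_norml; apply/negP => hy; apply: nU.
    by split=> //; rewrite !lt_neqAle eq_sym x00 x1.
  have := hC (Complex x y) x01; rewrite /= yY'.
  have Ye : C <= e * (1 + Y).
    have -> : e * (1 + Y) = C + e * (`|y0| + 2) by rewrite /Y; field; rewrite gt_eqF.
    by rewrite lerDl mulr_ge0// ?ltW//; lra.
  move=> h; have Y1 : 0 < 1 + Y by lra.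
  have : rnorm (v (Complex x y)) <= e by rewrite -(ler_pM2r Y1); exact: le_trans h Ye.
  lra.
- by have := ler_norm y0; have := ler_norm (- y0); rewrite normrN /Y; lra.
Qed.

End StripFunctions.

(** * Holomorphic majorants *)

Lemma lipschitz_measurable (R : realType) (b : R -> R) (K : R) : 0 <= K ->
  (forall y y', `|b y - b y'| <= K * `|y - y'|) -> measurable_fun setT b.
Proof.
move=> K0 bK; apply: continuous_measurable_fun => y; apply/cvgrPdist_lt => e e0.
have K1 : 0 < K + 1 by lra.
have eK : 0 < e / (K + 1) by rewrite divr_gt0.
apply: filterS (nbhsx_ballx y _ eK) => t; rewrite -ball_normE /= ltr_pdivlMr// => hy.
by apply: (le_lt_trans (bK _ _)); apply: le_lt_trans hy; rewrite mulrC ler_wpM2l//; lra.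
Qed.

Section RiemannSums.
Context (R : realType).
Local Notation mu := (@lebesgue_measure R).

(** On each of the n intervals b varies by at most K d. *)
Lemma riemann_sum (b : R -> R) (K a d : R) n : 0 <= K -> 0 <= d -> (forall y, 0 <= b y) ->
  (forall y y', `|b y - b y'| <= K * `|y - y'|) ->
  ((\sum_(j < n) d * b (a + j%:R * d))%:E <=
   \int[mu]_(y in `[a, (a + n%:R * d)%R[) (b y + K * d)%R%:E)%E.
Proof.
move=> K0 d0 b0 bK; have mb : measurable_fun setT (fun y => (b y + K * d)%:E).
  apply/measurable_EFinP; by apply: measurable_funD => //; exact: lipschitz_measurable bK.
have bd0 y : 0 <= b y + K * d by rewrite addr_ge0// mulr_ge0.
elim: n => [|n IH].
  by rewrite big_ord0; apply: integral_ge0 => y _; rewrite lee_fin.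
rewrite big_ord_recr/= EFinD.
have ad : a + n%:R * d <= a + n.+1%:R * d by rewrite -natr1 mulrDl mul1r; lra.
have an : a <= a + n%:R * d by rewrite lerDl mulr_ge0.
have -> : `[a, a + n.+1%:R * d[%classic =
    `[a, a + n%:R * d[%classic `|` `[a + n%:R * d, a + n.+1%:R * d[%classic.
  apply/seteqP; split=> y /=; rewrite !in_itv/=.
    by move=> /andP[h1 h2]; case: (ltP y (a + n%:R * d)) => h; [left|right]; rewrite ?h1 ?h2.
  by move=> [|] /andP[h1 h2]; apply/andP; split; lra.
rewrite ge0_integral_setU//; last first.
- apply/disj_setPS => y [] /=; rewrite !in_itv/= => /andP[_ h1] /andP[h2 _]; lra.
- by move=> y _; rewrite lee_fin.
- exact: (measurable_funTS mb).
apply: leeD => //.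
apply: (@le_trans _ _ (\int[mu]_(y in `[(a + n%:R * d)%R, (a + n.+1%:R * d)%R[) (b (a + n%:R * d))%R%:E)%E).
  rewrite integral_cst//= lebesgue_measure_itv/= lte_fin.
  case: ltP => h; first by rewrite -EFinB -EFinM lee_fin -natr1 mulrDl mul1r; lra.
  rewrite mule0 lee_fin; have -> : d = 0 by move: h; rewrite -natr1 mulrDl mul1r; lra.
  by rewrite mul0r.
apply: (ge0_le_integral mu (measurable_itv _) _ (measurable_cst _) (measurable_funTS mb)).
  by move=> y _; rewrite lee_fin.
move=> y; rewrite /= in_itv/= => /andP[h1 h2]; rewrite lee_fin.
have := bK (a + n%:R * d) y; rewrite ler_norml => /andP[_ h3].
have : K * `|a + n%:R * d - y| <= K * d.
  rewrite ler_wpM2l// ler_norml; move: h1 h2; rewrite -natr1 mulrDl mul1r.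
  by move: (n%:R * d) => q; lra.
lra.
Qed.

End RiemannSums.

Section Majorant.
Context (R : realType).
Local Notation mu := (@lebesgue_measure R).

Lemma Re_sum n (F : 'I_n -> R[i]) :
  complex.Re (\sum_(j < n) F j) = \sum_(j < n) complex.Re (F j).
Proof.
elim: n F => [|n IH] F; first by rewrite !big_ord0.
by rewrite !big_ord_recr/= -IH; case: (\sum_(j < n) _) (F ord_max) => [? ?] [? ?].
Qed.

Lemma cmod_ge_Re (z : R[i]) (a : R) : 0 < a -> a <= complex.Re z ->
  [/\ z != 0, a <= cmod z & cmod z^-1 <= a^-1].
Proof.
move=> a0 az; have h : a <= cmod z.
  by apply: (le_trans az); apply: (le_trans (ler_norm _)); exact: ler_Re.
have z0 : 0 < cmod z by exact: lt_le_trans h.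
by split=> //; [rewrite -cmod_gt0|rewrite cmodV lef_pV2].
Qed.

(** Up to the displacement d, a sum of two Poisson kernels for half planes, with
    poles on the two boundary lines at height t. *)
Definition pole_pair (d t : R) (z : R[i]^o) : R[i]^o :=
  (z + Complex d (- t))^-1 + (Complex (1 + d) t - z)^-1.

Section PolePair.
Context (d t : R) (d0 : 0 < d).

Let left_pole (z : R[i]) : closed_strip (z : R[i]^o) ->
  d <= complex.Re z + d <= complex.Re (z + Complex d (- t)).
Proof. by case: z => x y; rewrite /closed_strip /= => /andP[x0 x1]; move: d0; lra. Qed.

Let right_pole (z : R[i]) : closed_strip (z : R[i]^o) ->
  d <= (1 - complex.Re z) + d <= complex.Re (Complex (1 + d) t - z).
Proof. by case: z => x y; rewrite /closed_strip /= => /andP[x0 x1]; move: d0; lra. Qed.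

Lemma holo2_pole_pair (z : R[i]) : closed_strip (z : R[i]^o) -> holo2_at (pole_pair d t) z.
Proof.
move=> Sz; have /andP[h1 /(le_trans h1) h2] := left_pole Sz.
have /andP[h3 /(le_trans h3) h4] := right_pole Sz.
apply: holo2D; apply: holo2V.
- by apply: holo2D; [exact: holo2_id|exact: holo2_cst].
- by have [] := cmod_ge_Re d0 h2.
- apply: holo2D; first exact: holo2_cst.
  have := holo2M (holo2_cst (-1 : R[i]^o) z) (holo2_id z).
  by congr holo2_at; apply/funext => w; rewrite -[RHS]scaleN1r.
- by have [] := cmod_ge_Re d0 h4.
Qed.

Lemma Re_pole_pair (x y : R) : complex.Re (pole_pair d t (Complex x y)) =
  (x + d) / ((x + d) ^+ 2 + (y - t) ^+ 2) + (1 + d - x) / ((1 + d - x) ^+ 2 + (t - y) ^+ 2).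
Proof. by []. Qed.

Lemma Re_pole_pair_ge0 (z : R[i]) : closed_strip (z : R[i]^o) -> 0 <= complex.Re (pole_pair d t z).
Proof.
case: z => x y Sxy; have [x0 x1] : 0 <= x /\ x <= 1 by apply/andP; exact: Sxy.
move: d0; rewrite Re_pole_pair => d0'; have sq (p q : R) : 0 <= p ^+ 2 + q ^+ 2 by rewrite addr_ge0 ?sqr_ge0.
by apply: addr_ge0; apply: divr_ge0 => //; lra.
Qed.

Lemma Re_pole_pair_boundary k (y : R) : `|y - t| <= d ->
  (2 * d)^-1 <= complex.Re (pole_pair d t (bpoint k y)).
Proof.
move=> yt; have q2 : (y - t) ^+ 2 <= d ^+ 2.
  by rewrite -real_normK ?num_real//; apply: lerXn2r; rewrite ?nnegrE// ltW.
have [s0 dd] : 0 <= (y - t) ^+ 2 /\ 0 < d ^+ 2 by rewrite sqr_ge0 exprn_gt0.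
have sq (p q : R) : 0 <= p ^+ 2 + q ^+ 2 by rewrite addr_ge0 ?sqr_ge0.
have d0' := ltW d0.
have key : (2 * d)^-1 <= d / (d ^+ 2 + (y - t) ^+ 2).
  rewrite ler_pdivlMr; last lra.
  by rewrite ler_pdivrMl; [rewrite -mulrA -expr2; lra|rewrite mulr_gt0].
rewrite /bpoint Re_pole_pair; case: k => /=.
  have -> : 1 + d - 1 = d by ring.
  rewrite -(sqrrN (t - y)) opprB ler_wpDl//; apply: divr_ge0 => //; lra.
by rewrite add0r ler_wpDr//; apply: divr_ge0 => //; lra.
Qed.

Lemma cmod_pole_pair (x : R) : 0 < x < 1 -> cmod (pole_pair d t x%:C%C) <= x^-1 + (1 - x)^-1.
Proof.
move=> /andP[x0 x1]; have Sx : closed_strip (x%:C%C : R[i]^o) by rewrite /closed_strip /= !ltW.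
have /andP[_ h2] := left_pole Sx; have /andP[_ h4] := right_pole Sx.
have x1' : 0 < 1 - x by lra.
apply: (le_trans (cmodD _ _)); apply: lerD.
  have h : x <= complex.Re (x%:C%C + Complex d (- t)) by move: h2 d0 => /=; lra.
  by have [] := cmod_ge_Re x0 h.
have h : 1 - x <= complex.Re (Complex (1 + d) t - x%:C%C) by move: h4 d0 => /=; lra.
by have [] := cmod_ge_Re x1' h.
Qed.

End PolePair.

(** A function b on the two boundary lines which is small in mean is majorized there
    by the real part of a holomorphic function H which is small at theta: for H
    take a Riemann sum of the Poisson integral of b. *)
Lemma majorant (b : R -> R) (K T theta e e' : R) : 0 <= K -> 0 < T -> (forall y, 0 <= b y) ->
  (forall y y', `|b y - b y'| <= K * `|y - y'|) -> 0 < theta < 1 -> 0 < e ->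
  (\int[mu]_y (if `|y| <= T then b y else 0)%R%:E <= e'%:E)%E ->
  exists H : R[i]^o -> R[i]^o,
    [/\ forall z, closed_strip z -> holo2_at H z,
        forall z, closed_strip z -> e <= complex.Re (H z),
        cmod (H theta%:C%C) <= e + (e' + e) * (theta^-1 + (1 - theta)^-1) &
        forall k y, `|y| < T -> b y <= 2 * complex.Re (H (bpoint k y))].
Proof.
move=> K0 T0 b0 bK th e0 hI.
pose A := 8 * T ^+ 2 * K; have A0 : 0 <= A by apply: mulr_ge0 => //; apply: mulr_ge0 => //; exact: sqr_ge0.
(* enough intervals for the discretization error 4 T K d to be at most e *)
pose n := Num.bound (A / e); pose d := 2 * T / n.+1%:R.
have n0 : 0 < n.+1%:R :> R by rewrite ltr0n.
have d0 : 0 < d by rewrite divr_gt0// mulr_gt0.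
have nd : n.+1%:R * d = 2 * T by rewrite /d mulrCA mulfV ?mulr1// gt_eqF.
have small : 4 * T * K * d <= e.
  have -> : 4 * T * K * d = A / n.+1%:R by rewrite /A /d; field; rewrite gt_eqF.
  rewrite ler_pdivrMr// mulrC -ler_pdivrMr//; apply: ltW.
  have : A / e < n%:R by rewrite archi_boundP// divr_ge0// ltW.
  by move/lt_trans; apply; rewrite ltr_nat.
pose t j : R := - T + j%:R * d.
(* c j majorizes b on the interval from t j to t (j + 1) *)
pose c j := b (t j) + K * d.
have c0 j : 0 <= c j by rewrite addr_ge0// mulr_ge0// ltW.
have cd0 j : 0 <= c j * d by rewrite mulr_ge0// ltW.
pose H (z : R[i]^o) : R[i]^o := e%:C%C + \sum_(j < n.+1) (c j * d)%:C%C * pole_pair d (t j) z.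
have ReH z : complex.Re (H z) = e + \sum_(j < n.+1) c j * d * complex.Re (pole_pair d (t j) z).
  have ReD (w w' : R[i]) : complex.Re (w + w') = complex.Re w + complex.Re w'.
    by case: w w' => [? ?] [? ?].
  rewrite /H ReD Re_sum; congr (_ + _); apply: eq_bigr => j _.
  by case: (pole_pair _ _ _) => p q /=; rewrite mul0r subr0.
have sum_small : \sum_(j < n.+1) c j * d <= e' + e.
  have d0' := ltW d0; have := riemann_sum (- T) n.+1 K0 d0' b0 bK.
  rewrite nd (_ : - T + 2 * T = T); last by ring.
  have mb : measurable_fun setT (fun y => (b y)%:E).
    by apply/measurable_EFinP; exact: lipschitz_measurable bK.
  have -> : (\int[mu]_(y in `[(- T)%R, T[) (b y + K * d)%R%:E =
      \int[mu]_(y in `[(- T)%R, T[) (b y)%:E + \int[mu]_(y in `[(- T)%R, T[) (K * d)%R%:E)%E.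
    have mKd : measurable_fun `[(- T)%R, T[%classic (fun=> (K * d)%:E) by exact: measurable_cst.
    rewrite -(ge0_integralD mu (measurable_itv _) _ (measurable_funTS mb) _ mKd)//.
      by move=> y _; rewrite lee_fin.
    by move=> y _; rewrite lee_fin mulr_ge0.
  rewrite integral_cst//= lebesgue_measure_itv/= lte_fin ifT; last lra.
  have hI' : (\int[mu]_(y in `[(- T)%R, T[) (b y)%:E <= e'%:E)%E.
    apply: le_trans hI; rewrite integral_mkcond.
    have mT : measurable_fun setT (fun y : R => (if `|y| <= T then b y else 0)%R%:E).
      apply/measurable_EFinP; apply: measurable_fun_ifT => //; last exact/measurable_EFinP.
      by apply: measurable_fun_ler => //; exact: normr_measurable.
    apply: (ge0_le_integral mu measurableT _ _ mT).
    - by move=> y _; rewrite patchE; case: ifP => _; rewrite ?lee_fin.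
    - apply: (measurable_restrictT _ (measurable_itv _)).1; exact: (measurable_funTS mb).
    move=> y _; rewrite patchE; case: ifPn => [|_]; last by rewrite lee_fin; case: ifP.
    by rewrite inE /= in_itv/= => /andP[y1 y2]; rewrite ifT// ler_norml y1 ltW.
  move=> h; have := le_trans h (leeD2r _ hI').
  rewrite -EFinB -EFinM -EFinD lee_fin => h'.
  have -> : \sum_(j < n.+1) c j * d = \sum_(j < n.+1) d * b (t j) + n.+1%:R * d * (K * d).
    rewrite -mulrA mulr_natl -[X in _ *+ X]card_ord -sumr_const -big_split/=.
    by apply: eq_bigr => j _; rewrite /c; ring.
  by rewrite nd; move: h' small; rewrite /t; move: (\sum_(j < _) _) => S; lra.
exists H; split.
- move=> z Sz; apply: holo2D; first exact: holo2_cst.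
  elim: n.+1 => [|m IH].
    by have := holo2_cst (0 : R[i]^o) z; congr holo2_at; apply/funext => w; rewrite big_ord0.
  have := holo2D IH (holo2M (holo2_cst ((c m * d)%:C%C : R[i]^o) z) (holo2_pole_pair (t m) d0 Sz)).
  by congr holo2_at; apply/funext => w; rewrite big_ord_recr.
- move=> z Sz; rewrite ReH lerDl; apply: sumr_ge0 => j _.
  by rewrite mulr_ge0// Re_pole_pair_ge0.
- apply: (le_trans (cmodD _ _)); rewrite cmod_real gtr0_norm// lerD2l.
  have Q0 : 0 <= theta^-1 + (1 - theta)^-1.
    by rewrite addr_ge0// invr_ge0; lra.
  apply: le_trans (ler_wpM2r Q0 sum_small); rewrite mulr_suml.
  apply: (le_trans (@rnorm_sum R R[i]^o _ _ _)); apply: ler_sum => j _.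
  apply: (@le_trans _ _ (cmod ((c j * d)%:C%C * pole_pair d (t j) theta%:C%C))); first exact: lexx.
  rewrite cmodM cmod_real ger0_norm// ler_wpM2l//.
  exact: cmod_pole_pair.
move=> k y yT; pose x := (y + T) / d.
have yT' : - T < y < T by rewrite -ltr_norml.
have x0 : 0 <= x by rewrite divr_ge0 ?ltW//; lra.
have /andP[j1 j2] := truncn_itv x0; set j := Num.truncn x in j1 j2.
have jn : (j < n.+1)%N.
  rewrite -(ltr_nat R); apply: (le_lt_trans j1); rewrite ltr_pdivrMr// nd; lra.
have hj : 0 <= y - t j <= d.
  move: j1 j2; rewrite ler_pdivlMr// ltr_pdivrMr// -natr1 mulrDl mul1r /t.
  by move: (j%:R * d) => q; lra.
have by_ : b y <= c j.
  have := bK y (t j); rewrite ler_norml => /andP[_].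
  have : K * `|y - t j| <= K * d by rewrite ler_wpM2l// ger0_norm; lra.
  by rewrite /c; lra.
rewrite ReH (bigD1 (Ordinal jn))//=.
have h1 : (2 * d)^-1 <= complex.Re (pole_pair d (t j) (bpoint k y)).
  by apply: Re_pole_pair_boundary => //; rewrite ger0_norm; lra.
have h2 : c j / 2 <= c j * d * complex.Re (pole_pair d (t j) (bpoint k y)).
  apply: le_trans (ler_wpM2l (cd0 j) h1); rewrite le_eqVlt; apply/orP; left; apply/eqP.
  by field; rewrite gt_eqF.
have h3 : 0 <= \sum_(i < n.+1 | i != Ordinal jn) c i * d * complex.Re (pole_pair d (t i) (bpoint k y)).
  by apply: sumr_ge0 => i _; rewrite mulr_ge0// Re_pole_pair_ge0//; exact: closed_bpoint.
move: by_ h2 h3 e0; move: (c j) (c j * d * _) (\sum_(i < _ | _) _) => p q r.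
by clear; lra.
Qed.

End Majorant.

(** * Correction of boundary values *)

Section Correction.
Context (R : realType) (P : compatible_pair R).
Local Notation mu := (@lebesgue_measure R).
Local Notation incl := (@Defs.incl R P _).

Definition has_boundary (v : R[i]^o -> Sigma P) (b : forall k, R -> Defs.space P k) :=
  forall k, (forall y, v (bpoint k y) = incl (b k y)) /\ continuous (b k).

Lemma has_boundaryD v w b c : has_boundary v b -> has_boundary w c ->
  has_boundary (fun z => v z + w z) (fun k y => b k y + c k y).
Proof.
move=> hv hw k; have [vb cb] := hv k; have [wc cc] := hw k; split.
  by move=> y; rewrite vb wc inclD.
by move=> y; apply: cvgD; [exact: cb|exact: cc].
Qed.

Lemma has_boundary_scale (c : R[i]^o -> R[i]^o) v b : strip_continuous c -> has_boundary v b ->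
  has_boundary (fun z => c z *: v z) (fun k y => c (bpoint k y) *: b k y).
Proof.
move=> cc hv k; have [vb cb] := hv k; split; first by move=> y; rewrite vb inclZ.
move=> y; apply: cvgZ; last exact: cb.
apply: (@continuous_realP R R[i]^o (fun y => c (bpoint k y))).2 => {}y e e0.
have [r r0 hr] := cc _ (closed_bpoint k y) _ e0; exists r => // t ty.
apply: hr; first exact: closed_bpoint.
apply: le_lt_trans ty; apply: (le_trans (cmod_complex _ _ _ _)).
by rewrite subrr normr0 add0r.
Qed.

(** Divide by a holomorphic majorant of the boundary values and normalize at
    theta: the value at theta is kept while the boundary values become uniformly
    small, even though they were small in mean only. *)
Lemma correction v b (beta : R -> R) (K T theta e : R) :
  strip_holomorphic v -> has_boundary v b ->
  0 <= K -> 0 < T -> (forall y, 0 <= beta y) ->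
  (forall y y', `|beta y - beta y'| <= K * `|y - y'|) -> 0 < theta < 1 -> 0 < e ->
  (\int[mu]_y (if `|y| <= T then beta y else 0)%R%:E <= e%:E)%E ->
  (forall k y, rnorm (b k y) <= beta y) ->
  (forall k y, T <= `|y| -> rnorm (b k y) <= e) ->
  exists F c, [/\ strip_holomorphic F, has_boundary F c, F theta%:C%C = v theta%:C%C &
    forall k y, rnorm (c k y) <= 2 * e * (1 + 2 * (theta^-1 + (1 - theta)^-1))].
Proof.
move=> hv hb K0 T0 beta0 betaK th e0 hI b1 b2.
have [H [holoH ReH Hth HT]] := majorant K0 T0 beta0 betaK th e0 hI.
have Sth : closed_strip (theta%:C%C : R[i]^o).
  by rewrite /closed_strip /=; have /andP[? ?] := th; rewrite !ltW.
pose c z : R[i]^o := H theta%:C%C * (H z)^-1.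
have holoc z : closed_strip z -> holo2_at c z.
  move=> Sz; have [H0 _ _] := cmod_ge_Re e0 (ReH z Sz).
  exact: (holo2M (holo2_cst (H theta%:C%C) z) (holo2V (holoH z Sz) H0)).
have cB z : closed_strip z -> cmod (c z) <= cmod (H theta%:C%C) * e^-1.
  move=> Sz; have [_ _ He] := cmod_ge_Re e0 (ReH z Sz).
  by rewrite cmodM ler_wpM2l ?cmod_ge0.
exists (fun z => c z *: v z), (fun k y => c (bpoint k y) *: b k y); split.
- exact: (strip_holomorphic_scale holoc cB hv).
- by apply: has_boundary_scale => //; exact: strip_continuous_holo2.
- have [H0 _ _] := cmod_ge_Re e0 (ReH _ Sth).
  by rewrite /c mulfV// scale1r.
move=> k y; have Sy := closed_bpoint k y.
have ey := ReH _ Sy; have [H0 _ _] := cmod_ge_Re e0 ey.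
rewrite rnorm_scale cmodM cmodV mulrAC ler_pdivrMr ?cmod_gt0//.
have h1 : rnorm (b k y) <= 2 * cmod (H (bpoint k y)).
  have h2 : complex.Re (H (bpoint k y)) <= cmod (H (bpoint k y)).
    by apply: (le_trans (ler_norm _)); exact: ler_Re.
  have [yT|Ty] := ltP `|y| T.
    by have := HT k y yT; have := b1 k y; lra.
  by have := b2 k y Ty; lra.
apply: (@le_trans _ _ (cmod (H theta%:C%C) * (2 * cmod (H (bpoint k y))))).
  by rewrite ler_wpM2l ?cmod_ge0.
rewrite mulrCA mulrA ler_wpM2r ?cmod_ge0// -mulrA ler_wpM2l//.
by apply: (le_trans Hth); rewrite le_eqVlt; apply/orP; left; apply/eqP; ring.
Qed.

End Correction.

(** * Vertical averages *)

Section StripAverages.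
Context (R : realType) (P : compatible_pair R).
Local Notation incl := (@Defs.incl R P _).
Context (f G : R[i]^o -> Sigma P) (g : forall k, R -> Defs.space P k) (M : R).
Hypothesis dG : forall z, open_strip z -> cderiv G z (f z).
Hypothesis df : forall z, open_strip z -> exists d, cderiv f z d.
Hypothesis LG : forall z w, closed_strip z -> closed_strip w -> rnorm (G z - G w) <=
  M * (`|complex.Re z - complex.Re w| + `|complex.Im z - complex.Im w|).
Hypothesis sg : forall k, smeas (g k).
Hypothesis gM : forall k y, rnorm (g k y) <= M.
Hypothesis vG : forall k a b, a < b ->
  G (bpoint k b) - G (bpoint k a) = 'i%C *: incl (oint a b (g k)).

Let M0 : 0 <= M.
Proof. exact: le_trans (rnorm_ge0 (g false 0)) (gM false 0). Qed.

Let cX k : @seq_complete R (Defs.space P k) := complete_seq_complete (E := Defs.space P k).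

Definition damp (z : R[i]^o) : R[i]^o := (1 + z)^-1.

(** As G is a primitive of f, this is damp z times the mean value of f on the vertical
    segment of length 2d centred at z. *)
Definition strip_average (d : R) (z : R[i]^o) : Sigma P :=
  damp z *: (((2 * d)^-1%:C%C * 'i^-1)%C *: (G (z + Complex 0 d) - G (z + Complex 0 (- d)))).

Lemma damp_ge1 (z : R[i]^o) : closed_strip z -> 1 <= complex.Re (1 + z).
Proof. by case: z => x y /andP[x0 x1]; move: x0 => /=; lra. Qed.

Lemma holo2_damp z : closed_strip z -> holo2_at damp z.
Proof.
move=> Sz; have [z0 _ _] := cmod_ge_Re ltr01 (damp_ge1 Sz).
by apply: holo2V => //; apply: holo2D; [exact: holo2_cst|exact: holo2_id].
Qed.

Lemma cmod_damp z : closed_strip z -> cmod (damp z) * (1 + `|complex.Im z|) <= 2.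
Proof.
move=> Sz; have [z0 z1 _] := cmod_ge_Re ltr01 (damp_ge1 Sz).
have := ler_Im (1 + z); have -> : complex.Im (1 + z) = complex.Im z.
  by case: (z) => x y /=; rewrite add0r.
rewrite /damp cmodV ler_pdivrMl ?cmod_gt0// => h; lra.
Qed.

Lemma cmod_damp1 z : closed_strip z -> cmod (damp z) <= 1.
Proof. by move=> Sz; have [_ _] := cmod_ge_Re ltr01 (damp_ge1 Sz); rewrite invr1. Qed.

Lemma strip_shift (z : R[i]^o) (d : R) :
  (closed_strip z -> closed_strip (z + Complex 0 d : R[i]^o)) /\
  (open_strip z -> open_strip (z + Complex 0 d : R[i]^o)).
Proof. by case: z => x y; rewrite /closed_strip /open_strip /= addr0. Qed.

Lemma cmod_average_factor (d : R) : 0 < d -> cmod ((2 * d)^-1%:C * 'i^-1)%C = (2 * d)^-1.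
Proof.
move=> d0; rewrite cmodM cmodV cmodi invr1 mulr1; exact: cmod_inv_double.
Qed.

(** The increments of G over segments of length 2d are at most 2dM, so the averages
    are bounded, and damp provides the decay. *)
Lemma strip_average_holomorphic d : 0 < d -> strip_holomorphic (strip_average d).
Proof.
move=> d0; have d2 : 0 < 2 * d by rewrite mulr_gt0.
have holoG z : open_strip z -> holo2_at G z.
  move=> Sz; exists f; split; last exact: df.
  have Sz' : 0 < complex.Re z < 1 := Sz.
  exists (Num.min (complex.Re z) (1 - complex.Re z)); first by rewrite lt_min; lra.
  move=> w; rewrite lt_min => /andP[h1 h2]; apply: dG; rewrite /open_strip /=.
  have := ler_Re (w - z); rewrite ler_norml.
  have -> : complex.Re (w - z) = complex.Re w - complex.Re z by case: (w) (z) => [? ?] [? ?].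
  lra.
have cG t : strip_continuous (fun z => G (z + Complex 0 t)).
  move=> z Sz e e0; have M1 : 0 < 2 * M + 1 by move: M0; lra.
  exists (e / (2 * M + 1)); first by rewrite divr_gt0.
  move=> w Sw; rewrite ltr_pdivlMr// => wz.
  apply: (le_lt_trans (LG ((strip_shift w t).1 Sw) ((strip_shift z t).1 Sz))).
  have -> : complex.Re (w + Complex 0 t) - complex.Re (z + Complex 0 t) = complex.Re (w - z).
    by case: (w) (z) => [? ?] [? ?] /=; ring.
  have -> : complex.Im (w + Complex 0 t) - complex.Im (z + Complex 0 t) = complex.Im (w - z).
    by case: (w) (z) => [? ?] [? ?] /=; ring.
  have h := lerD (ler_Re (w - z)) (ler_Im (w - z)).
  apply: (le_lt_trans (ler_wpM2l M0 h)); apply: le_lt_trans wz.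
  by rewrite mulrDr mulrDr mulr1 mulrCA mulr2n mulrDl mul1r (mulrC _ M) lerDl cmod_ge0.
have cst (c : R[i]^o) : strip_continuous (fun=> c).
  by apply: strip_continuous_holo2 => z _; exact: holo2_cst.
have cst2 z (c : R[i]^o) : holo2_at (fun=> c) z by exact: holo2_cst.
split; last 1 first.
- exists (2 * M) => z Sz; rewrite rnorm_scale mulrAC; apply: ler_pM.
  + by rewrite mulr_ge0 ?cmod_ge0// addr_ge0.
  + exact: rnorm_ge0.
  + exact: cmod_damp.
  rewrite rnorm_scale cmod_average_factor// ler_pdivrMl//.
  apply: (le_trans (LG ((strip_shift z d).1 Sz) ((strip_shift z (- d)).1 Sz))).
  have -> : complex.Re (z + Complex 0 d) - complex.Re (z + Complex 0 (- d)) = 0.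
    by case: (z) => [? ?] /=; ring.
  have -> : complex.Im (z + Complex 0 d) - complex.Im (z + Complex 0 (- d)) = 2 * d.
    by case: (z) => [? ?] /=; ring.
  by rewrite normr0 add0r gtr0_norm// mulrC.
- move=> z Sz; have hd := holo2_damp (open_closed_strip Sz).
  apply: (holo2M hd); apply: (holo2M (cst2 _ _)); apply: holo2D.
    by apply: holo2_shift; apply: holoG; exact: (strip_shift z d).2.
  have := holo2M (cst2 z (-1)) (holo2_shift (holoG _ ((strip_shift z (- d)).2 Sz))).
  by congr holo2_at; apply/funext => w; rewrite scaleN1r.
apply: strip_continuous_scale; first by apply: strip_continuous_holo2; exact: holo2_damp.
apply: strip_continuous_scale => //; apply: strip_continuousD; first exact: cG.
have := strip_continuous_scale (cst (-1)) (cG (- d)).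
by congr strip_continuous; apply/funext => w; rewrite scaleN1r.
Qed.

(** The increments of G along the boundary are integrals of the functions g k. *)
Lemma strip_average_boundary d : 0 < d ->
  has_boundary (strip_average d) (fun k y => damp (bpoint k y) *: average (g k) d y).
Proof.
move=> d0; apply: (@has_boundary_scale R P damp
    (fun z => ((2 * d)^-1%:C%C * 'i^-1)%C *: (G (z + Complex 0 d) - G (z + Complex 0 (- d))))
    (fun k y => average (g k) d y)).
  by apply: strip_continuous_holo2; exact: holo2_damp.
move=> k; split.
  move=> y; have e t : bpoint k y + Complex 0 t = bpoint k (y + t).
    by apply/eqP; rewrite eq_complex /= addr0 !eqxx.
  have yd : y - d < y + d by lra.
  rewrite !e (vG k yd) /average inclZ scalerA -mulrA mulVf ?mulr1//.
  by rewrite -cmod_gt0 cmodi.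
apply/continuous_realP => y e e0.
have Md : 0 < M / d + 1 by rewrite ltr_wpDl// divr_ge0// ltW.
exists (e / (M / d + 1)); first by rewrite divr_gt0.
move=> t; rewrite ltr_pdivlMr// => ty.
apply: (le_lt_trans (average_lipschitz (@cX k) (@sg k) (@gM k) t y d0)).
by apply: le_lt_trans ty; rewrite mulrC ler_wpM2l// lerDl.
Qed.

(** A symmetric difference quotient of a primitive. *)
Lemma strip_average_cvg (z : R[i]^o) : open_strip z -> forall e : R, 0 < e ->
  exists2 r : R, 0 < r & forall d, 0 < d < r -> rnorm (strip_average d z - damp z *: f z) <= e.
Proof.
move=> Sz e e0; have [r r0 hr] := dG Sz e0; exists r => // d /andP[d0 dr].
have d2 : 0 < 2 * d by rewrite mulr_gt0.
rewrite -scalerBr rnorm_scale.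
apply: (le_trans (ler_wpM2r (rnorm_ge0 _) (cmod_damp1 (open_closed_strip Sz)))); rewrite mul1r.
have cd t : cmod (Complex 0 t) = `|t|.
  have -> : Complex 0 t = 'i%C * t%:C%C by apply/eqP; rewrite eq_complex /=; apply/andP; split; apply/eqP; ring.
  by rewrite cmodM cmodi mul1r cmod_real.
have h1 := hr (Complex 0 d) ltac:(by rewrite cd gtr0_norm).
have h2 := hr (Complex 0 (- d)) ltac:(by rewrite cd normrN gtr0_norm).
rewrite cd gtr0_norm// in h1; rewrite cd normrN gtr0_norm// in h2.
have fE : f z = ((2 * d)^-1%:C%C * 'i^-1)%C *: ((Complex 0 d - Complex 0 (- d)) *: f z).
  rewrite scalerA; have -> : Complex 0 d - Complex 0 (- d) = 'i%C * (2 * d)%:C%C.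
    by apply/eqP; rewrite eq_complex /=; apply/andP; split; apply/eqP; ring.
  rewrite -mulrA mulKf; last by rewrite -cmod_gt0 cmodi.
  by rewrite -rmorphM mulVf ?scale1r// gt_eqF.
rewrite fE -scalerBr rnorm_scale cmod_average_factor// ler_pdivrMl// scalerBl.
set A := G (z + _) in h1 *; set B := G (z + _) in h2 *.
have -> : A - B - (Complex 0 d *: f z - Complex 0 (- d) *: f z) =
    A - G z - Complex 0 d *: f z - (B - G z - Complex 0 (- d) *: f z).
  by rewrite [RHS]subr_swap [A - G z - (B - G z)]subr_swap subrr subr0.
apply: (le_trans (rnorm_subr _ _)); lra.
Qed.

End StripAverages.

(** * Uniform limits in the Calderon space *)

Section Limits.
Context (R : realType) (P : compatible_pair R).

Lemma geometric_limit (E : normedModType R[i]) (u : nat -> E) : @seq_complete R E ->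
  (forall n, rnorm (u n.+1 - u n) <= 2^-1 ^+ n) ->
  exists l, tends u l /\ forall n, rnorm (l - u n) <= 2 * 2^-1 ^+ n.
Proof.
move=> cE hu.
have hp n p : rnorm (u (n + p)%N - u n) <= 2 * 2^-1 ^+ n - 2 * 2^-1 ^+ (n + p).
  elim: p => [|p IH]; first by rewrite addn0 !subrr rnorm0.
  apply: (le_trans (rnorm_tri (u (n + p)%N) _ _)); rewrite addnS.
  have := hu (n + p)%N; have := exprS (2^-1 : R) (n + p).
  move: IH; move: (2^-1 ^+ n) (2^-1 ^+ (n + p)) (2^-1 ^+ (n + p).+1) => x y z; lra.
have hn n p : rnorm (u (n + p)%N - u n) <= 2 * 2^-1 ^+ n.
  apply: (le_trans (hp n p)); rewrite gerBl mulr_ge0// exprn_ge0// invr_ge0; lra.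
have [l hl] : exists l, tends u l.
  apply: cE => e e0; have [N hN] := geometric_small 4 e0.
  exists N => m n Nm Nn; apply: (le_lt_trans (rnorm_tri (u N) _ _)).
  have := hn N (m - N)%N; have := hn N (n - N)%N; rewrite !subnKC// [rnorm (u N - _)]rnormB.
  by move: hN; move: (2^-1 ^+ N) => x; lra.
exists l; split=> // n; apply: (@tends_le R E (fun p => u (n + p)%N)) => [|p]; last exact: hn.
move=> e /hl[N hN]; exists N => p Np; apply: hN; exact: leq_trans Np (leq_addl _ _).
Qed.

Lemma A_space_scale (c : R[i]) (F : R[i]^o -> Sigma P) : A_space F ->
  A_space (fun z => c *: F z).
Proof.
move=> [[[dF [M hM]] _] [L [/strip_continuousP cL LF] hg]].
have ext : continuous_extension (fun z => c *: F z) (fun z => c *: L z).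
  split; last by move=> z /LF ->.
  apply/strip_continuousP; apply: (strip_continuous_scale (c := fun=> c)) => //.
  by apply: strip_continuous_holo2 => z _; exact: holo2_cst.
split; [split; [split|by exists (fun z => c *: L z)]|].
- move=> z /dF/derivable_cderivP[d hd]; apply/derivable_cderivP.
  by eexists; exact: (cderiv_scale (cderiv_cst (c : R[i]^o) z) hd).
- by exists (cmod c * M) => z /hM h; rewrite rnorm_scale ler_wpM2l ?cmod_ge0.
exists (fun z => c *: L z) => // k; have [g [cg [B hB] Lg]] := hg k.
exists (fun y => c *: g y); split.
- by move=> y; apply: cvgZr; exact: cg.
- by exists (cmod c * B) => y; rewrite rnorm_scale ler_wpM2l ?cmod_ge0.
by move=> y; rewrite Lg inclZ.
Qed.

(** By the maximum principle, uniform convergence of the boundary values in X_0 and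
    X_1 implies uniform convergence in Sigma on the strip. *)
Lemma limit_A_space (S : nat -> R[i]^o -> Sigma P) (b : nat -> forall k, R -> Defs.space P k)
  (B : R) : (forall n, strip_holomorphic (S n)) -> (forall n, has_boundary (S n) (b n)) ->
  (forall k y, rnorm (b 0%N k y) <= B) ->
  (forall n k y, rnorm (b n.+1 k y - b n k y) <= 2^-1 ^+ n) ->
  exists2 F, A_space F & forall z, closed_strip z -> tends (S^~ z) (F z).
Proof.
move=> hS hb b0 hbn; have cS := sigma_complete (P := P).
have half n : 0 <= 2^-1 ^+ n :> R by rewrite exprn_ge0// invr_ge0.
have Sstep n z : closed_strip z -> rnorm (S n.+1 z - S n z) <= 2^-1 ^+ n.
  move=> Sz; have hN : strip_holomorphic (fun z => (-1 : R[i]) *: S n z).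
    apply: (strip_holomorphic_scale (c := fun=> -1) (B := cmod (-1))) => //.
    by move=> w _; exact: holo2_cst.
  have := strip_max (strip_holomorphicD (hS n.+1) hN) (half n).
  move=> /(_ _ _ Sz); rewrite scaleN1r; apply=> k y.
  rewrite (hb n.+1 k).1 (hb n k).1 scaleN1r -inclB.
  exact: le_trans (rnorm_incl _) (hbn n k y).
have /choice[F hF] z : exists l, closed_strip z ->
    tends (S^~ z) l /\ forall n, rnorm (l - S n z) <= 2 * 2^-1 ^+ n.
  have [Sz|nSz] := pselect (closed_strip z); last by exists 0.
  by have [l hl] := geometric_limit cS (fun n => Sstep n z Sz); exists l.
have cX k : @seq_complete R (Defs.space P k) := complete_seq_complete (E := Defs.space P k).
have hc k : exists c : R -> Defs.space P k, forall y,
    tends (fun n => b n k y) (c y) /\ forall n, rnorm (c y - b n k y) <= 2 * 2^-1 ^+ n.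
  have /choice[c hc] y : exists l, tends (fun n => b n k y) l /\
      forall n, rnorm (l - b n k y) <= 2 * 2^-1 ^+ n.
    exact: geometric_limit (@cX k) (fun n => hbn n k y).
  by exists c.
have cF : strip_continuous F.
  move=> z Sz e e0; have e3 : 0 < e / 3 by lra.
  have [N hN] := geometric_small 2 e3; have [_ cSN _] := hS N.
  have [r r0 hr] := cSN z Sz _ e3; exists r => // w Sw /(hr w Sw) hw.
  apply: (le_lt_trans (rnorm_tri (S N w) _ _)).
  have := rnorm_tri (S N z) (S N w) (F z); have := (hF w Sw).2 N; have := (hF z Sz).2 N.
  by rewrite [rnorm (F z - _)]rnormB; move: hN; move: (2^-1 ^+ N) => x; lra.
have ext : continuous_extension F F by split=> //; exact/strip_continuousP.
exists F; last by move=> z Sz; have [] := hF z Sz.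
split; [split; [split|by exists F]|exists F => // k].
- move=> z Sz; apply/derivable_cderivP.
  have Sz' : 0 < complex.Re z < 1 := Sz.
  pose r := Num.min (complex.Re z) (1 - complex.Re z) / 2.
  have r0 : 0 < r by rewrite divr_gt0// lt_min; lra.
  have inS x y : `|x| <= r -> open_strip (z + Complex x y : R[i]^o).
    have : 2 * r <= complex.Re z by rewrite mulrC divfK ?ge_min ?lexx// gt_eqF.
    have : 2 * r <= 1 - complex.Re z by rewrite mulrC divfK ?ge_min ?lexx ?orbT// gt_eqF.
    rewrite ler_norml /open_strip /= (_ : complex.Re (z + _) = complex.Re z + x).
      lra.
    by case: (z).
  apply: (@uniform_limit_derivable R (Sigma P) cS S F z r r0).
    by move=> n x y /inS h _; have [hSn _ _] := hS n; exact: hSn.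
  move=> e e0; have [N hN] := geometric_small 2 e0; exists N => n x y Nn /inS h _.
  have [_ hFn] := hF _ (open_closed_strip (h y)).
  rewrite rnormB; apply: (le_trans (hFn n)); apply: (le_trans _ (ltW hN)).
  by rewrite ler_pM2l// ler_wiXn2l// invf_le1// ler1n.
- have [_ _ [C hC]] := hS 0%N; exists (C + 2) => z /open_closed_strip Sz.
  have := rnormD (S 0%N z) (F z - S 0%N z); rewrite subrKC.
  have := (hF z Sz).2 0%N; rewrite expr0 mulr1.
  have : rnorm (S 0%N z) <= C.
    by apply: le_trans (hC z Sz); rewrite ler_peMr ?rnorm_ge0// lerDl.
  lra.
have [c hck] := hc k; exists c; split.
- apply/continuous_realP => y e e0; have e3 : 0 < e / 3 by lra.
  have [N hN] := geometric_small 2 e3.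
  have [r r0 hr] := (continuous_realP _).1 (hb N k).2 y _ e3; exists r => // t /hr ht.
  apply: (le_lt_trans (rnorm_tri (b N k t) _ _)).
  have := rnorm_tri (b N k y) (b N k t) (c y); have := (hck t).2 N; have := (hck y).2 N.
  by rewrite [rnorm (c y - _)]rnormB; move: hN; move: (2^-1 ^+ N) => x; lra.
- exists (B + 2) => y; have := rnormD (b 0%N k y) (c y - b 0%N k y); rewrite subrKC.
  by have := (hck y).2 0%N; rewrite expr0 mulr1; have := b0 k y; lra.
move=> y; have [h1 _] := hF _ (closed_bpoint k y); apply: (tends_uniq h1).
have := tends_incl (hck y).1; congr tends; apply/funext => n.
by rewrite (hb n k).1.
Qed.

End Limits.

(** * Summation of the corrections *)

Lemma lipschitz_sum (R : realType) (p q p' q' L d : R) :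
  `|p - p'| <= L * d -> `|q - q'| <= L * d -> `|p + q - (p' + q')| <= (L + L) * d.
Proof.
by move=> h1 h2; rewrite opprD addrACA mulrDl; apply: (le_trans (ler_normD _ _)); exact: lerD.
Qed.

Section Corrections.
Context (R : realType) (P : compatible_pair R).
Local Notation mu := (@lebesgue_measure R).
Context (f G : R[i]^o -> Sigma P) (g : forall k, R -> Defs.space P k) (M theta : R).
Hypothesis th : 0 < theta < 1.
Hypothesis dG : forall z, open_strip z -> cderiv G z (f z).
Hypothesis df : forall z, open_strip z -> exists d, cderiv f z d.
Hypothesis LG : forall z w, closed_strip z -> closed_strip w -> rnorm (G z - G w) <=
  M * (`|complex.Re z - complex.Re w| + `|complex.Im z - complex.Im w|).
Hypothesis sg : forall k, smeas (g k).
Hypothesis gM : forall k y, rnorm (g k y) <= M.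
Hypothesis vG : forall k a b, a < b ->
  G (bpoint k b) - G (bpoint k a) = 'i%C *: Defs.incl (oint a b (g k)).

Let M0 : 0 <= M.
Proof. exact: le_trans (rnorm_ge0 (g false 0)) (gM false 0). Qed.

Let cX k : @seq_complete R (Defs.space P k) := complete_seq_complete (E := Defs.space P k).

Local Notation v n := (strip_average G n.+1%:R^-1).
Local Notation avg n k := (average (g k) n.+1%:R^-1).

Let d0 n : 0 < n.+1%:R^-1 :> R. Proof. by rewrite invr_gt0 ltr0n. Qed.

(** A common bound for the differences of the boundary values on the two lines, as
    [correction] requires. *)
Definition average_gap n m y : R :=
  rnorm (avg n false y - avg m false y) + rnorm (avg n true y - avg m true y).

Lemma average_gap_lipschitz n m : exists2 K : R, 0 <= K & forall y y',
  `|average_gap n m y - average_gap n m y'| <= K * `|y - y'|.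
Proof.
pose L : R := M / n.+1%:R^-1 + M / m.+1%:R^-1.
have L0 : 0 <= L by rewrite addr_ge0// divr_ge0// ltW.
exists (L + L) => [|y y']; first exact: addr_ge0.
have h k : `|rnorm (avg n k y - avg m k y) - rnorm (avg n k y' - avg m k y')| <= L * `|y - y'|.
  apply: (le_trans (rnorm_lip _ _)); rewrite subr_swap mulrDl.
  apply: (le_trans (rnorm_subr _ _)).
  by apply: lerD; exact: (average_lipschitz (@cX k) (@sg k) (@gM k)).
exact: lipschitz_sum (h false) (h true).
Qed.

(** Compare both averages with g. *)
Lemma average_gap_mean (T e : R) : 0 <= T -> 0 < e -> exists N, forall n m, (N <= n)%N -> (N <= m)%N ->
  (\int[mu]_y (if `|y| <= T then average_gap n m y else 0)%R%:E <= e%:E)%E.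
Proof.
move=> T0 e0; have e4 : 0 < e / 4 by lra.
have [N1 h1] := average_mean (@cX false) (@sg false) (@gM false) T0 e4.
have [N2 h2] := average_mean (@cX true) (@sg true) (@gM true) T0 e4.
exists (maxn N1 N2) => n m; rewrite !geq_max => /andP[n1 n2] /andP[m1 m2].
pose r n k (y : R) : R := if `|y| <= T then rnorm (avg n k y - g k y) else 0.
have r0 i k y : (0 <= (r i k y)%:E)%E by rewrite lee_fin /r; case: ifP => // _; exact: rnorm_ge0.
have mif (u : R -> R) : measurable_fun setT u ->
    measurable_fun setT (fun y : R => (if `|y| <= T then u y else 0)%R%:E).
  move=> mu_; apply/measurable_EFinP; apply: measurable_fun_ifT => //.
  by apply: measurable_fun_ler => //; exact: normr_measurable.
have ma i k : smeas (avg i k) := smeas_average (@cX k) (@sg k) (@gM k) (d0 i).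
have mr i k : measurable_fun setT (fun y => (r i k y)%:E).
  by apply: mif; apply: measurable_rnorm; exact: smeasB.
have step : (\int[mu]_y (if `|y| <= T then average_gap n m y else 0)%R%:E <=
    \int[mu]_y (((r n false y)%:E + (r m false y)%:E) + ((r n true y)%:E + (r m true y)%:E)))%E.
  apply: (ge0_le_integral mu measurableT).
  - by move=> y _; rewrite lee_fin; case: ifP => // _; apply: addr_ge0; exact: rnorm_ge0.
  - apply: mif; exact: (measurable_funD (measurable_rnorm (smeasB (ma n false) (ma m false)))
      (measurable_rnorm (smeasB (ma n true) (ma m true)))).
  - exact: (emeasurable_funD (emeasurable_funD (mr n false) (mr m false))
      (emeasurable_funD (mr n true) (mr m true))).
  move=> y _; rewrite -!EFinD lee_fin /r; case: ifP => _; last by rewrite !addr0.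
  rewrite /average_gap; apply: lerD.
    by apply: (le_trans (rnorm_tri (g false y) _ _)); rewrite lerD2l rnormB.
  by apply: (le_trans (rnorm_tri (g true y) _ _)); rewrite lerD2l rnormB.
apply: (le_trans step).
have sum2 k : (\int[mu]_y ((r n k y)%:E + (r m k y)%:E) =
    \int[mu]_y (r n k y)%:E + \int[mu]_y (r m k y)%:E)%E.
  exact: (ge0_integralD mu measurableT (fun y _ => r0 n k y) (mr n k) (fun y _ => r0 m k y) (mr m k)).
have m2' k : measurable_fun setT (fun y => ((r n k y)%:E + (r m k y)%:E)%E).
  exact: (emeasurable_funD (mr n k) (mr m k)).
have p2 k y : (0 <= (r n k y)%:E + (r m k y)%:E)%E by rewrite adde_ge0.
have -> : (\int[mu]_y (((r n false y)%:E + (r m false y)%:E) + ((r n true y)%:E + (r m true y)%:E)) =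
    \int[mu]_y ((r n false y)%:E + (r m false y)%:E) +
    \int[mu]_y ((r n true y)%:E + (r m true y)%:E))%E.
  exact: (ge0_integralD mu measurableT (fun y _ => p2 false y) (m2' false) (fun y _ => p2 true y) (m2' true)).
rewrite !sum2; have -> : e%:E = ((e / 4)%:E + (e / 4)%:E + ((e / 4)%:E + (e / 4)%:E))%E.
  by rewrite -!EFinD; congr (_%:E); lra.
exact: (leeD (leeD (ltW (h1 n n1)) (ltW (h1 m m1))) (leeD (ltW (h2 n n2)) (ltW (h2 m m2)))).
Qed.

(** The averages themselves need not form a Cauchy sequence for the norm of H^oo(X), but
    their differences do after correction. *)
Lemma small_corrections (e : R) : 0 < e -> exists N, forall n m, (N <= n)%N -> (N <= m)%N ->
  exists F c, [/\ strip_holomorphic F, has_boundary F c,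
    F theta%:C%C = v n theta%:C%C - v m theta%:C%C & forall k y, rnorm (c k y) <= e].
Proof.
move=> e0; pose kappa := 1 + 2 * (theta^-1 + (1 - theta)^-1).
have kappa0 : 0 < kappa.
  have t1 : 0 < theta^-1 by rewrite invr_gt0; move: th; lra.
  have t2 : 0 < (1 - theta)^-1 by rewrite invr_gt0; move: th; lra.
  by rewrite /kappa; lra.
pose e1 := e / (2 * kappa); have e10 : 0 < e1 by rewrite divr_gt0// mulr_gt0.
(* outside [-T, T] damp makes the boundary values at most e1 *)
pose T := 4 * M / e1 + 1.
have M4 : 0 <= 4 * M by apply: mulr_ge0 => //; exact: M0.
have T0' : 0 <= 4 * M / e1 := divr_ge0 M4 (ltW e10).
have T0 : 0 < T by rewrite /T; lra.
have [N hN] := average_gap_mean (ltW T0) e10; exists N => n m Nn Nm.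
have [K K0 hK] := average_gap_lipschitz n m.
have gap0 y : 0 <= average_gap n m y by apply: addr_ge0; exact: rnorm_ge0.
have hneg : strip_holomorphic (fun z => (-1 : R[i]) *: v m z).
  apply: (strip_holomorphic_scale (c := fun=> -1) (B := cmod (-1))) => //.
    by move=> w _; exact: holo2_cst.
  exact: (strip_average_holomorphic dG df LG gM (d0 m)).
have hv := strip_holomorphicD (strip_average_holomorphic dG df LG gM (d0 n)) hneg.
have cm1 : strip_continuous (fun=> -1 : R[i]^o).
  by apply: strip_continuous_holo2 => z _; exact: holo2_cst.
have hb := has_boundaryD (strip_average_boundary sg gM vG (d0 n))
  (has_boundary_scale cm1 (strip_average_boundary sg gM vG (d0 m))).
have bE k y : rnorm (damp (bpoint k y) *: avg n k y + (-1 : R[i]) *: (damp (bpoint k y) *: avg m k y)) =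
    cmod (damp (bpoint k y)) * rnorm (avg n k y - avg m k y).
  by rewrite scaleN1r -scalerBr rnorm_scale.
have [||F [c [hF hc Fth cE]]] := correction hv hb K0 T0 gap0 hK th e10 (hN n m Nn Nm).
- move=> k y; rewrite bE; apply: (@le_trans _ _ (rnorm (avg n k y - avg m k y))).
    by rewrite ler_piMl ?rnorm_ge0// cmod_damp1//; exact: closed_bpoint.
  by rewrite /average_gap; case: (k); rewrite ?lerDl ?lerDr rnorm_ge0.
- move=> k y Ty; rewrite bE.
  have h1 : rnorm (avg n k y - avg m k y) <= 2 * M.
    apply: (le_trans (rnorm_subr _ _)); rewrite mulr2n mulrDl mul1r; apply: lerD;
      exact: (average_bound (@cX k) (@sg k) (@gM k)).
  have h2 := cmod_damp (closed_bpoint k y); have y1 : 0 < 1 + `|y| by rewrite ltr_wpDr.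
  have /= h3 := ler_pM (mulr_ge0 (cmod_ge0 _) (ltW y1)) (rnorm_ge0 _) h2 h1.
  rewrite -(ler_pM2r y1) mulrAC; apply: (le_trans h3).
  have h4 : e1 * (1 + T) <= e1 * (1 + `|y|) by rewrite ler_pM2l// lerD2l.
  apply: le_trans h4; have -> : e1 * (1 + T) = 2 * (2 * M) + 2 * e1.
    by rewrite /T; field; rewrite gt_eqF.
  by rewrite lerDl mulr_ge0// ltW.
exists F, c; split=> //; first by rewrite Fth scaleN1r.
move=> k y; apply: (le_trans (cE k y)).
by rewrite /e1 -/kappa le_eqVlt; apply/orP; left; apply/eqP; field; rewrite gt_eqF.
Qed.

(** Along a subsequence the corrections form a convergent series. *)
Lemma corrected_limit : exists2 F, A_space F & F theta%:C%C = damp theta%:C%C *: f theta%:C%C.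
Proof.
have /choice[N hN] : forall i : nat, exists N, forall n m, (N <= n)%N -> (N <= m)%N ->
    exists F c, [/\ strip_holomorphic F, has_boundary F c,
      F theta%:C%C = v n theta%:C%C - v m theta%:C%C & forall k y, rnorm (c k y) <= 2^-1 ^+ i].
  by move=> i; apply: small_corrections; rewrite exprn_gt0// invr_gt0.
(* increasing indices with N i <= s i *)
pose s i := (\sum_(j < i.+1) (N j).+1)%N.
have sN i : (N i <= s i)%N by rewrite /s big_ord_recr/=; apply: leq_trans (leqnSn _) (leq_addl _ _).
have ss i : (s i <= s i.+1)%N by rewrite /s [leqRHS]big_ord_recr/= leq_addr.
have /choice[F hF] i := hN i (s i.+1) (s i) (leq_trans (sN i) (ss i)) (sN i).
have /choice[c hc] i := hF i.
pose S n z := v (s 0%N) z + \sum_(i < n) F i z.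
pose b n k y := damp (bpoint k y) *: avg (s 0%N) k y + \sum_(i < n) c i k y.
have S0 n : (S n.+1 = fun z => S n z + F n z) /\ (b n.+1 = fun k y => b n k y + c n k y).
  split; first by apply/funext => z; rewrite /S big_ord_recr/= addrA.
  by apply/functional_extensionality_dep => k; apply/funext => y; rewrite /b big_ord_recr/= addrA.
have hS n : strip_holomorphic (S n).
  elim: n => [|n IH].
    have := strip_average_holomorphic dG df LG gM (d0 (s 0%N)); congr strip_holomorphic.
    by apply/funext => z; rewrite /S big_ord0 addr0.
  by rewrite (S0 n).1; have [h _ _ _] := hc n; exact: strip_holomorphicD.
have hb n : has_boundary (S n) (b n).
  elim: n => [|n IH].
    have := strip_average_boundary sg gM vG (d0 (s 0%N)).
    have -> : S 0%N = v (s 0%N) by apply/funext => z; rewrite /S big_ord0 addr0.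
    have -> // : b 0%N = fun k y => damp (bpoint k y) *: avg (s 0%N) k y.
    by apply/functional_extensionality_dep => k; apply/funext => y; rewrite /b big_ord0 addr0.
  by rewrite (S0 n).1 (S0 n).2; have [_ h _ _] := hc n; exact: has_boundaryD.
have [||L AL hL] := @limit_A_space R P S b M hS hb.
- move=> k y; rewrite /b big_ord0 addr0 rnorm_scale -[leRHS]mul1r; apply: ler_pM.
  + exact: cmod_ge0.
  + exact: rnorm_ge0.
  + by apply: cmod_damp1; exact: closed_bpoint.
  + exact: (average_bound (@cX k) (@sg k) (@gM k)).
- by move=> n k y; have [_ _ _ h] := hc n; rewrite (S0 n).2 addrAC subrr add0r.
exists L => //; have Sth : open_strip (theta%:C%C : R[i]^o) := th.
apply: (tends_uniq (hL _ (open_closed_strip Sth))).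
have SE n : S n theta%:C%C = v (s n) theta%:C%C.
  elim: n => [|n IH]; first by rewrite /S big_ord0 addr0.
  by rewrite (S0 n).1 IH; have [_ _ -> _] := hc n; rewrite subrKC.
move=> e e0; have e2 : 0 < e / 2 by lra.
have [r r0 hr] := strip_average_cvg dG Sth e2.
have s_ge n : (n <= s n)%N.
  elim: n => [//|n IH]; rewrite /s big_ord_recr/= -/(s n).
  by move: IH; lia.
have [N0 hN0] := invS_small r0; exists N0 => n hn.
rewrite SE; apply: le_lt_trans (hr _ _) _; last by lra.
by rewrite d0 /= hN0//; exact: leq_trans hn (s_ge n).
Qed.

End Corrections.

Theorem mainTheorem1 (R : realType) (P : compatible_pair R) (theta : R)
  (htheta : 0 < theta < 1) :
  [set eval_at theta f | f in [set f : R[i]^o -> Sigma P | Hinfty f]] =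
  calderon_space P theta.
Proof.
apply/seteqP; split=> [_ [f hf <-]|_ [f hf <-]]; last by exists f => //; exact: A_space_Hinfty.
have [G [g [M [dG df LG sgM vG]]]] := Hinfty_primitive hf.
have [F AF Fth] := corrected_limit htheta dG df LG (fun k => (sgM k).1) (fun k => (sgM k).2) vG.
exists (fun z => (1 + theta%:C%C) *: F z); first exact: A_space_scale.
rewrite /eval_at Fth scalerA /damp mulfV ?scale1r//.
have Oth : open_strip (theta%:C%C : R[i]^o) := htheta; have Sth := open_closed_strip Oth.
by have [] := cmod_ge_Re ltr01 (damp_ge1 Sth).
Qed.
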